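(* (1) No simply-connected Riemannian manifold with non-positive constant sectional curvature admits a compact minimal submanifold. (2) In a round sphere $\mathbb S^n(k)$ (the $n$-dimensional sphere of constant sectional curvature $k>0$), there exists no compact minimal submanifold contained in an open geodesic ball whose radius is half of the diameter of $\mathbb S^n(k)$.
   Context: The diameter is the maximum of the Riemannian distance function. Submanifolds are immersed, connected, of dimension at least one and smaller than that of the ambient manifold, and compact submanifolds have no boundary. A submanifold is minimal if its mean curvature vector field vanishes identically. *)

(* Defs.v *)
(* Smooth manifolds, Riemannian metrics, and the second-order geometry of
   immersions, in charts over R^n = 'rV[R]_n.  Tangent vectors are row vectors,
   so that ['J F x] acts on the right and its i-th row is the i-th partial
   derivative of F.  The library norm on 'rV[R]_n is the sup norm; it is used for
   its topology only, and Euclidean products are written [u *m v^T]. *)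
From HB Require Import structures.
From mathcomp Require Import all_boot all_order all_algebra.
From mathcomp Require Import all_classical all_reals all_analysis.
Set Implicit Arguments.
Unset Strict Implicit.
Unset Printing Implicit Defensive.
Import Order.TTheory GRing.Theory Num.Theory.
Import numFieldNormedType.Exports.
Local Open Scope classical_set_scope.
Local Open Scope ring_scope.

Section Smooth.
Context {R : realType}.

Definition partial n (W : normedModType R) (i : 'I_n) (F : 'rV[R]_n -> W)
  : 'rV[R]_n -> W := fun x => 'D_(delta_mx 0 i) F x.

(* Only meant for open U. *)
Fixpoint Ck_on n (W : normedModType R) (k : nat) (U : set 'rV[R]_n)
    (F : 'rV[R]_n -> W) : Prop :=
  if k is k'.+1 then
    (forall x, U x -> differentiable F x) /\
    (forall i, Ck_on k' U (partial i F))
  else forall x, U x -> {for x, continuous F}.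

Definition smooth_on n (W : normedModType R) (U : set 'rV[R]_n)
    (F : 'rV[R]_n -> W) : Prop := forall k, Ck_on k U F.

End Smooth.

Section Manifolds.
Context {R : realType}.

(* [chart_inv] is only meaningful on the open set [chart_img]. *)
Record chart (X : topologicalType) (n : nat) := Chart {
  chart_dom : set X;
  chart_to : X -> 'rV[R]_n;
  chart_inv : 'rV[R]_n -> X;
  chart_dom_open : open chart_dom;
  chart_img_open : open (chart_to @` chart_dom);
  chart_toK : {in chart_dom, cancel chart_to chart_inv};
  chart_to_continuous :
    forall p, chart_dom p -> {for p, continuous chart_to};
  chart_inv_continuous :
    forall x, (chart_to @` chart_dom) x -> {for x, continuous chart_inv} }.

Definition chart_img X n (c : chart X n) : set 'rV[R]_n :=
  chart_to c @` chart_dom c.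

(* The smooth structure is the one generated by the atlas of all [chart_at p].
   Chart images are open in R^n, so manifolds have no boundary. *)
Record smoothManifold (n : nat) := SmoothManifold {
  carrier :> topologicalType;
  manifold_hausdorff : hausdorff_space carrier;
  manifold_second_countable : @second_countable carrier;
  chart_at : carrier -> chart carrier n;
  chart_at_dom : forall p, chart_dom (chart_at p) p;
  chart_at_compatible : forall p q,
    smooth_on (chart_to (chart_at p) @`
                 (chart_dom (chart_at p) `&` chart_dom (chart_at q)))
              (chart_to (chart_at q) \o chart_inv (chart_at p)) }.

Definition chart_coord n (M : smoothManifold n) (p : M) : 'rV[R]_n :=
  chart_to (chart_at p) p.

Definition inner n (G : 'M[R]_n) (u v : 'rV[R]_n) : R := (u *m G *m v^T) 0 0.

(* [metric p x] is the matrix of the metric, at the point of coordinates x, in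
   the coordinate frame of [chart_at p]. *)
Record riemannianManifold (n : nat) := RiemannianManifold {
  manifold :> smoothManifold n;
  metric : manifold -> 'rV[R]_n -> 'M[R]_n;
  metric_smooth : forall p, smooth_on (chart_img (chart_at p)) (metric p);
  metric_sym : forall p x, chart_img (chart_at p) x ->
    (metric p x)^T = metric p x;
  metric_posdef : forall p x, chart_img (chart_at p) x ->
    forall v, v != 0 -> 0 < inner (metric p x) v v;
  metric_compatible : forall p q x,
    let tau := chart_to (chart_at q) \o chart_inv (chart_at p) in
    (chart_to (chart_at p) @`
       (chart_dom (chart_at p) `&` chart_dom (chart_at q))) x ->
    metric p x = 'J tau x *m metric q (tau x) *m ('J tau x)^T }.

End Manifolds.

Arguments chart R X n : clear implicits.
Arguments smoothManifold R n : clear implicits.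
Arguments riemannianManifold R n : clear implicits.

Section Curvature.
Context {R : realType} {n : nat}.
Implicit Types (g : 'rV[R]_n -> 'M[R]_n) (i j k l s : 'I_n).

(* The coefficient of d_k in nabla_(d_i) d_j, nabla the Levi-Civita connection. *)
Definition christoffel g i j k (x : 'rV[R]_n) : R :=
  2^-1 * \sum_l invmx (g x) k l *
    (partial i g x j l + partial j g x i l - partial l g x i j).

(* The coefficient of d_l in R(d_i, d_j) d_k, with
   R(X, Y) = [nabla_X, nabla_Y] - nabla_[X, Y]. *)
Definition riemann g i j k l (x : 'rV[R]_n) : R :=
  partial i (christoffel g j k l) x - partial j (christoffel g i k l) x
  + \sum_s (christoffel g j k s x * christoffel g i s l x
            - christoffel g i k s x * christoffel g j s l x).

Definition curvature_op g (x u v w : 'rV[R]_n) : 'rV[R]_n :=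
  \row_l \sum_i \sum_j \sum_k u 0 i * v 0 j * w 0 k * riemann g i j k l x.

Definition sectional g (x u v : 'rV[R]_n) : R :=
  inner (g x) (curvature_op g x u v v) u /
  (inner (g x) u u * inner (g x) v v - inner (g x) u v ^+ 2).

End Curvature.

Definition constant_sectional_curvature (R : realType) n
    (M : riemannianManifold R n) (k : R) : Prop :=
  forall (p : M) (u v : 'rV[R]_n), row_free (col_mx u v) ->
    sectional (metric p) (chart_coord p) u v = k.

Section SimplyConnected.
Context {R : realType}.

Definition path_connected (X : topologicalType) : Prop :=
  forall x y : X, exists gamma : R -> X,
    [/\ {within `[0, 1], continuous gamma}, gamma 0 = x & gamma 1 = y].

(* H s t is the position at time s of the loop number t of the homotopy. *)
Definition simply_connected (X : topologicalType) : Prop :=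
  [/\ exists x : X, True,
      path_connected X &
      forall gamma : R -> X, {within `[0, 1], continuous gamma} ->
        gamma 0 = gamma 1 ->
        exists H : R * R -> X,
          [/\ {within `[0, 1] `*` `[0, 1], continuous H},
              forall s, s \in `[0, 1] -> H (s, 0) = gamma s,
              forall s, s \in `[0, 1] -> H (s, 1) = gamma 0 &
              forall t, t \in `[0, 1] ->
                H (0, t) = gamma 0 /\ H (1, t) = gamma 0]].

End SimplyConnected.

Arguments simply_connected R X : clear implicits.

Section Immersions.
Context {R : realType} {m n : nat}.
Variable N : smoothManifold R m.

Definition local_rep (M : smoothManifold R n) (f : N -> M) (p : N)
    : 'rV[R]_m -> 'rV[R]_n :=
  chart_to (chart_at (f p)) \o f \o chart_inv (chart_at p).

Definition smooth_map (M : smoothManifold R n) (f : N -> M) : Prop :=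
  continuous f /\
  forall p, exists2 U, open_nbhs (chart_coord p) U & smooth_on U (local_rep f p).

Definition immersion (M : smoothManifold R n) (f : N -> M) : Prop :=
  smooth_map f /\ forall p, row_free ('J (local_rep f p) (chart_coord p)).

Variable M : riemannianManifold R n.
Variable f : N -> M.

Definition induced_metric (p : N) : 'M[R]_m :=
  let J := 'J (local_rep f p) (chart_coord p) in
  J *m metric (f p) (chart_coord (f p)) *m J^T.

(* nabla_(d_i) d_j, nabla the Levi-Civita connection of M, d_i the coordinate
   fields of N pushed forward along f. *)
Definition ambient_derivative (p : N) (i j : 'I_m) : 'rV[R]_n :=
  let F := local_rep f p in let x := chart_coord p in let J := 'J F x in
  partial i (partial j F) x +
  \row_c \sum_a \sum_b
    J i a * J j b * christoffel (metric (f p)) a b c (chart_coord (f p)).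

(* Orthogonal projection of a tangent vector of M at f p to the normal space. *)
Definition normal_part (p : N) (v : 'rV[R]_n) : 'rV[R]_n :=
  let J := 'J (local_rep f p) (chart_coord p) in
  v - v *m metric (f p) (chart_coord (f p)) *m J^T
        *m invmx (induced_metric p) *m J.

Definition second_fundamental_form (p : N) (i j : 'I_m) : 'rV[R]_n :=
  normal_part p (ambient_derivative p i j).

Definition mean_curvature (p : N) : 'rV[R]_n :=
  m%:R^-1 *: \sum_i \sum_j
    invmx (induced_metric p) i j *: second_fundamental_form p i j.

(* Connected manifolds are nonempty; [connected] alone does not exclude the
   empty set. *)
Definition submanifold : Prop :=
  [/\ (0 < m < n)%N, exists p : N, True, connected [set: N] & immersion f].

Definition minimal_submanifold : Prop :=
  submanifold /\ forall p, mean_curvature p = 0.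

Definition compact_minimal_submanifold : Prop :=
  minimal_submanifold /\ compact [set: N].

End Immersions.

Section Distance.
Context {R : realType} {n : nat}.
Variable M : riemannianManifold R n.

(* gamma is C^1 on a neighbourhood of [a, b]. *)
Definition C1_curve (gamma : R -> M) (a b : R) : Prop :=
  forall t, t \in `[a, b] ->
    let u := chart_to (chart_at (gamma t)) \o gamma in
    [/\ {for t, continuous gamma},
        \forall s \near t, derivable u s 1 &
        {for t, continuous (derive1 u)}].

Definition speed (gamma : R -> M) (t : R) : R :=
  let v := derive1 (chart_to (chart_at (gamma t)) \o gamma) t in
  Num.sqrt (inner (metric (gamma t) (chart_coord (gamma t))) v v).

Definition curve_length (gamma : R -> M) (a b : R) : \bar R :=
  (\int[lebesgue_measure]_(t in `[a, b]) (speed gamma t)%:E)%E.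

(* [joined_by p q l]: some piecewise C^1 curve from p to q has length l. *)
Inductive joined_by : M -> M -> \bar R -> Prop :=
| joined_refl p : joined_by p p 0%E
| joined_cons (gamma : R -> M) (a b : R) q l :
    a <= b -> C1_curve gamma a b -> joined_by (gamma b) q l ->
    joined_by (gamma a) q (curve_length gamma a b + l)%E.

Definition riemannian_dist (p q : M) : \bar R :=
  ereal_inf [set l | joined_by p q l].

Definition diameter : \bar R :=
  ereal_sup [set d | exists p q, d = riemannian_dist p q].

Definition open_geodesic_ball (p : M) (r : \bar R) : set M :=
  [set q | (riemannian_dist p q < r)%E].

End Distance.

Definition euclidean_sphere (R : realType) n (k : R) : set 'rV[R]_n.+1 :=
  [set y | (y *m y^T) 0 0 = k^-1].

(* M is, up to the isometry iota, the sphere of radius 1 / sqrt k centred at 0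
   in R^(n+1) with the Riemannian metric induced by the Euclidean one. *)
Definition is_round_sphere (R : realType) n (k : R)
    (M : riemannianManifold R n) : Prop :=
  exists (iota : M -> 'rV[R]_n.+1) (kappa : 'rV[R]_n.+1 -> M),
    [/\ continuous iota /\ (forall p, euclidean_sphere k (iota p)),
        {within euclidean_sphere k, continuous kappa},
        cancel iota kappa /\
          (forall y, euclidean_sphere k y -> iota (kappa y) = y) &
        forall p, let F := iota \o chart_inv (chart_at p) in
          smooth_on (chart_img (chart_at p)) F /\
          (forall x, chart_img (chart_at p) x ->
             'J F x *m ('J F x)^T = metric p x)].

(* Main.v *)
(* Both parts apply the maximum principle to a function u on the ambient
   manifold whose covariant Hessian is lam g for some function lam: if f is
   minimal, then the Laplacian of u o f is m (lam o f), so lam <= 0 at every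
   maximum of u o f.

   (1) In constant curvature k the linear system dc = 0, du = w,
   nabla w = (c - k u) g in the unknowns (c, u, w) is flat.  By Frobenius it has
   local solutions with arbitrary initial values, and on a simply connected
   manifold these extend to global ones by monodromy.  The solution with value
   (1, 0, 0) at a point of the submanifold has c = 1 along it, and u >= 0 at the
   maximum, where lam = 1 - k u > 0.

   (2) In the sphere iota : M -> R^(n+1), Gauss' formula shows that
   u = - <iota p, iota> has lam = - k u.  Comparing the angle between iota p and
   a curve with its arc length gives cos (sqrt k d(p, q)) <= k <iota p, iota q>
   for sqrt k d(p, q) < pi, and great circles bound the diameter by pi / sqrt k.
   Hence u < 0 and lam > 0 on a ball about p of half the diameter. *)
Require Import Defs.
From HB Require Import structures.
From mathcomp Require Import all_boot all_order all_algebra.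
From mathcomp Require Import all_classical all_reals all_analysis.
From mathcomp Require Import ring lra.
Set Implicit Arguments.
Unset Strict Implicit.
Unset Printing Implicit Defensive.
Import Order.TTheory GRing.Theory Num.Theory.
Import numFieldNormedType.Exports.
Local Open Scope classical_set_scope.
Local Open Scope ring_scope.

(** * Matrix-valued functions and partial derivatives *)

(** Every point [p] carries its own chart, so a section of the linear system in (1) is recorded by
    its components in the chart frame at each point. These need not vary continuously with the
    point; monodromy is therefore run on an abstract transport [Phi p y], subject only to local
    invertibility and a local cocycle law. The curvature hypothesis likewise speaks of each point in
    its own chart, which forces the transformation laws of connection and curvature. The first comes
    from uniqueness of the Levi-Civita connection, the second from symmetry of the second
    derivatives of the Jacobian. In (2), differentiating an arc cosine fails at the poles. Instead,
    the cosine of an angle that grows slightly too fast is shown never to be crossed. The inverse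
    [kappa] is only continuous, so the differentiability of great circles in charts has to be
    recovered from that of their images in Euclidean space. *)

Section MatrixCalculus.
Context {R : realType} {V : normedModType R}.

Lemma mx_norm_le m n (A : 'M[R]_(m, n)) (K : R) :
  0 <= K -> (forall i j, `|A i j| <= K) -> `|A| <= K.
Proof.
move=> K0 AK; rewrite [leLHS]/Num.Def.normr/= mx_normrE.
by apply: bigmax_le => // i _; exact: AK.
Qed.

Lemma mx_entry_le m n (A : 'M[R]_(m, n)) i j : `|A i j| <= `|A|.
Proof.
rewrite [leRHS]/Num.Def.normr/= mx_normrE.
exact: (le_bigmax _ (fun ij : 'I_m * 'I_n => `|A ij.1 ij.2|) (i, j)).
Qed.

Lemma mx_norm_mul m n p (A : 'M[R]_(m, n)) (B : 'M[R]_(n, p)) :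
  `|A *m B| <= n%:R * (`|A| * `|B|).
Proof.
apply: mx_norm_le => [|i j]; first by rewrite !mulr_ge0.
rewrite mxE (le_trans (ler_norm_sum _ _ _))//.
rewrite (le_trans (ler_sum _ (G := fun=> `|A| * `|B|) _))//.
  by move=> k _; rewrite normrM ler_pM// mx_entry_le.
by rewrite sumr_const card_ord mulr_natl.
Qed.

Lemma continuous_mxP m n (T : topologicalType) (F : T -> 'M[R]_(m, n)) x :
  {for x, continuous F} <-> forall i j, {for x, continuous (fun y => F y i j)}.
Proof.
split=> [cF i j|cF].
  exact: (@continuous_comp _ _ _ F (fun A : 'M[R]_(m, n) => A i j) x cF
    (@coord_continuous _ _ _ _ _ _)).
apply/cvgrPdist_le => /= e e0; near=> y; apply: mx_norm_le; first exact: ltW.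
move=> i j; rewrite !mxE; move: i j; near: y; apply: filter_forall => i; apply: filter_forall => j.
have /cvgrPdist_le := cF i j; exact.
Unshelve. all: by end_near. Qed.

Lemma differentiable_mxP m n (F : V -> 'M[R]_(m, n)) x :
  differentiable F x <-> forall i j, differentiable (fun y => F y i j) x.
Proof.
split=> [dF i j|dF].
  exact: (@differentiable_comp _ _ _ _ F (fun A : 'M[R]_(m, n) => A i j) x dF
    (differentiable_coord _ _ _)).
have -> : F = \sum_i \sum_j (fun y => F y i j *: delta_mx i j).
  apply/funext => y; rewrite {1}[F y]matrix_sum_delta fct_sumE.
  by apply: eq_bigr => i _; rewrite fct_sumE.
apply: differentiable_sum => i; apply: differentiable_sum => j.
exact: differentiableZl.
Qed.

Lemma derive_entry m n (F : V -> 'M[R]_(m, n)) x v i j :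
  derivable F x v -> ('D_v F x) i j = 'D_v (fun y => F y i j) x.
Proof. by move=> dF; rewrite derive_mx// mxE. Qed.

Lemma differentiable_bigsum (I : Type) (W : normedModType R) (r : seq I)
    (f : I -> V -> W) x :
  (forall i, differentiable (f i) x) ->
  differentiable (fun y => \sum_(i <- r) f i y) x.
Proof.
move=> df; elim: r => [|i r IH].
  by under eq_fun do rewrite big_nil; exact: differentiable_cst.
by under eq_fun do rewrite big_cons; exact: (differentiableD (df i) IH).
Qed.

Lemma derivable_bigsum (I : Type) (W : normedModType R) (r : seq I)
    (f : I -> V -> W) x v :
  (forall i, derivable (f i) x v) ->
  derivable (fun y => \sum_(i <- r) f i y) x v.
Proof.
move=> df; elim: r => [|i r IH].
  by under eq_fun do rewrite big_nil; exact: derivable_cst.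
by under eq_fun do rewrite big_cons; exact: (derivableD (df i) IH).
Qed.

Lemma derive_bigsum (I : Type) (W : normedModType R) (r : seq I)
    (f : I -> V -> W) x v :
  (forall i, derivable (f i) x v) ->
  'D_v (fun y => \sum_(i <- r) f i y) x = \sum_(i <- r) 'D_v (f i) x.
Proof.
move=> df; elim: r => [|i r IH].
  by under eq_fun do rewrite big_nil; rewrite big_nil derive_cst.
under eq_fun do rewrite big_cons; rewrite big_cons -IH -deriveD//.
exact: derivable_bigsum.
Qed.

Lemma derivable_mulmx m n p (F : V -> 'M[R]_(m, n)) (G : V -> 'M[R]_(n, p)) x v :
  derivable F x v -> derivable G x v -> derivable (fun y => F y *m G y) x v.
Proof.
move=> /derivable_mxP dF /derivable_mxP dG; apply/derivable_mxP => i j.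
under eq_fun do rewrite mxE.
by apply: derivable_bigsum => k; exact: (derivableM (dF i k) (dG k j)).
Qed.

Lemma derive_mulmx m n p (F : V -> 'M[R]_(m, n)) (G : V -> 'M[R]_(n, p)) x v :
  derivable F x v -> derivable G x v ->
  'D_v (fun y => F y *m G y) x = 'D_v F x *m G x + F x *m 'D_v G x.
Proof.
move=> dF dG; apply/matrixP => i j; rewrite derive_entry; last first.
  exact: derivable_mulmx.
under eq_fun do rewrite mxE.
move: (dF) (dG) => /derivable_mxP eF /derivable_mxP eG.
rewrite derive_bigsum; last by move=> k; exact: (derivableM (eF i k) (eG k j)).
rewrite !mxE -big_split /=; apply: eq_bigr => k _.
rewrite (deriveM (eF i k) (eG k j)) !derive_entry// addrC.
by congr (_ + _); rewrite [LHS]mulrC.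
Qed.

Lemma differentiable_mulmx m n p (F : V -> 'M[R]_(m, n))
    (G : V -> 'M[R]_(n, p)) x :
  differentiable F x -> differentiable G x ->
  differentiable (fun y => F y *m G y) x.
Proof.
move=> /differentiable_mxP dF /differentiable_mxP dG.
apply/differentiable_mxP => i j; under eq_fun do rewrite mxE.
by apply: differentiable_bigsum => k; exact: (differentiableM (dF i k) (dG k j)).
Qed.

Lemma continuous_mulmx (T : topologicalType) m n p (F : T -> 'M[R]_(m, n))
    (G : T -> 'M[R]_(n, p)) x :
  {for x, continuous F} -> {for x, continuous G} ->
  {for x, continuous (fun y => F y *m G y)}.
Proof.
move=> /continuous_mxP dF /continuous_mxP dG.
apply/continuous_mxP => i j; rewrite /prop_for/= /continuous_at.
under eq_fun do rewrite mxE; rewrite mxE.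
apply: cvg_big => [|k _]; first exact: add_continuous.
by apply: cvgM; [exact: dF|exact: dG].
Qed.

Lemma differentiable_trmx m n (F : V -> 'M[R]_(m, n)) x :
  differentiable F x -> differentiable (fun y => (F y)^T) x.
Proof.
move=> /differentiable_mxP dF; apply/differentiable_mxP => i j.
by under eq_fun do rewrite mxE; exact: dF.
Qed.

Lemma derivable_trmx m n (F : V -> 'M[R]_(m, n)) x v :
  derivable F x v -> derivable (fun y => (F y)^T) x v.
Proof.
move=> /derivable_mxP dF; apply/derivable_mxP => i j.
by under eq_fun do rewrite mxE; exact: dF.
Qed.

Lemma derive_trmx m n (F : V -> 'M[R]_(m, n)) x v :
  derivable F x v -> 'D_v (fun y => (F y)^T) x = ('D_v F x)^T.
Proof.
move=> dF; apply/matrixP => i j; rewrite mxE !derive_entry//; last first.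
  exact: derivable_trmx.
by under eq_fun do rewrite mxE.
Qed.

Lemma continuous_trmx (T : topologicalType) m n (F : T -> 'M[R]_(m, n)) x :
  {for x, continuous F} -> {for x, continuous (fun y => (F y)^T)}.
Proof.
move=> /continuous_mxP dF; apply/continuous_mxP => i j.
by rewrite /prop_for/= /continuous_at; under eq_fun do rewrite mxE; rewrite mxE; exact: dF.
Qed.

Lemma differentiable_prod (I : Type) (r : seq I) (f : I -> V -> R) x :
  (forall i, differentiable (f i) x) ->
  differentiable (fun y => \prod_(i <- r) f i y) x.
Proof.
move=> df; elim: r => [|i r IH].
  by under eq_fun do rewrite big_nil; exact: differentiable_cst.
by under eq_fun do rewrite big_cons; exact: (differentiableM (df i) IH).
Qed.

Lemma differentiable_det n (F : V -> 'M[R]_n) x :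
  differentiable F x -> differentiable (fun y => \det (F y)) x.
Proof.
move=> /differentiable_mxP dF; rewrite /determinant.
apply: differentiable_bigsum => s.
exact: (@differentiableM _ _ (fun=> (-1) ^+ perm.odd_perm s)
  (fun y => \prod_i F y i (perm.fun_of_perm s i)) x
  (differentiable_cst _ _) (differentiable_prod _ (fun i => dF i _))).
Qed.

Lemma differentiable_bound (W : normedModType R) (f : V -> W) x :
  differentiable f x -> forall e : R, 0 < e ->
  \forall h \near 0, `|f (h + x) - f x - 'd f x h| <= e * `|h|.
Proof.
move=> /diff_locallyP[_ /eqaddoP H] e e0; have := H e e0.
by apply: filterS => h /=; rewrite !fctE opprD addrA.
Qed.

(** Epsilon form of differentiability, in which the Frobenius estimate below delivers its
    conclusion. *)
Lemma bound_differentiable (W : normedModType R) (f : V -> W)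
    (L : {linear V -> W}) x : continuous L ->
  (forall e : R, 0 < e -> \forall h \near 0, `|f (h + x) - f x - L h| <= e * `|h|) ->
  differentiable f x /\ 'd f x = L :> (V -> W).
Proof.
move=> cL H.
have E : f \o shift x = cst (f x) + L +o_ 0 id.
  apply/eqaddoP => e e0; have := H e e0.
  by apply: filterS => h /=; rewrite !fctE opprD addrA.
have dE := diff_unique cL E.
by split=> //; apply/diff_locallyP; rewrite dE.
Qed.

Lemma near_eq_differentiable (W : normedModType R) (f g : V -> W) x :
  (\forall y \near x, f y = g y) -> differentiable f x -> differentiable g x.
Proof.
move=> fg df.
suff /(bound_differentiable (diff_continuous df))[] : forall e : R, 0 < e ->
  \forall h \near 0, `|g (h + x) - g x - 'd f x h| <= e * `|h| by [].
move=> e e0; have := differentiable_bound df e0.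
have : \forall h \near (0 : V), f (h + x) = g (h + x).
  have : (h + x) @[h --> (0 : V)] --> 0 + x.
    by apply: cvgD; [exact: cvg_id|exact: cvg_cst].
  by rewrite add0r => /(_ _ fg).
apply: filterS2 => h -> ; rewrite -(nbhs_singleton fg)//.
Unshelve. all: by end_near. Qed.

(** Near [x] the determinant does not vanish, so the inverse agrees with the adjugate divided by the
    determinant. *)
Lemma differentiable_invmx n (F : V -> 'M[R]_n) x :
  differentiable F x -> F x \in unitmx ->
  differentiable (fun y => invmx (F y)) x.
Proof.
move=> dF uF.
have -> : (fun y => invmx (F y)) =
    (fun y => if F y \in unitmx then (\det (F y))^-1 *: \adj (F y) else F y).
  by [].
have dd := differentiable_det dF.
have nu : \forall y \near x, (F y \in unitmx) = true.
  have := differentiable_continuous dd.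
  move: uF; rewrite unitmxE unitfE => d0 /cvgrPdist_lt/(_ `|\det (F x)|).
  rewrite normr_gt0 => /(_ d0); apply: filterS => y yd.
  rewrite unitmxE unitfE; apply: contraTN yd => /eqP ->.
  by rewrite subr0 ltxx.
have dI : differentiable (fun y => (\det (F y))^-1 *: \adj (F y)) x.
  apply/differentiable_mxP => i j; under eq_fun do rewrite !mxE.
  apply: (@differentiableM _ _ (fun y => (\det (F y))^-1)).
    by apply: differentiableV => //; rewrite -unitfE -unitmxE.
  rewrite /cofactor; apply: (@differentiableM _ _ (fun=> (-1) ^+ (j + i))) => //.
  apply: differentiable_det; apply/differentiable_mxP => a b.
  under eq_fun do rewrite !mxE.
  by move/differentiable_mxP: dF; exact.
by apply: near_eq_differentiable dI; near=> y; rewrite (near nu y).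
Unshelve. all: by end_near. Qed.

End MatrixCalculus.

Section MatrixInverse.
Context {R : realType}.

Lemma continuous_invmx (T : topologicalType) n (F : T -> 'M[R]_n) x :
  {for x, continuous F} -> F x \in unitmx ->
  {for x, continuous (fun y => invmx (F y))}.
Proof.
move=> cF uF; apply: (@continuous_comp _ _ _ F invmx x cF).
by apply: differentiable_continuous; exact: (@differentiable_invmx _ _ _ id).
Qed.

Lemma unitmx_near (T : topologicalType) n (F : T -> 'M[R]_n) x :
  {for x, continuous F} -> F x \in unitmx -> \forall y \near x, F y \in unitmx.
Proof.
move=> cF uF.
have cd : {for x, continuous (fun y => \det (F y))}.
  apply: (@continuous_comp _ _ _ F (fun A => \det A) x cF).
  by apply: differentiable_continuous; exact: (@differentiable_det _ _ _ id).
move: uF; rewrite unitmxE unitfE => d0.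
move: cd => /cvgrPdist_lt/(_ `|\det (F x)|); rewrite normr_gt0 => /(_ d0).
apply: filterS => y yd; rewrite unitmxE unitfE; apply: contraTN yd => /eqP ->.
by rewrite subr0 ltxx.
Qed.

Context {V : normedModType R}.

(** Differentiates the product of [F] with its inverse, which is constant near [x]. *)
Lemma derive_invmx n (F : V -> 'M[R]_n) x v :
  differentiable F x -> F x \in unitmx ->
  'D_v (fun y => invmx (F y)) x =
  - (invmx (F x) *m 'D_v F x *m invmx (F x)).
Proof.
move=> dF uF; have dI := differentiable_invmx dF uF.
have : 'D_v (fun y => F y *m invmx (F y)) x = 0.
  rewrite (@near_eq_derive _ _ _ _ (cst 1%:M)) ?derive_cst//.
  have := unitmx_near (differentiable_continuous dF) uF.
  by apply: filterS => y uy; rewrite mulmxV.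
rewrite derive_mulmx; try exact: diff_derivable.
move=> /(congr1 (mulmx (invmx (F x)))); rewrite mulmxDr mulmx0 !mulmxA mulVmx//.
by rewrite mul1mx => /eqP; rewrite addrC addr_eq0 => /eqP.
Qed.

End MatrixInverse.

Lemma derive_comp (R : realType) (U V W : normedModType R) (f : U -> V)
    (g : V -> W) x v :
  differentiable f x -> differentiable g (f x) ->
  'D_v (g \o f) x = 'D_('D_v f x) g (f x).
Proof.
move=> df dg; rewrite !deriveE//; last exact: differentiable_comp.
by rewrite diff_comp.
Qed.

Section Partial.
Context {R : realType}.

Lemma partialE n (W : normedModType R) i (F : 'rV[R]_n -> W) x :
  partial i F x = 'D_(delta_mx 0 i) F x.
Proof. by []. Qed.

Lemma derive_partial n (W : normedModType R) (F : 'rV[R]_n -> W) x v :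
  differentiable F x -> 'D_v F x = \sum_i v 0 i *: partial i F x.
Proof.
move=> dF; rewrite deriveE// {1}[v]row_sum_delta linear_sum; apply: eq_bigr => i _.
by rewrite linearZ /partial deriveE.
Qed.

Lemma row_jacobian m n (F : 'rV[R]_m -> 'rV[R]_n) x i :
  differentiable F x -> row i ('J F x) = partial i F x.
Proof. by move=> dF; rewrite /partial deriveEjacobian// -rowE. Qed.

Lemma partial_comp m n (W : normedModType R) (F : 'rV[R]_m -> 'rV[R]_n)
    (G : 'rV[R]_n -> W) x i :
  differentiable F x -> differentiable G (F x) ->
  partial i (G \o F) x = \sum_a 'J F x i a *: partial a G (F x).
Proof.
move=> dF dG; rewrite /partial derive_comp// derive_partial//.
apply: eq_bigr => a _.
by rewrite -[in LHS]/(partial i F x) -row_jacobian// mxE.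
Qed.

Lemma jacobian_comp m n p (F : 'rV[R]_m -> 'rV[R]_n)
    (G : 'rV[R]_n -> 'rV[R]_p) x :
  differentiable F x -> differentiable G (F x) ->
  'J (G \o F) x = 'J F x *m 'J G (F x).
Proof.
move=> dF dG; apply/row_matrixP => i.
rewrite row_jacobian; last exact: differentiable_comp.
rewrite partial_comp// row_mul mulmx_sum_row; apply: eq_bigr => a _.
by rewrite -row_jacobian// [X in _ = X *: _]mxE.
Qed.

Lemma near_eq_partial n (W : normedModType R) (F G : 'rV[R]_n -> W) i x :
  (\forall y \near x, F y = G y) -> partial i F x = partial i G x.
Proof. by move=> FG; rewrite /partial; exact: near_eq_derive. Qed.

Lemma near_eq_jacobian m n (F G : 'rV[R]_m -> 'rV[R]_n) x :
  (\forall y \near x, F y = G y) -> differentiable F x -> 'J F x = 'J G x.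
Proof.
move=> FG dF; apply/row_matrixP => i.
have dG := near_eq_differentiable FG dF.
transitivity (partial i F x); first exact: row_jacobian.
transitivity (partial i G x); first exact: near_eq_partial.
by apply/esym; exact: row_jacobian.
Qed.

(** For the sup norm, the scalar mean value theorem applied to each entry is enough. *)
Lemma mvt_mx m n (f : R -> 'M[R]_(m, n)) (a b K : R) : a <= b ->
  (forall t, t \in `[a, b] -> derivable f t 1) ->
  (forall t, t \in `[a, b] -> `|'D_1 f t| <= K) ->
  `|f b - f a| <= K * (b - a).
Proof.
move=> ab df Kf; have K0 : 0 <= K.
  by apply: le_trans (Kf a _) => //; rewrite in_itv/= lexx.
apply: mx_norm_le; first by rewrite mulr_ge0// subr_ge0.
move=> i j; rewrite !mxE.
have dfij t : t \in `[a, b] -> derivable (fun t => f t i j) t 1.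
  by move=> /df/derivable_mxP; exact.
have [|t|c cab ->] := @MVT_segment R (fun t => f t i j)
    (fun t => 'D_1 (fun t => f t i j) t) a b ab.
- by move=> t /subset_itv_oo_cc tab; apply: derivableP; exact: dfij.
- by move: t; apply: derivable_within_continuous => t; exact: dfij.
rewrite normrM (ger0_norm (_ : 0 <= b - a)) ?subr_ge0//.
rewrite ler_wpM2r ?subr_ge0// (le_trans _ (Kf _ cab))// -derive_entry//.
  exact: mx_entry_le.
exact: df.
Qed.

End Partial.

(** * Symmetry of second derivatives *)

Section Schwarz.
Context {R : realType}.

Lemma is_derive_line (V W : normedModType R) (F : V -> W) x a (s : R) :
  differentiable F (x + s *: a) ->
  is_derive s 1 (fun t => F (x + t *: a)) ('D_a F (x + s *: a)).
Proof.
move=> dF.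
have dl : is_diff s (fun t : R => x + t *: a) (fun t => t *: a).
  have -> : (fun t : R => x + t *: a) = cst x + ( *:%R^~ a) by [].
  by apply: is_diff_eq; exact: add0r.
split; first by apply: diff_derivable; exact: (@differentiable_comp _ _ _ _ (fun t : R => x + t *: a)).
rewrite (@derive_comp _ _ _ _ (fun t : R => x + t *: a))//.
by congr ('D_ _ _ _); rewrite deriveE// diff_val scale1r.
Qed.

(** Only differentiability of ['D_a F] at the single point [x] is available, so the mean value
    theorem is used once, in the direction [a], and the rest is read off the differential. This
    serves both Schwarz's theorem and the second-order condition at a maximum. *)
Lemma second_difference (V : normedModType R) (F : V -> R) (a b x : V) :
  `|a| <= 1 -> `|b| <= 1 -> (\forall y \near x, differentiable F y) ->
  differentiable ('D_a F) x -> forall e : R, 0 < e -> \forall t \near 0^'+,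
  `|F (x + t *: a + t *: b) - F (x + t *: a) - F (x + t *: b) + F x
    - t * t * 'D_b ('D_a F) x| <= 3 * e * (t * t).
Proof.
move=> a1 b1 dF dDF e e0.
have [d d0 dP] : exists2 d : R, 0 < d & forall h, `|h| < d ->
    differentiable F (x + h) /\
    `|'D_a F (h + x) - 'D_a F x - 'd ('D_a F) x h| <= e * `|h|.
  have := differentiable_bound dDF e0.
  have : (x + h) @[h --> (0 : V)] --> x + 0.
    by apply: cvgD; [exact: cvg_cst|exact: cvg_id].
  rewrite addr0 => /(_ _ dF) H1 H2.
  have H1' : \forall h \near (0 : V), differentiable F (x + h) by exact: H1.
  have [d d0 dP] := iffLR (nbhs_ballP _ _) (@filterI _ (nbhs (0 : V)) _ _ _ H1' H2).
  by exists d => // h hd; apply: dP; rewrite -ball_normE/= sub0r normrN.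
near=> t; have t0 : 0 < t by [].
have td : t *+ 2 < d.
  rewrite -mulr_natr -ltr_pdivlMr//; near: t; apply: nbhs_right_lt.
  by rewrite divr_gt0.
have small c h : 0 <= c <= t -> `|h| <= t -> `|c *: a + h| <= t *+ 2.
  move=> /andP[c0 ct] ht; rewrite mulr2n (le_trans (ler_normD _ _))// lerD//.
  by rewrite normrZ ger0_norm// -[leRHS]mulr1 ler_pM.
have tb : `|t *: b| <= t.
  by rewrite normrZ gtr0_norm// -[leRHS]mulr1 ler_wpM2l// ltW.
have ht0 : `|0 : V| <= t by rewrite normr0 ltW.
have dg h c : 0 <= c <= t -> `|h| <= t ->
    is_derive c 1 (fun s => F (x + h + s *: a)) ('D_a F (x + h + c *: a)).
  move=> ct ht; apply: is_derive_line.
  rewrite -addrA [h + _]addrC; apply: (dP _ _).1.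
  by apply: le_lt_trans td; exact: small.
(* The second difference is the increment over [[0, t]] of the difference of [F] along two parallel
   lines. *)
have [||c ct] := @MVT R
    ((fun s => F (x + t *: b + s *: a)) - (fun s => F (x + 0 + s *: a)))
    (fun s => 'D_a F (x + t *: b + s *: a) - 'D_a F (x + 0 + s *: a)) 0 t t0.
- by move=> s /andP[/ltW s0 /ltW st]; apply: is_deriveB; apply: dg; rewrite ?s0.
- apply: derivable_within_continuous => s; rewrite in_itv/= => st.
  by apply: derivableB; apply: ex_derive; apply: dg.
rewrite !fctE scale0r !addr0 subr0 => E.
have {}ct : 0 <= c <= t by move: ct; rewrite in_itv/= => /andP[/ltW -> /ltW ->].
rewrite [x + t *: a + _]addrAC.
have -> : forall p q r s u : R, p - q - r + s - u = p - q - (r - s) - u.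
  by move=> *; ring.
rewrite E; set D := 'd ('D_a F) x in dP.
have Db : 'D_b ('D_a F) x = D b by rewrite deriveE.
have [_ P1] := dP _ (le_lt_trans (small _ _ ct tb) td).
have [_ P2] := dP _ (le_lt_trans (small _ _ ct ht0) td).
have n1 := small _ _ ct tb.
have n2 : `|c *: a + 0| <= t.
  rewrite addr0 normrZ ger0_norm; last by case/andP: ct.
  by case/andP: ct => c0 ct; rewrite -[leRHS]mulr1 ler_pM.
have -> : 'D_a F (x + t *: b + c *: a) = 'D_a F (c *: a + t *: b + x).
  by congr ('D_a F _); rewrite addrC addrA [c *: a + x]addrC -addrA addrC -addrA addrC [t*:b + _]addrC.
have -> : 'D_a F (x + c *: a) = 'D_a F (c *: a + 0 + x) by rewrite addr0 addrC.
rewrite Db; move: P1 P2; rewrite !linearD !linear0 linearZ/=.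
have -> : D (t *: b) = t * D b by rewrite linearZ.
set A := 'D_a F (c *: a + t *: b + x); set B := 'D_a F (c *: a + 0 + x).
set C := 'D_a F x; set X := c *: D a; set Y := D b => P1 P2.
(* Both values of ['D_a F] are compared with its differential at [x], and the contributions along
   [a] cancel. The displacements have norms at most [2 t] and [t], whence the factor 3. *)
have -> : (A - B) * t - t * t * Y =
    ((A - C + (- X - t * Y)) - (B - C + (- X + 0))) * t by ring.
rewrite normrM (gtr0_norm t0) [leRHS]mulrA ler_wpM2r ?(ltW t0)//.
rewrite (le_trans (ler_normB _ _))//.
rewrite (le_trans (lerD P1 P2))//.
rewrite -mulrDr [3 * e]mulrC -mulrA ler_wpM2l ?(ltW e0)//.
rewrite (le_trans (lerD n1 n2))//; lra.
Unshelve. all: by end_near. Qed.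

(** The second difference is symmetric in its two directions and approximates both mixed
    derivatives. *)
Lemma schwarz n (F : 'rV[R]_n -> R) i j x :
  (\forall y \near x, differentiable F y) ->
  differentiable (partial i F) x -> differentiable (partial j F) x ->
  partial i (partial j F) x = partial j (partial i F) x.
Proof.
move=> dF di dj.
have n1 k : `|delta_mx 0 k : 'rV[R]_n| <= 1.
  apply: mx_norm_le => // a b; rewrite mxE.
  by case: (_ && _); rewrite ?normr1 ?normr0.
apply/eqP; rewrite -subr_eq0 -normr_le0; apply/ler_addgt0Pl => e e0; rewrite addr0.
(* Each of the two approximations costs three times this amount. *)
have e6 : 0 < e / 6 by rewrite divr_gt0.
have H1 := second_difference (n1 i) (n1 j) dF di e6.
have H2 := second_difference (n1 j) (n1 i) dF dj e6.
have [t [[K1 K2] t0]] := filter_ex (filterI (filterI H1 H2) (nbhs_right_gt 0)).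
move: K1 K2; rewrite -/(partial i F) -/(partial j F).
rewrite -/(partial j (partial i F) x) -/(partial i (partial j F) x).
rewrite [x + t *: _ + _]addrAC.
set A := F (_ + _ + _); set B := F _; set C := F _; set D := F x.
set P := partial j _ _; set Q := partial i _ _ => K1 K2.
have tt0 : 0 < t * t by rewrite mulr_gt0.
rewrite -(ler_pM2r tt0) -[X in _ * X](gtr0_norm tt0) -normrM.
have -> : (Q - P) * (t * t) =
    (A - B - C + D - t * t * P) - (A - C - B + D - t * t * Q) by ring.
rewrite (le_trans (ler_normB _ _))// (le_trans (lerD K1 K2))//.
by rewrite [leLHS](_ : _ = e * (t * t))//; field.
Qed.

Lemma partial_entry m p n (F : 'rV[R]_n -> 'M[R]_(m, p)) i x a b :
  differentiable F x -> partial i F x a b = partial i (fun z => F z a b) x.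
Proof. by move=> dF; apply: derive_entry; exact: diff_derivable. Qed.

Lemma schwarz_mx m p n (F : 'rV[R]_n -> 'M[R]_(m, p)) i j x :
  (\forall y \near x, differentiable F y) ->
  differentiable (partial i F) x -> differentiable (partial j F) x ->
  partial i (partial j F) x = partial j (partial i F) x.
Proof.
move=> dF di dj; apply/matrixP => a b.
have E k : \forall y \near x, (fun z => partial k F z a b) y = partial k (fun z => F z a b) y.
  by apply: filterS dF => y dy; exact: partial_entry.
have dfE k : differentiable (partial k F) x -> differentiable (partial k (fun z => F z a b)) x.
  by move=> /differentiable_mxP/(_ a b); exact: near_eq_differentiable.
transitivity (partial i (partial j (fun z => F z a b)) x).
  by rewrite -(near_eq_partial _ (E j)); exact: partial_entry.
transitivity (partial j (partial i (fun z => F z a b)) x); last first.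
  by rewrite -(near_eq_partial _ (E i)); apply/esym; exact: partial_entry.
apply: schwarz; [|exact: dfE|exact: dfE].
by apply: filterS dF => y /differentiable_mxP; exact.
Qed.

End Schwarz.

#[global] Opaque partial.

(** * Linear differential equations and the theorem of Frobenius *)

Section LinearODE.
Context {R : realType}.

Lemma antiderivative (f : R -> R) (a b : R) : continuous f ->
  exists2 F : R -> R, F a = 0 & forall t : R, t \in `[a, b] -> is_derive t 1 F (f t).
Proof.
(* Starting the integral at [a - 1] makes every point of [[a, b]] interior, so that the derivative
   is two-sided even at the ends. *)
move=> cf; pose F (x : R) := \int[lebesgue_measure]_(t in [set` `[a - 1, x]]) f t.
exists (fun x => F x - F a); first by rewrite subrr.
move=> t; rewrite in_itv/= => /andP[t0 t1].
have [] := @continuous_FTC1_closed R f (a - 1) t (b + 1).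
- by lra.
- apply: continuous_compact_integrable; first exact: segment_compact.
  exact: continuous_subspaceT.
- by lra.
- exact: cf.
rewrite derive1E => dF vF.
have H : is_derive t 1 F (f t) by split.
have -> : (fun x => F x - F a) = F - cst (F a) by [].
by apply: is_derive_eq; rewrite subr0.
Qed.

Lemma antiderivative_mx m n (f : R -> 'M[R]_(m, n)) : continuous f ->
  exists2 F : R -> 'M[R]_(m, n), F 0 = 0 &
    forall t : R, t \in `[0, 1] -> is_derive t 1 F (f t).
Proof.
move=> cf.
have /choice[F FP] (ij : 'I_m * 'I_n) : exists F : R -> R, F 0 = 0 /\
    forall t : R, t \in `[0, 1] -> is_derive t 1 F (f t ij.1 ij.2).
  have cij : continuous (fun t => f t ij.1 ij.2).
    by move=> t; apply: (iffLR (continuous_mxP f t)); exact: cf.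
  by have [F F0 FP] := antiderivative 0 1 cij; exists F.
exists (fun t => \matrix_(i, j) F (i, j) t).
  by apply/matrixP => i j; rewrite !mxE (FP (i, j)).1.
move=> t t01.
have E i j : (fun x => (\matrix_(i, j) F (i, j) x) i j) = F (i, j).
  by apply/funext => x; rewrite mxE.
have dm : derivable (fun t => \matrix_(i, j) F (i, j) t) t 1.
  by apply/derivable_mxP => i j; rewrite E; have := (FP (i, j)).2 t t01.
split => //; apply/matrixP => i j.
by rewrite derive_entry// E; have [_ ->] := (FP (i, j)).2 t t01.
Qed.

Lemma half_power_lt (e : R) : 0 < e -> exists k, 2^-1 ^+ k < e.
Proof.
move=> e0; have h1 : `|2^-1 : R| < 1 by rewrite ger0_norm; lra.
have [k _ kP] := cvgr_lt _ (cvg_expr h1) e e0.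
by exists k; exact: kP (leqnn k).
Qed.

(** Entrywise, [u k + 2 * 2^-k] decreases and [u k - 2 * 2^-k] increases, so the infimum of the
    former lies between the two for every [k]. This gives the limit together with an explicit
    error. *)
Lemma geometric_limit m n (u : nat -> 'M[R]_(m, n)) :
  (forall k, `|u k.+1 - u k| <= 2^-1 ^+ k) ->
  exists l, forall k, `|l - u k| <= 2 * 2^-1 ^+ k.
Proof.
move=> uk.
have H (i : 'I_m) (j : 'I_n) : exists l : R, forall k, `|l - u k i j| <= 2 * 2^-1 ^+ k.
  pose v k := u k i j + 2 * 2^-1 ^+ k; pose w k := u k i j - 2 * 2^-1 ^+ k.
  have d k : `|u k.+1 i j - u k i j| <= 2^-1 ^+ k.
    by apply: le_trans (uk k); apply: le_trans (mx_entry_le _ i j); rewrite !mxE.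
  have e0 k : 0 <= (2^-1 : R) ^+ k by rewrite exprn_ge0.
  have vS k : v k.+1 <= v k.
    by have := d k; have := e0 k; rewrite /v exprS ler_norml; lra.
  have wS k : w k <= w k.+1.
    by have := d k; have := e0 k; rewrite /w exprS ler_norml; lra.
  have vm k p : v (k + p)%N <= v k.
    by elim: p => [|p IH]; rewrite ?addn0// addnS (le_trans (vS _)).
  have wm k p : w k <= w (k + p)%N.
    by elim: p => [|p IH]; rewrite ?addn0// addnS (le_trans IH).
  have wv k p : w k <= v p.
    have wvk q : w q <= v q by have := e0 q; rewrite /w /v; lra.
    have [/subnKC <-|/ltnW/subnKC <-] := leqP k p.
      exact: le_trans (wm _ _) (wvk _).
    exact: le_trans (wvk _) (vm _ _).
  have hi : has_inf (range v).
    by split; [exists (v 0%N), 0%N|exists (w 0%N) => _ [k _ <-]].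
  exists (inf (range v)) => k; rewrite ler_norml; apply/andP; split.
    have : w k <= inf (range v).
      by apply: lb_le_inf; [exists (v 0%N), 0%N|move=> _ [p _ <-]].
    by rewrite /w; lra.
  have : inf (range v) <= v k by apply: ge_inf; [exact: hi.2|exists k].
  by rewrite /v; lra.
have /choice[l lP] (ij : 'I_m * 'I_n) := H ij.1 ij.2.
exists (\matrix_(i, j) l (i, j)) => k; apply: mx_norm_le.
  by rewrite mulr_ge0// exprn_ge0.
by move=> i j; rewrite !mxE; exact: (lP (i, j) k).
Qed.

(** The retraction of the line onto [[0, 1]], written with absolute values to make continuity
    immediate. Composing with it turns data on [[0, 1]] into continuous functions on the whole line,
    as [antiderivative] requires. *)
Definition clamp (t : R) : R := (1 + `|t| - `|t - 1|) / 2.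

Lemma clamp_itv t : clamp t \in `[0, 1].
Proof.
by rewrite in_itv/= /clamp; case: (ger0P t); case: (ger0P (t - 1)); lra.
Qed.

Lemma clamp_id (t : R) : t \in `[0, 1] -> clamp t = t.
Proof.
by rewrite in_itv/= /clamp; case: (ger0P t); case: (ger0P (t - 1)); lra.
Qed.

Lemma continuous_clamp : continuous clamp.
Proof.
move=> t; apply: cvgM; last exact: cvg_cst.
apply: cvgB; last by apply: cvg_norm; apply: cvgB; [exact: cvg_id|exact: cvg_cst].
by apply: cvgD; [exact: cvg_cst|apply: cvg_norm; exact: cvg_id].
Qed.

Lemma scalar1_norm_le N : `|1%:M : 'M[R]_N| <= 1.
Proof.
by apply: mx_norm_le => // i j; rewrite mxE; case: (_ == _); rewrite ?normr1 ?normr0.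
Qed.

Lemma half_mul N m (Y : 'M[R]_(m, N)) (B : 'M[R]_N) :
  N%:R * `|B| <= 2^-1 -> `|Y *m B| <= 2^-1 * `|Y|.
Proof.
move=> B1; rewrite (le_trans (mx_norm_mul _ _))// mulrCA mulrC ler_wpM2r//.
Qed.

Lemma half_gronwall m N (E : R -> 'M[R]_(m, N)) (dE : R -> 'M[R]_(m, N)) (d : R) :
  (forall t : R, t \in `[0, 1] -> is_derive t 1 E (dE t)) -> E 0 = 0 ->
  (forall t : R, t \in `[0, 1] -> `|dE t| <= 2^-1 * `|E t| + d) ->
  forall t : R, t \in `[0, 1] -> `|E t| <= 2 * d.
Proof.
move=> dEP E0 Ed.
have drE t : t \in `[0, 1] -> derivable E t 1 by move=> /dEP [].
have [|c c01 cmax] := @EVT_max R (fun t => `|E t|) 0 1 ler01.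
  apply: continuous_in_subspaceT => t /set_mem /drE /derivable1_diffP dt.
  by apply: cvg_norm; exact: differentiable_continuous dt.
suff Ec : `|E c| <= 2 * d by move=> t t01; exact: le_trans (cmax t t01) _.
have c0 : 0 <= c <= 1 by move: c01; rewrite in_itv.
have : `|E c - E 0| <= (2^-1 * `|E c| + d) * (c - 0).
  apply: mvt_mx; first by case/andP: c0.
    by move=> t; rewrite in_itv/= => ?; apply: drE; rewrite in_itv/=; lra.
  move=> t; rewrite in_itv/= => t0; have t01 : t \in `[0, 1] by rewrite in_itv/=; lra.
  have [_ ->] := dEP t t01; apply: le_trans (Ed t t01) _.
  by rewrite lerD2r ler_wpM2l// cmax.
rewrite E0 !subr0 => H.
have H0 : 0 <= 2^-1 * `|E c| + d.
  by apply: le_trans (Ed c c01); exact: normr_ge0.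
have : (2^-1 * `|E c| + d) * c <= 2^-1 * `|E c| + d by rewrite ler_piMr//; lra.
lra.
Qed.

Lemma continuous_geometric_limit m n (T : topologicalType)
    (u : nat -> T -> 'M[R]_(m, n)) (l : T -> 'M[R]_(m, n)) :
  (forall k, continuous (u k)) ->
  (forall k t, `|l t - u k t| <= 2 * 2^-1 ^+ k) -> continuous l.
Proof.
move=> cu lu t; apply/cvgrPdist_le => e e0.
have [|k ek] := @half_power_lt (e / 6); first lra.
have /cvgrPdist_le/(_ (e / 3)) := cu k t.
have e3 : 0 < e / 3 by lra.
move=> /(_ e3); apply: filterS => s us.
have -> : l t - l s = (l t - u k t) + (u k t - u k s) - (l s - u k s).
  by rewrite opprB addrA [_ + (u k t - _)]addrA subrK subrK.
rewrite (le_trans (ler_normB _ _))// (le_trans (lerD (ler_normD _ _) (lexx _)))//.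
by have := lu k t; have := lu k s; lra.
Qed.

(** Picard iteration. The bound on [B] makes the integral operator a contraction of ratio 1/2, so
    consecutive iterates differ by at most [2^-k]. *)
Lemma linear_ode N (B : R -> 'M[R]_N) : continuous B ->
  (forall t, N%:R * `|B t| <= 2^-1) ->
  exists2 Y : R -> 'M[R]_N, Y 0 = 1%:M &
    forall t : R, t \in `[0, 1] -> is_derive t 1 Y (Y t *m B t).
Proof.
move=> cB B1.
(* A total integration operator; its value on discontinuous functions is arbitrary. *)
have /choice[op opP] (f : R -> 'M[R]_N) : exists F : R -> 'M[R]_N,
    continuous f -> F 0 = 0 /\ forall t : R, t \in `[0, 1] -> is_derive t 1 F (f t).
  have [cf|ncf] := pselect (continuous f); last by exists f.
  by have [F F0 FP] := antiderivative_mx cf; exists F.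
pose I (Z : R -> 'M[R]_N) t := 1%:M + op (fun t => Z t *m B t) t.
have cZB (Z : R -> 'M[R]_N) : continuous Z -> continuous (fun t => Z t *m B t).
  by move=> cZ t; apply: continuous_mulmx; [exact: cZ|exact: cB].
have I0 Z : continuous Z -> I Z 0 = 1%:M.
  by move=> /cZB/opP[+ _]; rewrite /I => ->; rewrite addr0.
have dI Z : continuous Z -> forall t : R, t \in `[0, 1] -> is_derive t 1 (I Z) (Z t *m B t).
  move=> /cZB/opP[_ H] t /H dop.
  have := @is_deriveD _ _ _ (cst 1%:M) _ t 1 0 _ (is_derive_cst _ _ _) dop.
  by rewrite add0r.
(* The antiderivative is controlled on [[0, 1]] only, hence the clamp at every stage. *)
pose u := fix u k := if k is k'.+1 then I (u k') \o clamp else cst 1%:M.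
have cu k : continuous (u k).
  elim: k => [|k IH] /=; first by move=> t; exact: cvg_cst.
  move=> t; apply: continuous_comp; first exact: continuous_clamp.
  apply: differentiable_continuous; apply/derivable1_diffP.
  by have [] := dI _ IH _ (clamp_itv t).
have Iu k (s : R) : s \in `[0, 1] -> u k.+1 s = I (u k) s.
  by move=> s01 /=; rewrite clamp_id.
have uc k t : u k t = u k (clamp t).
  by case: k => //= k; rewrite (clamp_id (clamp_itv t)).
have dist Z Z' (K : R) : continuous Z -> continuous Z' ->
    (forall s, `|Z s - Z' s| <= K) ->
    forall s : R, s \in `[0, 1] -> `|I Z s - I Z' s| <= 2^-1 * K.
  move=> cZ cZ' ZK s; rewrite in_itv/= => s01.
  have K0 : 0 <= K by apply: le_trans (ZK 0); exact: normr_ge0.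
  have -> : I Z s - I Z' s = (I Z - I Z') s - (I Z - I Z') 0.
    by rewrite !fctE !I0// subrr subr0.
  have H t : t \in `[0, s] -> is_derive t 1 (I Z - I Z') ((Z t - Z' t) *m B t).
    rewrite in_itv/= => ts; have t01 : t \in `[0, 1] by rewrite in_itv/=; lra.
    rewrite mulmxBl; have := dI _ cZ _ t01; have := dI _ cZ' _ t01.
    by move=> ? ?; apply: is_deriveB.
  apply: (@le_trans _ _ (2^-1 * K * (s - 0))); last first.
    by rewrite ler_piMr; [| |lra]; lra.
  apply: mvt_mx; [by case/andP: s01|by move=> t /H []|].
  move=> t /H [_ ->]; apply: le_trans (half_mul _ (B1 t)) _.
  by rewrite ler_wpM2l// ZK.
have uk k t : `|u k.+1 t - u k t| <= 2^-1 ^+ k.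
  rewrite (uc k.+1) (uc k); move: (clamp t) (clamp_itv t) => {}t.
  elim: k t => [|k IH] t t01.
    rewrite Iu// expr0 /=.
    (* The constant 1 is the image of the zero function, so the contraction estimate also covers the
       first gap. *)
    have -> : I (cst 1%:M) t - cst 1%:M t = I (cst 1%:M) t - I (cst 0) t.
      congr (_ - _).
      have : `|I (cst 0) t - I (cst 0) 0| <= 0 * (t - 0).
        have c0 : continuous (cst (0 : 'M[R]_N) : R -> _) by move=> ?; exact: cvg_cst.
        move: t01; rewrite in_itv/= => t01; apply: mvt_mx; first by case/andP: t01.
          move=> s; rewrite in_itv/= => s0; have s01 : s \in `[0, 1] by rewrite in_itv/=; lra.
          by have [] := dI _ c0 _ s01.
        move=> s; rewrite in_itv/= => s0; have s01 : s \in `[0, 1] by rewrite in_itv/=; lra.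
        by have [_ ->] := dI _ c0 _ s01; rewrite mul0mx normr0.
      rewrite mul0r normr_le0 subr_eq0 => /eqP ->; rewrite I0//.
      by move=> ?; exact: cvg_cst.
    apply: (@le_trans _ _ (2^-1 * 1)); last by lra.
    apply: dist => //; try by move=> ?; exact: cvg_cst.
    by move=> s; rewrite subr0 scalar1_norm_le.
  rewrite (Iu k.+1)// (Iu k)// exprS.
  by apply: dist => // s; rewrite (uc k.+1) (uc k); apply: IH; exact: clamp_itv.
have /choice[l lP] t := geometric_limit (uk ^~ t).
have cl : continuous l by apply: continuous_geometric_limit cu _ => k t; exact: lP.
have Il (s : R) : s \in `[0, 1] -> I l s = l s.
  move=> s01; apply/eqP; rewrite -subr_eq0 -normr_le0.
  apply/ler_addgt0Pl => e e0; rewrite addr0.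
  have [|k ek] := @half_power_lt (e / 3); first lra.
  have -> : I l s - l s = (I l s - I (u k) s) - (l s - u k.+1 s).
    by rewrite Iu// opprB addrA subrK.
  rewrite (le_trans (ler_normB _ _))//.
  have H1 := dist _ _ _ cl (cu k) (fun s => lP s k) s s01.
  by have := lP s k.+1; rewrite exprS; lra.
exists (I l); first exact: I0.
by move=> t t01; rewrite Il//; exact: dI.
Qed.

End LinearODE.

Section Combination.
Context {R : realType} {n : nat}.

(** Contraction of a [W]-valued 1-form, given by its components, with the tangent vector [v]. *)
Definition comb (W : lmodType R) (v : 'rV[R]_n) (Z : 'I_n -> W) : W :=
  \sum_i v 0 i *: Z i.

Lemma eq_comb (W : lmodType R) v (Z Z' : 'I_n -> W) :
  Z =1 Z' -> comb v Z = comb v Z'.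
Proof. by move=> ZZ; apply: eq_bigr => i _; rewrite ZZ. Qed.

Lemma norm_comb (W : normedModType R) (v : 'rV[R]_n) (Z : 'I_n -> W) (K : R) :
  0 <= K -> (forall i, `|Z i| <= K) -> `|comb v Z| <= n%:R * (`|v| * K).
Proof.
move=> K0 ZK; rewrite /comb (le_trans (ler_norm_sum _ _ _))//.
rewrite (le_trans (ler_sum _ (G := fun=> `|v| * K) _))//.
  by move=> i _; rewrite normrZ ler_pM// mx_entry_le.
by rewrite sumr_const card_ord mulr_natl.
Qed.

Lemma combDl (W : lmodType R) (v w : 'rV[R]_n) (Z : 'I_n -> W) :
  comb (v + w) Z = comb v Z + comb w Z.
Proof. by rewrite -big_split; apply: eq_bigr => i _; rewrite mxE scalerDl. Qed.

Lemma combZl (W : lmodType R) (a : R) v (Z : 'I_n -> W) :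
  comb (a *: v) Z = a *: comb v Z.
Proof. by rewrite scaler_sumr; apply: eq_bigr => i _; rewrite mxE scalerA. Qed.

Lemma combB (W : lmodType R) v (Z Z' : 'I_n -> W) :
  comb v (fun i => Z i - Z' i) = comb v Z - comb v Z'.
Proof. by rewrite -sumrB; apply: eq_bigr => i _; rewrite scalerBr. Qed.

Lemma combZr (W : lmodType R) v (a : R) (Z : 'I_n -> W) :
  comb v (fun i => a *: Z i) = a *: comb v Z.
Proof.
by rewrite scaler_sumr; apply: eq_bigr => i _; rewrite !scalerA mulrC.
Qed.

Lemma comb0l (W : lmodType R) (Z : 'I_n -> W) : comb 0 Z = 0.
Proof. by apply: big1 => i _; rewrite mxE scale0r. Qed.

Lemma combD (W : lmodType R) v (Z Z' : 'I_n -> W) :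
  comb v (fun i => Z i + Z' i) = comb v Z + comb v Z'.
Proof. by rewrite -big_split; apply: eq_bigr => i _; rewrite scalerDr. Qed.

Lemma comb2D (W : lmodType R) v w (F G F' G' : 'I_n -> 'I_n -> W) :
  (forall i j, F i j + G i j = F' i j + G' i j) ->
  comb v (fun i => comb w (F i)) + comb v (fun i => comb w (G i)) =
  comb v (fun i => comb w (F' i)) + comb v (fun i => comb w (G' i)).
Proof.
move=> FG; rewrite -!combD; apply: eq_comb => i; rewrite -!combD.
exact: eq_comb.
Qed.

Lemma comb_delta (W : lmodType R) i (Z : 'I_n -> W) : comb (delta_mx 0 i) Z = Z i.
Proof.
rewrite /comb (bigD1 i)//= big1 ?addr0 => [|j ji]; rewrite mxE/= ?eqxx ?scale1r//.
by rewrite (negbTE ji) scale0r.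
Qed.

Lemma comb_exchange (W : lmodType R) v w (F : 'I_n -> 'I_n -> W) :
  comb v (fun i => comb w (F i)) = comb w (fun j => comb v (F ^~ j)).
Proof.
rewrite /comb; under eq_bigr do rewrite scaler_sumr.
rewrite exchange_big; apply: eq_bigr => j _; rewrite scaler_sumr.
by apply: eq_bigr => i _; rewrite !scalerA mulrC.
Qed.

Lemma mulmx_comb m p q v w (P : 'I_n -> 'M[R]_(m, p)) (Q : 'I_n -> 'M[R]_(p, q)) :
  comb v P *m comb w Q = comb w (fun i => comb v (fun j => P j *m Q i)).
Proof.
rewrite /comb mulmx_sumr; apply: eq_bigr => i _.
rewrite mulmx_suml scaler_sumr; apply: eq_bigr => j _.
by rewrite -scalemxAl -scalemxAr !scalerA mulrC.
Qed.

Lemma continuous_comb (T : topologicalType) (W : normedModType R) v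
    (Z : 'I_n -> T -> W) x :
  (forall i, {for x, continuous (Z i)}) ->
  {for x, continuous (fun y => comb v (Z ^~ y))}.
Proof.
move=> cZ; rewrite /comb; apply: cvg_big => [|i _]; first exact: add_continuous.
by apply: cvgZ; [exact: cvg_cst|exact: cZ].
Qed.

Lemma continuous_combl (W : normedModType R) (Z : 'I_n -> W) :
  continuous (fun v : 'rV[R]_n => comb v Z).
Proof.
move=> v; apply: differentiable_continuous; apply: differentiable_bigsum => i.
by apply: differentiableZl; exact: differentiable_coord.
Qed.

Lemma is_derive_comb (W : normedModType R) v (Z : 'I_n -> R -> W) (dZ : 'I_n -> W) (t : R) :
  (forall i, is_derive t 1 (Z i) (dZ i)) ->
  is_derive t 1 (fun s => comb v (Z ^~ s)) (comb v dZ).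
Proof.
move=> H; have d i : derivable (fun s => v 0 i *: Z i s) t 1.
  by apply: (@derivableZ _ _ _ (Z i)); have [] := H i.
split; first exact: derivable_bigsum.
rewrite /comb derive_bigsum//; apply: eq_bigr => i _.
have [dd <-] := H i; exact: deriveZ.
Qed.

End Combination.

Lemma subr_trans (V : zmodType) (a b c : V) : a - b = (c - b) - (c - a).
Proof. by rewrite opprB [RHS]addrC addrA subrK. Qed.

Lemma near_dist_lt (R : realType) (V : normedModType R) (z : V) (r : R) :
  0 < r -> \forall y \near z, `|y - z| < r.
Proof.
move=> r0; apply/nbhs_ballP; exists r => // y.
by rewrite -ball_normE/= distrC.
Qed.

Section DerivativeProducts.
Context {R : realType}.

Lemma is_derive_mulmx (V : normedModType R) m n p (F : V -> 'M[R]_(m, n))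
    (G : V -> 'M[R]_(n, p)) x v dF dG :
  is_derive x v F dF -> is_derive x v G dG ->
  is_derive x v (fun y => F y *m G y) (dF *m G x + F x *m dG).
Proof.
move=> [dF' <-] [dG' <-]; split; first exact: derivable_mulmx.
exact: derive_mulmx.
Qed.

Lemma is_derive_scale_id m n (C : R -> 'M[R]_(m, n)) (t : R) dC :
  is_derive t 1 C dC -> is_derive t 1 (fun s => s *: C s) (C t + t *: dC).
Proof.
move=> HC; have dl := is_diff_scalel t (1%:M : 'M[R]_m).
have H1 : is_derive t 1 ( *:%R^~ (1%:M : 'M[R]_m)) 1%:M.
  by split; [exact: diff_derivable|rewrite deriveE// diff_val scale1r].
have := is_derive_mulmx H1 HC.
under eq_fun do rewrite -scalemxAl mul1mx.
by rewrite mul1mx -scalemxAl mul1mx.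
Qed.

End DerivativeProducts.

Section UniformTaylor.
Context {R : realType} {n : nat} {W : normedModType R}.

(* Compactness of the segment makes a local estimate uniform along it. *)
Lemma near_segment (P : 'rV[R]_n -> R -> Prop) :
  (forall t : R, t \in `[0, 1] ->
    \forall sh \near (t, (0 : 'rV[R]_n)), (sh.1 : R) \in `[0, 1] -> P sh.2 sh.1) ->
  \forall h \near (0 : 'rV[R]_n), forall t : R, t \in `[0, 1] -> P h t.
Proof.
move=> HP.
have /compact_near_coveringP/near_covering_withinP C := @segment_compact R 0 1.
have := C _ (nbhs (0 : 'rV[R]_n)) P _ _.
by apply => t t01; exact: HP.
Qed.

Lemma uniform_continuous_segment (A : 'rV[R]_n -> W) (z x : 'rV[R]_n) :
  (forall t : R, t \in `[0, 1] -> {for z + t *: x, continuous A}) ->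
  forall e : R, 0 < e -> \forall h \near (0 : 'rV[R]_n), forall t : R, t \in `[0, 1] ->
    `|A (z + t *: (x + h)) - A (z + t *: x)| <= e.
Proof.
move=> cA e e0; apply: near_segment => t t01.
have e2 : 0 < e / 2 by rewrite divr_gt0.
have /cvgrPdist_le/(_ _ e2) H := cA t t01.
have c1 : (fun sh : R * 'rV[R]_n => z + sh.1 *: (x + sh.2)) @ (t, (0 : 'rV[R]_n)) --> z + t *: (x + 0).
  apply: cvgD; first exact: cvg_cst.
  apply: cvgZ; first exact: cvg_fst.
  by apply: cvgD; [exact: cvg_cst|exact: cvg_snd].
have c2 : (fun sh : R * 'rV[R]_n => z + sh.1 *: x) @ (t, (0 : 'rV[R]_n)) --> z + t *: x.
  apply: cvgD; first exact: cvg_cst.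
  by apply: cvgZ; [exact: cvg_fst|exact: cvg_cst].
rewrite addr0 in c1.
have N1 : \forall sh \near (t, (0 : 'rV[R]_n)),
  `|A (z + t *: x) - A (z + sh.1 *: (x + sh.2))| <= e / 2 by exact: c1 _ H.
have N2 : \forall sh \near (t, (0 : 'rV[R]_n)),
  `|A (z + t *: x) - A (z + sh.1 *: x)| <= e / 2 by exact: c2 _ H.
apply: filterS2 N1 N2 => -[s h] /= H1 H2 _.
have -> : A (z + s *: (x + h)) - A (z + s *: x) =
    (A (z + t *: x) - A (z + s *: x)) - (A (z + t *: x) - A (z + s *: (x + h))).
  exact: subr_trans.
by rewrite (le_trans (ler_normB _ _))// [leRHS]splitr lerD.
Qed.

End UniformTaylor.

(** Differentiability at each point of the segment would give a range of [h] that depends on [t].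
    Continuity of the partial derivatives, through the mean value inequality, gives a range that is
    good for all parameters near [t], and compactness concludes. *)
Lemma uniform_taylor_segment {R : realType} {n m p : nat}
    (A : 'rV[R]_n -> 'M[R]_(m, p)) (z x : 'rV[R]_n) :
  (forall t : R, t \in `[0, 1] -> \forall y \near z + t *: x, differentiable A y) ->
  (forall (t : R) j, t \in `[0, 1] -> {for z + t *: x, continuous (partial j A)}) ->
  forall e : R, 0 < e -> \forall h \near (0 : 'rV[R]_n), forall t : R, t \in `[0, 1] ->
    `|A (z + t *: (x + h)) - A (z + t *: x)
      - t *: comb h (fun j => partial j A (z + t *: x))| <= e * `|h|.
Proof.
move=> dA cA e e0; apply: near_segment => t t01.
(* Contraction with [h] sums [n] terms; the extra 1 keeps the divisor positive when [n = 0]. *)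
set K := n%:R + 1 : R; have K0 : 0 < K by rewrite /K ltr_wpDl.
have eK : 0 < e / K by rewrite divr_gt0.
have H : \forall y \near z + t *: x, differentiable A y /\
    forall j, `|partial j A (z + t *: x) - partial j A y| <= e / K / 2.
  have H1 (j : 'I_n) : nbhs (z + t *: x) [set y | `|partial j A (z + t *: x) - partial j A y| <= e / K / 2].
    by have /cvgrPdist_le := cA t j t01; apply; rewrite divr_gt0.
  apply: filterS2 (dA t t01) (filter_forall _ H1) => y dy H2.
  by split=> // j; exact: H2.
have [d d0 dP] := iffLR (nbhs_ballP _ _) H.
have c2 : (fun sh : R * 'rV[R]_n => z + sh.1 *: x) @ (t, (0 : 'rV[R]_n)) --> z + t *: x.
  apply: cvgD; first exact: cvg_cst.
  by apply: cvgZ; [exact: cvg_fst|exact: cvg_cst].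
have d2 : 0 < d / 2 by rewrite divr_gt0.
have N1 : \forall sh \near (t, (0 : 'rV[R]_n)), `|z + t *: x - (z + sh.1 *: x)| < d / 2.
  by move/cvgrPdist_lt : c2; apply.
have N2 : \forall sh \near (t, (0 : 'rV[R]_n)), `|0 - sh.2| < d / 2.
  have c3 : snd @ (t, (0 : 'rV[R]_n)) --> (0 : 'rV[R]_n) by exact: cvg_snd.
  by move/cvgrPdist_lt : c3; apply.
apply: filterS2 N1 N2 => -[s h] /= H1 H2 s01.
rewrite sub0r normrN in H2.
have s01' : 0 <= s <= 1 by move: s01; rewrite in_itv.
have inb (r : R) : r \in `[0, 1] -> ball (z + t *: x) d (z + s *: x + r *: (s *: h)).
  rewrite in_itv/= => r01; rewrite -ball_normE/= opprD addrA (le_lt_trans (ler_normB _ _))//.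
  rewrite [ltRHS]splitr ltr_leD// scalerA normrZ ger0_norm; last by rewrite mulr_ge0; lra.
  apply: le_trans (ltW H2); rewrite ler_piMl// mulr_ile1//; lra.
pose C := s *: comb h (fun j => partial j A (z + s *: x)).
(* Subtracting the linear term makes the Taylor remainder an increment of [f], whose derivative is
   small. *)
pose f (r : R) := A (z + s *: x + r *: (s *: h)) - r *: C.
have -> : A (z + s *: (x + h)) - A (z + s *: x) - C = f 1 - f 0.
  rewrite /f !scale0r !scale1r addr0 subr0 scalerDr addrA.
  by rewrite -!addrA [- C + _]addrC.
have df (r : R) : r \in `[0, 1] -> is_derive r 1 f
    ('D_(s *: h) A (z + s *: x + r *: (s *: h)) - C).
  move=> r01; have [dy _] := dP _ (inb r r01).
  have H3 := is_derive_line dy.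
  have H4 : is_derive r 1 (fun r : R => r *: C) C.
    have dl := is_diff_scalel r C.
    by split; [exact: diff_derivable|rewrite deriveE// diff_val scale1r].
  exact: is_deriveB.
have : `|f 1 - f 0| <= e * `|h| * (1 - 0); last by rewrite subr0 mulr1.
apply: mvt_mx => //; first by move=> r /df [].
move=> r r01; have [_ ->] := df r r01; have [dy py] := dP _ (inb r r01).
have i0 : (0 : R) \in `[0, 1] by rewrite in_itv/= lexx ler01.
have [_ p0] := dP _ (inb 0 i0); rewrite scale0r addr0 in p0.
rewrite derive_partial// -/(comb _ _) combZl -scalerBr -combB normrZ.
rewrite ger0_norm; last by case/andP: s01'.
apply: (@le_trans _ _ `|comb h (fun i => partial i A (z + s *: x + r *: (s *: h)) - partial i A (z + s *: x))|).
  by rewrite ler_piMl//; case/andP: s01'.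
apply: (@le_trans _ _ (n%:R * (`|h| * (e / K)))).
  apply: norm_comb => [|j]; first exact: ltW.
  rewrite (subr_trans _ _ (partial j A (z + t *: x))).
  apply: le_trans (ler_normB _ _) _; rewrite [leRHS]splitr.
  by apply: lerD; [exact: p0|exact: py].
rewrite mulrA [n%:R * _]mulrC -mulrA mulrC ler_wpM2r// mulrCA ler_piMr ?(ltW e0)//.
by rewrite ler_pdivrMr// mul1r /K; lra.
Qed.

(** * Parallel sections of a flat connection, by transport along rays *)

Section Frobenius.
Context {R : realType} {n N : nat}.
Variables (A : 'I_n -> 'rV[R]_n -> 'M[R]_N) (z : 'rV[R]_n) (d M : R).
Hypothesis d0 : 0 < d.
Hypothesis dA : forall x i, `|x| < d -> differentiable (A i) (z + x).
Hypothesis cA : forall x i j, `|x| < d -> {for z + x, continuous (partial j (A i))}.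
Hypothesis flatA : forall x i j, `|x| < d ->
  partial j (A i) (z + x) + A j (z + x) *m A i (z + x) =
  partial i (A j) (z + x) + A i (z + x) *m A j (z + x).
Hypothesis MA : forall x i, `|x| < d -> `|A i (z + x)| <= M.
Hypothesis M0 : 0 <= M.
Hypothesis dM : N%:R * (n%:R * (d * M)) <= 2^-1.

(** The connection form on the velocity of the ray from [z] to [z + x]. On the ball of radius [d]
    the hypothesis [dM] gives it the smallness that [linear_ode] asks for. *)
Let B (x : 'rV[R]_n) (t : R) := comb x (fun i => A i (z + clamp t *: x)).

Let ball_scale (x : 'rV[R]_n) (t : R) : t \in `[0, 1] -> `|x| < d -> `|t *: x| < d.
Proof.
rewrite in_itv/= => /andP[t0 t1]; apply: le_lt_trans.
by rewrite normrZ ger0_norm// ler_piMl.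
Qed.

Let normB x t : `|x| < d -> N%:R * `|B x t| <= 2^-1.
Proof.
move=> xd; apply: le_trans dM; rewrite ler_wpM2l//.
apply: (le_trans (norm_comb _ M0 _)) => [i|].
  by apply: MA; apply: ball_scale => //; exact: clamp_itv.
by rewrite ler_wpM2l// ler_wpM2r// ltW.
Qed.

Let continuousB x : `|x| < d -> continuous (B x).
Proof.
move=> xd t; apply: continuous_comb => i.
apply: (@continuous_comp _ _ _ (fun t => z + clamp t *: x) (A i)).
  apply: cvgD; first exact: cvg_cst.
  by apply: cvgZ; [exact: continuous_clamp|exact: cvg_cst].
apply: differentiable_continuous; apply: dA.
by apply: ball_scale => //; exact: clamp_itv.
Qed.

Let solution : exists Y : 'rV[R]_n -> R -> 'M[R]_N, forall x, `|x| < d ->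
  Y x 0 = 1%:M /\ forall t : R, t \in `[0, 1] -> is_derive t 1 (Y x) (Y x t *m B x t).
Proof.
suff /choice[Y YP] : forall x, exists Y : R -> 'M[R]_N, `|x| < d ->
    Y 0 = 1%:M /\ forall t : R, t \in `[0, 1] -> is_derive t 1 Y (Y t *m B x t).
  by exists Y.
move=> x; have [xd|] := ltP `|x| d; last by exists (fun=> 0).
by have [Y Y0 YP] := linear_ode (continuousB xd) (fun t => normB t xd); exists Y.
Qed.

Section Estimate.
Variable Y : 'rV[R]_n -> R -> 'M[R]_N.
Hypothesis YP : forall x, `|x| < d ->
  Y x 0 = 1%:M /\ forall t : R, t \in `[0, 1] -> is_derive t 1 (Y x) (Y x t *m B x t).

Let normY x (t : R) : `|x| < d -> t \in `[0, 1] -> `|Y x t| <= 2.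
Proof.
move=> xd t01; have [Y0 dY] := YP xd.
have : `|Y x t - 1%:M| <= 2 * 2^-1.
  apply: (@half_gronwall _ _ _ (fun t => Y x t - 1%:M) (fun t => Y x t *m B x t)) => //.
  - move=> s s01; have := is_deriveB (dY s s01) (is_derive_cst (1%:M : 'M[R]_N) _ _).
    by rewrite subr0.
  - by rewrite Y0 subrr.
  - move=> s s01; apply: (le_trans (half_mul _ (normB s xd))).
    have : `|Y x s| <= `|Y x s - 1%:M| + 1.
      rewrite -{1}[Y x s](subrK 1%:M) (le_trans (ler_normD _ _))// lerD2l.
      exact: scalar1_norm_le.
    lra.
have : `|Y x t| <= `|Y x t - 1%:M| + 1.
  rewrite -{1}[Y x t](subrK 1%:M) (le_trans (ler_normD _ _))// lerD2l.
  exact: scalar1_norm_le.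
lra.
Qed.

(* E compares the transport along the ray through x + h with the transport
   along the ray through x followed by the infinitesimal transport along t h;
   flatness is what makes the first-order part of the defect of E vanish. *)
Let defect x h (e : R) : `|x| < d -> `|x + h| < d -> 0 < e -> `|h| <= e ->
  (forall i (t : R), t \in `[0, 1] ->
     `|A i (z + t *: (x + h)) - A i (z + t *: x)| <= e) ->
  (forall i (t : R), t \in `[0, 1] ->
     `|A i (z + t *: (x + h)) - A i (z + t *: x)
       - t *: comb h (fun j => partial j (A i) (z + t *: x))| <= e * `|h|) ->
  `|Y (x + h) 1 - Y x 1 - Y x 1 *m comb h (fun i => A i (z + x))| <=
  e * `|h| * (4 * N%:R * (n%:R * `|x| + n%:R +
     N%:R * n%:R * M * (n%:R * `|x| + n%:R * M))).
Proof.
move=> xd yd e0 he H1 H2.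
have [Yx0 dYx] := YP xd; have [Yy0 dYy] := YP yd.
pose C t := comb h (fun i => A i (z + t *: x)).
pose D t := comb h (fun i => comb x (fun j => partial j (A i) (z + t *: x))).
pose D' t := comb x (fun i => comb h (fun j => partial j (A i) (z + t *: x))).
pose E t := Y (x + h) t - Y x t *m (1%:M + t *: C t).
(* First-order Taylor remainder, in [h], of the coefficient along the ray; [rem] adds a product of
   two small factors. *)
pose rho t := B (x + h) t - B x t - C t - t *: D' t.
pose rem t := rho t + t *: (C t *m (B (x + h) t - B x t)).
(* The flatness equation contracted with [x] and [h]. It trades the derivative of the connection in
   the direction [h] for the one along the ray. *)
have flatCD (t : R) : t \in `[0, 1] -> D' t + C t *m B x t = D t + B x t *m C t.
  move=> t01; rewrite /B (clamp_id t01) /C /D /D' !mulmx_comb.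
  rewrite (comb_exchange h x (fun i j => partial j (A i) (z + t *: x))).
  rewrite (comb_exchange h x (fun i j => A j (z + t *: x) *m A i (z + t *: x))).
  apply: (@comb2D _ _ 'M[R]_N x h (fun i j => partial j (A i) (z + t *: x))
    (fun i j => A j (z + t *: x) *m A i (z + t *: x))
    (fun i j => partial i (A j) (z + t *: x))
    (fun i j => A i (z + t *: x) *m A j (z + t *: x))) => i j.
  by apply: flatA; exact: ball_scale.
have dC (t : R) : t \in `[0, 1] -> is_derive t 1 C (D t).
  move=> t01; apply: is_derive_comb => i.
  have dd := dA i (ball_scale t01 xd).
  have := is_derive_line dd.
  by rewrite derive_partial.
(* [E] satisfies the equation of [Y (x + h)] with a source of order [o(h)], to which the Gronwall
   estimate applies. *)
have dE (t : R) : t \in `[0, 1] ->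
    is_derive t 1 E (E t *m B (x + h) t + Y x t *m rem t).
  move=> t01.
  have H3 : is_derive t 1 (fun t => 1%:M + t *: C t) (0 + (C t + t *: D t)).
    exact: is_deriveD (is_derive_cst _ _ _) (is_derive_scale_id (dC t t01)).
  have H4 := is_deriveB (dYy t t01) (is_derive_mulmx (dYx t t01) H3).
  apply: is_derive_eq H4 _; rewrite add0r.
  have := flatCD t t01; rewrite /E /rem /rho.
  move: (Y x t) (Y (x + h) t) (B x t) (B (x + h) t) (C t) (D t) (D' t).
  move=> Yx Yy Bx By Ct Dt Dt' flat.
  rewrite -[Yx *m Bx *m _]mulmxA -mulmxDr [in RHS]mulmxBl -addrA -mulmxA; congr (_ + _).
  rewrite addrC -[RHS]opprB -mulmxBr; congr (- (_ *m _)).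
  rewrite mulmxDr mulmxDl mulmx1 mul1mx -scalemxAr -scalemxAl mulmxBr.
  have {flat} : Dt = Dt' + Ct *m Bx - Bx *m Ct by rewrite flat addrK.
  move=> ->; move: (Bx *m Ct) (Ct *m By) (Ct *m Bx) => U1 U2 U3.
  by apply/matrixP => i j; rewrite !mxE; ring.
have nC (t : R) : t \in `[0, 1] -> `|C t| <= n%:R * (`|h| * M).
  by move=> t01; apply: norm_comb => // i; apply: MA; exact: ball_scale.
have nB (t : R) : t \in `[0, 1] ->
    `|B (x + h) t - B x t| <= n%:R * (`|x| * e) + n%:R * (e * M).
  move=> t01; rewrite /B (clamp_id t01) combDl addrAC -combB.
  rewrite (le_trans (ler_normD _ _))// lerD//.
    by apply: norm_comb => [|i]; [exact: ltW|exact: H1].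
  apply: (@le_trans _ _ (n%:R * (`|h| * M))).
    by apply: norm_comb => // i; apply: MA; exact: ball_scale.
  by rewrite ler_wpM2l// ler_wpM2r.
have nrho (t : R) : t \in `[0, 1] -> `|rho t| <= n%:R * (`|x| * (e * `|h|)) + n%:R * (`|h| * e).
  move=> t01; rewrite /rho /B (clamp_id t01) combDl /C /D'.
  have -> : forall a b c d e : 'M[R]_N, a + b - c - d - e = (a - c - e) + (b - d).
    by move=> *; apply/matrixP => i j; rewrite !mxE; ring.
  rewrite -!combB -combZr -combB.
  rewrite (le_trans (ler_normD _ _))// lerD//.
    apply: norm_comb => [|i]; first by rewrite mulr_ge0// ltW.
    exact: H2.
  by apply: norm_comb => [|i]; [exact: ltW|exact: H1].
set K := n%:R * `|x| + n%:R + N%:R * n%:R * M * (n%:R * `|x| + n%:R * M).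
have nrem (t : R) : t \in `[0, 1] -> `|rem t| <= e * `|h| * K.
  move=> t01; rewrite /rem (le_trans (ler_normD _ _))//.
  have -> : e * `|h| * K = n%:R * (`|x| * (e * `|h|)) + n%:R * (`|h| * e) +
    N%:R * ((n%:R * (`|h| * M)) * (n%:R * (`|x| * e) + n%:R * (e * M))).
    by rewrite /K; ring.
  apply: lerD; first exact: nrho.
  rewrite normrZ; apply: (@le_trans _ _ `|C t *m (B (x + h) t - B x t)|).
    by rewrite ler_piMl//; move: t01; rewrite in_itv/= => /andP[t0 t1]; rewrite ger0_norm.
  rewrite (le_trans (mx_norm_mul _ _))// ler_wpM2l//.
  by apply: ler_pM => //; [exact: nC|exact: nB].
have i1 : (1 : R) \in `[0, 1] by rewrite in_itv/= lexx ler01.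
have -> : Y (x + h) 1 - Y x 1 - Y x 1 *m comb h (fun i => A i (z + x)) = E 1.
  by rewrite /E /C !scale1r mulmxDr mulmx1 opprD addrA.
(* One factor 2 comes from [half_gronwall], the other bounds [Y], and [N] comes from the norm of a
   matrix product. *)
have -> : e * `|h| * (4 * N%:R * K) = 2 * (N%:R * (2 * (e * `|h| * K))) by ring.
apply: (half_gronwall dE) => //.
  by rewrite /E Yx0 Yy0 scale0r addr0 mulmx1 subrr.
move=> t t01; rewrite (le_trans (ler_normD _ _))// lerD//.
  exact: half_mul (normB t yd).
rewrite (le_trans (mx_norm_mul _ _))// ler_wpM2l// ler_pM//.
  exact: normY.
exact: nrem.
Qed.

Let transport := fun w => Y (w - z) 1.

(** The ray equation controls only the radial derivative; [defect] supplies the derivative in all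
    directions, with the differential given by the connection. *)
Lemma transport_diff x : `|x| < d ->
  differentiable transport (z + x) /\
  forall i, partial i transport (z + x) = transport (z + x) *m A i (z + x).
Proof.
move=> xd; pose L h := transport (z + x) *m comb h (fun i => A i (z + x)).
have Llin : linear L.
  move=> a u v; rewrite /L combDl combZl mulmxDr; congr (_ + _).
  by rewrite -scalemxAr.
pose LM := GRing.isLinear.Build R _ _ _ L Llin.
pose LL : {linear 'rV[R]_n -> 'M[R]_N} := HB.pack L LM.
have cL : continuous LL.
  suff : continuous L by [].
  move=> v; apply: (@continuous_mulmx R 'rV[R]_n N N N (cst (transport (z + x)))
    (fun h => comb h (fun i => A i (z + x))) v); first exact: cst_continuous.
  exact: continuous_combl.
have [] := @bound_differentiable R _ _ transport LL (z + x) cL.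
  move=> e e0.
  set K := 4 * N%:R * (n%:R * `|x| + n%:R +
     N%:R * n%:R * M * (n%:R * `|x| + n%:R * M)).
  have K0 : 0 <= K by rewrite /K !(mulr_ge0, addr_ge0).
  have eK : 0 < e / (K + 1) by rewrite divr_gt0// ltr_wpDl.
  have N1 : \forall h \near (0 : 'rV[R]_n), `|x + h| < d.
    have xd' : 0 < d - `|x| by rewrite subr_gt0.
    apply: filterS (near_dist_lt (0 : 'rV[R]_n) xd') => h; rewrite subr0 => hd.
    by rewrite (le_lt_trans (ler_normD _ _))//; lra.
  have N2 : \forall h \near (0 : 'rV[R]_n), `|h| <= e / (K + 1).
    by apply: filterS (near_dist_lt (0 : 'rV[R]_n) eK) => h; rewrite subr0 => /ltW.
  have N3 i : \forall h \near (0 : 'rV[R]_n), forall t : R, t \in `[0, 1] ->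
     `|A i (z + t *: (x + h)) - A i (z + t *: x)| <= e / (K + 1).
    apply: uniform_continuous_segment => // t t01.
    by apply: differentiable_continuous; apply: dA; exact: ball_scale.
  have N4 i : \forall h \near (0 : 'rV[R]_n), forall t : R, t \in `[0, 1] ->
     `|A i (z + t *: (x + h)) - A i (z + t *: x)
       - t *: comb h (fun j => partial j (A i) (z + t *: x))| <= e / (K + 1) * `|h|.
    apply: uniform_taylor_segment => // [t t01|t j t01].
      have nb : \forall y \near z + t *: x, `|y - z| < d.
        have xt := ball_scale t01 xd.
        have xd' : 0 < d - `|t *: x| by rewrite subr_gt0.
        apply: filterS (near_dist_lt (z + t *: x) xd') => y yd.
        have -> : y - z = (y - (z + t *: x)) + t *: x by rewrite opprD addrA subrK.
        by rewrite (le_lt_trans (ler_normD _ _))//; lra.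
      by apply: filterS nb => y yd; rewrite -[y](subrK z) addrC; exact: dA.
    by apply: cA; exact: ball_scale.
  apply: filterS3 (filterI N1 N2) (filter_forall _ N3) (filter_forall _ N4).
  move=> h [h1 h2] h3 h4.
  rewrite /= /L /transport [h + _]addrC.
  have E1 : z + x + h - z = x + h by rewrite addrAC [z + x]addrC addrK.
  have E2 : z + x - z = x by rewrite addrC addKr.
  rewrite E1 E2.
  apply: le_trans (defect xd h1 eK h2 h3 h4) _.
  have gen (a b c : R) : c + 1 != 0 -> a / (c + 1) * b * c = a * b * (c / (c + 1)).
    by move=> c1; field.
  rewrite -/K gen; last by rewrite gt_eqF// ltr_wpDl.
  rewrite ler_piMr ?mulr_ge0 ?(ltW e0)//.
  by rewrite ler_pdivrMr ?mul1r; lra.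
move=> dS vS; split=> // i.
by rewrite partialE deriveE// vS /= /L comb_delta.
Qed.

End Estimate.

Lemma flat_section_ball : exists S : 'rV[R]_n -> 'M[R]_N, S z = 1%:M /\
  forall x, `|x| < d -> differentiable S (z + x) /\
    forall i, partial i S (z + x) = S (z + x) *m A i (z + x).
Proof.
have [Y YP] := solution; exists (fun w => Y (w - z) 1).
split; last exact: transport_diff.
have z0 : `|0 : 'rV[R]_n| < d by rewrite normr0.
(* The ray to [z] itself is constant, so its coefficient vanishes and the solution keeps its initial
   value. *)
have [Y0 dY] := YP _ z0; rewrite subrr; apply/eqP; rewrite -subr_eq0 -normr_le0 -Y0.
rewrite -[leRHS](mul0r (1 - 0)); apply: mvt_mx => // t t01.
  by have [] := dY t t01.
by have [_ ->] := dY t t01; rewrite /B comb0l mulmx0 normr0.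
Qed.

End Frobenius.

(* Frobenius: a flat linear connection is locally trivial. *)
Lemma flat_section (R : realType) n N (A : 'I_n -> 'rV[R]_n -> 'M[R]_N) (z : 'rV[R]_n) :
  (\forall x \near z, forall i, differentiable (A i) x /\
     forall j, {for x, continuous (partial j (A i))} /\
       partial j (A i) x + A j x *m A i x = partial i (A j) x + A i x *m A j x) ->
  exists S : 'rV[R]_n -> 'M[R]_N, S z = 1%:M /\
    \forall x \near z, differentiable S x /\ forall i, partial i S x = S x *m A i x.
Proof.
move=> H.
pose M := \sum_i `|A i z| + 1 : R.
have M0 : 0 <= M by rewrite /M addr_ge0// sumr_ge0.
have H2 : \forall x \near z, forall i, `|A i x| <= M.
  suff H2 i : nbhs z [set x | `|A i x| <= M] by exact: filter_forall H2.
  have c1 : `|A i x| @[x --> z] --> `|A i z|.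
    have cAi := differentiable_continuous (nbhs_singleton H i).1.
    exact: cvg_norm cAi.
  apply: (cvgr_le _ c1); rewrite /M (bigD1 i)//= -addrA ltrDl ltr_wpDl// sumr_ge0//.
have [d d0 dP] := iffLR (nbhs_ballP _ _) (filterI H H2).
have C0 : 0 <= N%:R * (n%:R * M) by rewrite !mulr_ge0.
(* With [C = N n M], the second bound gives [r C <= C / (2 C + 1) <= 1/2]. *)
pose r := Num.min d (2 * (N%:R * (n%:R * M)) + 1)^-1.
have r0 : 0 < r by rewrite lt_min d0 invr_gt0; lra.
have inb x : `|x| < r -> ball z d (z + x).
  rewrite lt_min => /andP[xd _]; rewrite -ball_normE/= opprD addrA subrr sub0r normrN//.
have [||||||S [S0 SP]] := @flat_section_ball R n N A z r M r0; last first.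
- exists S; split => //.
  by apply: filterS (near_dist_lt z r0) => y yr; rewrite -[y](subrK z) addrC; exact: SP.
- have -> : N%:R * (n%:R * (r * M)) = r * (N%:R * (n%:R * M)) by ring.
  have : r <= (2 * (N%:R * (n%:R * M)) + 1)^-1 by rewrite ge_min lexx orbT.
  move=> rC; apply: le_trans (ler_wpM2r C0 rC) _.
  by rewrite mulrC ler_pdivrMr; lra.
- exact: M0.
- by move=> x i /inb /dP [_]; exact.
- by move=> x i j /inb /dP [/(_ i) [_ /(_ j) []]].
- by move=> x i j /inb /dP [/(_ i) [_ /(_ j) []]].
- by move=> x i /inb /dP [/(_ i) []].
Qed.

(** * The Levi-Civita connection and its curvature *)

Section ContinuouslyDifferentiable.
Context {R : realType} {n : nat}.
Variable U : set 'rV[R]_n.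
Hypothesis oU : open U.

Lemma near_open x : U x -> \forall y \near x, U y.
Proof. by move=> Ux; apply: open_nbhs_nbhs. Qed.

Lemma C1_differentiable (W : normedModType R) (F : 'rV[R]_n -> W) x :
  Ck_on 1 U F -> U x -> differentiable F x.
Proof. by move=> [+ _]; exact. Qed.

Lemma C1_continuous (W : normedModType R) (F : 'rV[R]_n -> W) x i :
  Ck_on 1 U F -> U x -> {for x, continuous (partial i F)}.
Proof. by move=> [_ +]; exact. Qed.

Lemma smooth_C1 (W : normedModType R) (F : 'rV[R]_n -> W) :
  smooth_on U F -> Ck_on 1 U F.
Proof. exact. Qed.

Lemma smooth_partial (W : normedModType R) (F : 'rV[R]_n -> W) i :
  smooth_on U F -> smooth_on U (partial i F).
Proof. by move=> sF k; have [_] := sF k.+1; exact. Qed.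

(** Continuity and derivatives are local and [U] is open, so values on [U] decide. *)
Lemma eq_Ck (W : normedModType R) k (F G : 'rV[R]_n -> W) :
  (forall x, U x -> F x = G x) -> Ck_on k U F -> Ck_on k U G.
Proof.
elim: k F G => [|k IH] F G FG.
  move=> cF x Ux; have FGx : \forall y \near x, F y = G y.
    by apply: filterS (near_open Ux) => y; exact: FG.
  rewrite /prop_for/= /continuous_at -FG//.
  exact: cvg_trans (near_eq_cvg FGx) (cF x Ux).
move=> [dF pF]; split.
  move=> x Ux; apply: near_eq_differentiable (dF x Ux).
  by apply: filterS (near_open Ux) => y; exact: FG.
move=> i; apply: IH (pF i) => x Ux; apply: near_eq_partial.
by apply: filterS (near_open Ux) => y; exact: FG.
Qed.

Lemma C1_mulmx m p q (F : 'rV[R]_n -> 'M[R]_(m, p)) (G : 'rV[R]_n -> 'M[R]_(p, q)) :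
  Ck_on 1 U F -> Ck_on 1 U G -> Ck_on 1 U (fun x => F x *m G x).
Proof.
move=> [dF pF] [dG pG]; split.
  by move=> x Ux; apply: differentiable_mulmx; [exact: dF|exact: dG].
move=> i; apply: (@eq_Ck _ 0 (fun x => partial i F x *m G x + F x *m partial i G x)).
  move=> x Ux; rewrite !partialE derive_mulmx//.
    by apply: diff_derivable; exact: dF.
  by apply: diff_derivable; exact: dG.
move=> x Ux.
exact: (continuousD
  (continuous_mulmx (pF i x Ux) (differentiable_continuous (dG x Ux)))
  (continuous_mulmx (differentiable_continuous (dF x Ux)) (pG i x Ux))).
Qed.

Lemma C1_trmx m p (F : 'rV[R]_n -> 'M[R]_(m, p)) :
  Ck_on 1 U F -> Ck_on 1 U (fun x => (F x)^T).
Proof.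
move=> [dF pF]; split; first by move=> x Ux; apply: differentiable_trmx; exact: dF.
move=> i; apply: (@eq_Ck _ 0 (fun x => (partial i F x)^T)).
  by move=> x Ux; rewrite !partialE derive_trmx//; apply: diff_derivable; exact: dF.
by move=> x Ux; apply: continuous_trmx; exact: pF.
Qed.

Lemma C1_mxP m p (F : 'rV[R]_n -> 'M[R]_(m, p)) :
  (forall i j, Ck_on 1 U (fun x => F x i j)) -> Ck_on 1 U F.
Proof.
move=> cF; split.
  by move=> x Ux; apply/differentiable_mxP => a b; exact: (cF a b).1.
move=> i x Ux; apply/continuous_mxP => a b.
apply: (@eq_Ck _ 0 (partial i (fun z => F z a b))) x Ux; last exact: (cF a b).2.
move=> y Uy; apply/esym/partial_entry.
by apply/differentiable_mxP => a' b'; exact: (cF a' b').1.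
Qed.

Lemma C1_entry m p (F : 'rV[R]_n -> 'M[R]_(m, p)) i j :
  Ck_on 1 U F -> Ck_on 1 U (fun x => F x i j).
Proof.
move=> [dF pF]; split.
  by move=> x Ux; move/differentiable_mxP: (dF x Ux); exact.
move=> k; apply: (@eq_Ck _ 0 (fun x => partial k F x i j)).
  by move=> x Ux; rewrite partial_entry//; exact: dF.
by move=> x Ux; move/continuous_mxP: (pF k x Ux); exact.
Qed.

Lemma C1_cst (W : normedModType R) (a : W) : Ck_on 1 U (cst a).
Proof.
split=> [x Ux|i]; first exact: differentiable_cst.
apply: (@eq_Ck _ 0 (cst 0)) => [x Ux|x Ux]; first by rewrite partialE derive_cst.
exact: cst_continuous.
Qed.

Lemma C1_D (W : normedModType R) (F G : 'rV[R]_n -> W) :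
  Ck_on 1 U F -> Ck_on 1 U G -> Ck_on 1 U (fun x => F x + G x).
Proof.
move=> [dF pF] [dG pG]; split.
  by move=> x Ux; apply: differentiableD; [exact: dF|exact: dG].
move=> i; apply: (@eq_Ck _ 0 (fun x => partial i F x + partial i G x)).
  move=> x Ux; rewrite !partialE -deriveD//; apply: diff_derivable.
    exact: dF.
  exact: dG.
by move=> x Ux; exact: (continuousD (pF i x Ux) (pG i x Ux)).
Qed.

Lemma C1_Z (W : normedModType R) (a : R) (F : 'rV[R]_n -> W) :
  Ck_on 1 U F -> Ck_on 1 U (fun x => a *: F x).
Proof.
move=> [dF pF]; split; first by move=> x Ux; apply: differentiableZ; exact: dF.
move=> i; apply: (@eq_Ck _ 0 (fun x => a *: partial i F x)).
  by move=> x Ux; rewrite !partialE -deriveZ//; apply: diff_derivable; exact: dF.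
by move=> x Ux; exact: (cvgZ (cvg_cst a) (pF i x Ux)).
Qed.

Lemma C1_invmx m (F : 'rV[R]_n -> 'M[R]_m) :
  Ck_on 1 U F -> (forall x, U x -> F x \in unitmx) ->
  Ck_on 1 U (fun x => invmx (F x)).
Proof.
move=> [dF pF] uF; split.
  by move=> x Ux; apply: differentiable_invmx; [exact: dF|exact: uF].
move=> i.
apply: (@eq_Ck _ 0 (fun x => - (invmx (F x) *m partial i F x *m invmx (F x)))).
  by move=> x Ux; rewrite !partialE derive_invmx//; [exact: dF|exact: uF].
move=> x Ux; have cI : {for x, continuous (fun x => invmx (F x))}.
  by apply: continuous_invmx; [apply: differentiable_continuous; exact: dF|exact: uF].
exact: (continuousN (continuous_mulmx (continuous_mulmx cI (pF i x Ux)) cI)).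
Qed.

End ContinuouslyDifferentiable.

Section PartialRules.
Context {R : realType} {n : nat}.

Lemma partialD (W : normedModType R) (F G : 'rV[R]_n -> W) i x :
  differentiable F x -> differentiable G x ->
  partial i (fun y => F y + G y) x = partial i F x + partial i G x.
Proof. by move=> dF dG; rewrite !partialE -deriveD//; exact: diff_derivable. Qed.

Lemma partial_mulmx m p q (F : 'rV[R]_n -> 'M[R]_(m, p)) (G : 'rV[R]_n -> 'M[R]_(p, q)) i x :
  differentiable F x -> differentiable G x ->
  partial i (fun y => F y *m G y) x = partial i F x *m G x + F x *m partial i G x.
Proof. by move=> dF dG; rewrite !partialE derive_mulmx//; exact: diff_derivable. Qed.

Lemma partial_trmx m p (F : 'rV[R]_n -> 'M[R]_(m, p)) i x :
  differentiable F x -> partial i (fun y => (F y)^T) x = (partial i F x)^T.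
Proof. by move=> dF; rewrite !partialE derive_trmx//; exact: diff_derivable. Qed.

Lemma partial_invmx m (F : 'rV[R]_n -> 'M[R]_m) i x :
  differentiable F x -> F x \in unitmx ->
  partial i (fun y => invmx (F y)) x = - (invmx (F x) *m partial i F x *m invmx (F x)).
Proof. by move=> dF uF; rewrite !partialE derive_invmx. Qed.

Lemma partial_cst (W : normedModType R) (a : W) i (x : 'rV[R]_n) : partial i (cst a) x = 0.
Proof. by rewrite partialE derive_cst. Qed.

Lemma partial_row m p (F : 'rV[R]_n -> 'M[R]_(m, p)) i k x :
  differentiable F x -> partial i (fun y => row k (F y)) x = row k (partial i F x).
Proof.
move=> dF; rewrite [RHS]rowE.
have -> : (fun y => row k (F y)) = (fun y => delta_mx 0 k *m F y).
  by apply/funext => y; rewrite rowE.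
rewrite (partial_mulmx _ (differentiable_cst _ _) dF).
by rewrite -[X in X *m _ + _]/(partial i (cst (delta_mx 0 k : 'rV[R]_m)) x) partial_cst mul0mx add0r.
Qed.

End PartialRules.

(** A nonzero vector in the kernel would have norm zero. *)
Lemma posdef_unit (R : realType) n (G : 'M[R]_n) :
  (forall v, v != 0 -> 0 < inner G v v) -> G \in unitmx.
Proof.
move=> Gp; rewrite -row_free_unit; apply: inj_row_free => v vG.
apply/eqP; apply: contraPT (Gp v) => v0 H.
by have := H v0; rewrite /inner vG mul0mx mxE ltxx.
Qed.

(** * Matrix identities behind the Levi-Civita connection and its curvature *)

Section KoszulAlgebra.
Context {R : realType} {n : nat}.
Implicit Types P M : 'I_n -> 'M[R]_n.

(* The Koszul formula, for P i the i-th partial derivative of the metric. *)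
Definition koszul P i : 'M[R]_n :=
  \matrix_(j, l) (2^-1 * (P i j l + P j i l - P l i j)).

(** [koszul P i] is the connection matrix with its upper index lowered; this is compatibility with
    the metric. *)
Lemma koszulD P i : (forall o, (P o)^T = P o) -> koszul P i + (koszul P i)^T = P i.
Proof.
move=> s; have e o a b : P o a b = P o b a by rewrite -[in LHS]s mxE.
apply/matrixP => j l; rewrite !mxE (e i l j) (e l i j) (e j i l) (e l j i); by field.
Qed.

(** Vanishing of the torsion. *)
Lemma koszul_row P i j : (forall o, (P o)^T = P o) -> row j (koszul P i) = row i (koszul P j).
Proof.
move=> s; have e o a b : P o a b = P o b a by rewrite -[in LHS]s mxE.
by apply/rowP => l; rewrite !mxE (e l i j) [P i j l + _]addrC.
Qed.

(** In the combination of three permuted compatibility equations, symmetry in the first two indices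
    cancels all but one unknown. *)
Lemma koszul_unique P M : (forall i j, row j (M i) = row i (M j)) ->
  (forall i, P i = M i + (M i)^T) -> forall i, M i = koszul P i.
Proof.
move=> Ms PM i; have e a b c : M a b c = M b a c.
  by have /rowP/(_ c) := Ms a b; rewrite !mxE.
apply/matrixP => j l; rewrite mxE !PM !mxE (e i l j) (e j l i) (e j i l); by field.
Qed.

(** Here [a] and [b] stand for the derivatives of [Gj] along [i] and of [Gi] along [j]. The premise
    equates the two mixed second derivatives of the metric, expanded by compatibility. *)
Lemma curv_skew_algebra (a b Gi Gj g : 'M[R]_n) :
  a *m g + Gj *m (Gi *m g + g *m Gi^T) + ((Gi *m g + g *m Gi^T) *m Gj^T + g *m a^T) =
  b *m g + Gi *m (Gj *m g + g *m Gj^T) + ((Gj *m g + g *m Gj^T) *m Gi^T + g *m b^T) ->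
  (a - b + Gj *m Gi - Gi *m Gj) *m g + g *m (a - b + Gj *m Gi - Gi *m Gj)^T = 0.
Proof.
have trB (A B : 'M[R]_n) : (A - B)^T = A^T - B^T by rewrite linearB.
have trD (A B : 'M[R]_n) : (A + B)^T = A^T + B^T by rewrite linearD.
have trN (A : 'M[R]_n) : (- A)^T = - A^T by rewrite linearN.
rewrite !(trB, trD, trN, trmx_mul) !(mulmxDl, mulmxDr, mulmxBl, mulmxBr, mulNmx, mulmxN) !mulmxA.
move: (a *m g) (b *m g) (g *m a^T) (g *m b^T) (Gj *m Gi *m g) (Gi *m Gj *m g).
move: (Gj *m g *m Gi^T) (Gi *m g *m Gj^T) (g *m Gi^T *m Gj^T) (g *m Gj^T *m Gi^T).
move=> t1 t2 t3 t4 t5 t6 t7 t8 t9 t10 /matrixP E; apply/matrixP => k l.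
by move: (E k l); rewrite !mxE; lra.
Qed.

(** First Bianchi identity, with [D a b] for the derivative of [G b] along [a]: vanishing torsion,
    and its derivative, make the terms cancel in pairs. *)
Lemma bianchi_algebra (D : 'I_n -> 'I_n -> 'M[R]_n) (G : 'I_n -> 'M[R]_n) i j k :
  (forall a b c, row c (D a b) = row b (D a c)) ->
  (forall a b, row b (G a) = row a (G b)) ->
  row k (D i j - D j i + G j *m G i - G i *m G j) +
  row i (D j k - D k j + G k *m G j - G j *m G k) +
  row j (D k i - D i k + G i *m G k - G k *m G i) = 0.
Proof.
move=> Ds Gs.
have rB (A B : 'M[R]_n) c : row c (A - B) = row c A - row c B by rewrite linearB.
have rD (A B : 'M[R]_n) c : row c (A + B) = row c A + row c B by rewrite linearD.
have rN (A : 'M[R]_n) c : row c (- A) = - row c A by rewrite linearN.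
rewrite !(rB, rD, rN) !row_mul (Ds i j k) (Ds j i k) (Ds k j i).
rewrite (Gs j k) (Gs i k) (Gs j i).
move: (row j (D i k)) (row i (D j k)) (row i (D k j)) (row j (G k) *m G i).
move: (row j (D k i)) (row k (G i) *m G j) (row i (G k) *m G j) (row i (G j) *m G k).
by move=> *; apply/rowP => l; rewrite !mxE; ring.
Qed.

End KoszulAlgebra.

Section LeviCivita.
Context {R : realType} {n : nat}.
Implicit Types (g : 'rV[R]_n -> 'M[R]_n).

(* The connection matrix of nabla_(d_i): its row j is nabla_(d_i) d_j. *)
Definition gam g i (x : 'rV[R]_n) : 'M[R]_n := \matrix_(j, k) christoffel g i j k x.

(** Row [k] is [R(d_i, d_j) d_k]. *)
Definition curv g i j (x : 'rV[R]_n) : 'M[R]_n := \matrix_(k, l) riemann g i j k l x.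

Lemma gamE g i x :
  gam g i x = koszul (fun k => partial k g x) i *m (invmx (g x))^T.
Proof.
apply/matrixP => j k; rewrite !mxE /christoffel mulr_sumr; apply: eq_bigr => l _.
by rewrite !mxE -mulrA; congr (_ * _); rewrite mulrC.
Qed.

(** This identifies connections without computing Christoffel symbols: under a change of chart, and
    for an isometric embedding in Euclidean space. *)
Lemma levi_civita_unique g x (T : 'I_n -> 'M[R]_n) :
  (g x)^T = g x -> g x \in unitmx ->
  (forall i, partial i g x = T i *m g x + g x *m (T i)^T) ->
  (forall i j, row j (T i) = row i (T j)) -> forall i, T i = gam g i x.
Proof.
move=> gs gu Tg Ts i; rewrite gamE trmx_inv gs.
rewrite -(@koszul_unique _ _ _ (fun i => T i *m g x)) ?mulmxK//.
  by move=> a b; rewrite !row_mul Ts.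
by move=> a; rewrite Tg trmx_mul gs.
Qed.

Variable U : set 'rV[R]_n.
Variable g : 'rV[R]_n -> 'M[R]_n.
Hypothesis oU : open U.
Hypothesis sg : smooth_on U g.
Hypothesis symg : forall x, U x -> (g x)^T = g x.
Hypothesis ug : forall x, U x -> g x \in unitmx.

Let dg x : U x -> differentiable g x.
Proof. exact: C1_differentiable (smooth_C1 sg). Qed.

Lemma partial_sym x : U x -> forall i, (partial i g x)^T = partial i g x.
Proof.
move=> Ux i; rewrite -partial_trmx; last exact: dg.
by apply: near_eq_partial; apply: filterS (near_open oU Ux) => y; exact: symg.
Qed.

Lemma gam_metric i x : U x ->
  partial i g x = gam g i x *m g x + g x *m (gam g i x)^T.
Proof.
move=> Ux; have {2}-> : g x = (g x)^T by rewrite symg.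
rewrite -trmx_mul gamE trmx_inv symg// mulmxKV ?ug// koszulD//.
exact: partial_sym.
Qed.

Lemma gam_row i j x : U x -> row j (gam g i x) = row i (gam g j x).
Proof.
move=> Ux; rewrite !gamE !row_mul; congr (_ *m _); apply: koszul_row.
exact: partial_sym.
Qed.

Lemma C1_gam i : Ck_on 1 U (gam g i).
Proof.
have -> : gam g i = fun x => koszul (fun k => partial k g x) i *m (invmx (g x))^T.
  by apply/funext => x; rewrite gamE.
apply: C1_mulmx => //; last first.
  by apply: C1_trmx => //; apply: C1_invmx => //; exact: smooth_C1.
apply: C1_mxP => // j l.
have H a b c : Ck_on 1 U (fun x => partial a g x b c).
  by apply: C1_entry => //; apply: smooth_C1; exact: smooth_partial.
have H1 := C1_Z oU 2^-1 (C1_D oU (C1_D oU (H i j l) (H j i l)) (C1_Z oU (-1) (H l i j))).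
by apply: eq_Ck H1 => // x Ux; rewrite mxE scaleN1r.
Qed.

Let dgam i x : U x -> differentiable (gam g i) x.
Proof. exact: C1_differentiable (C1_gam i). Qed.

(** The products appear in reverse order because the matrices act on row vectors from the right. *)
Lemma curvE i j x : U x -> curv g i j x =
  partial i (gam g j) x - partial j (gam g i) x
  + gam g j x *m gam g i x - gam g i x *m gam g j x.
Proof.
move=> Ux; apply/matrixP => k l.
have E (A B C D : 'M[R]_n) : (A - B + C - D) k l = A k l - B k l + (C k l - D k l).
  by rewrite !mxE addrA.
rewrite E (@partial_entry _ _ _ _ (gam g j) i x k l (dgam j Ux)).
rewrite (@partial_entry _ _ _ _ (gam g i) j x k l (dgam i Ux)).
rewrite [LHS]mxE /riemann sumrB.
have F a : (fun y => gam g a y k l) = christoffel g a k l.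
  by apply/funext => y; rewrite mxE.
rewrite !F; congr (_ - _ + (_ - _)).
- by rewrite mxE; apply: eq_bigr => s _; rewrite !mxE.
- by rewrite mxE; apply: eq_bigr => s _; rewrite !mxE.
Qed.

Lemma curvC i j x : U x -> curv g j i x = - curv g i j x.
Proof.
move=> Ux; rewrite !curvE//.
move: (partial i _ x) (partial j _ x) (gam g i x *m _) (gam g j x *m _).
by move=> a b c d; apply/matrixP => k l; rewrite !mxE; ring.
Qed.

Lemma curv_skew i j x : U x ->
  curv g i j x *m g x + g x *m (curv g i j x)^T = 0.
Proof.
move=> Ux.
have pp a b : partial a (partial b g) x =
    partial a (gam g b) x *m g x + gam g b x *m (gam g a x *m g x + g x *m (gam g a x)^T)
    + ((gam g a x *m g x + g x *m (gam g a x)^T) *m (gam g b x)^T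
       + g x *m (partial a (gam g b) x)^T).
  have dG := dgam b Ux; have dGT := differentiable_trmx dG; have dgx := dg Ux.
  rewrite (@near_eq_partial _ _ _ _ (fun y => gam g b y *m g y + g y *m (gam g b y)^T)); last first.
    by apply: filterS (near_open oU Ux) => y; exact: gam_metric.
  rewrite partialD; last 2 first.
  - exact: differentiable_mulmx.
  - exact: differentiable_mulmx.
  by rewrite !partial_mulmx// partial_trmx// -gam_metric.
rewrite curvE//; apply: curv_skew_algebra; rewrite -!pp.
apply: schwarz_mx.
- by apply: filterS (near_open oU Ux) => y; exact: dg.
- exact: C1_differentiable (smooth_C1 (smooth_partial i sg)) Ux.
- exact: C1_differentiable (smooth_C1 (smooth_partial j sg)) Ux.
Qed.

Lemma curv_bianchi i j k x : U x ->
  row k (curv g i j x) + row i (curv g j k x) + row j (curv g k i x) = 0.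
Proof.
move=> Ux; rewrite !curvE//.
apply: (@bianchi_algebra _ _ (fun a b => partial a (gam g b) x) (gam g ^~ x)) => [a b c|a b].
  rewrite -!partial_row//; try exact: dgam.
  by apply: near_eq_partial; apply: filterS (near_open oU Ux) => y; exact: gam_row.
exact: gam_row.
Qed.

End LeviCivita.

(** * A curvature tensor is determined by its sectional values *)

Section Polarization.
Context {R : realFieldType} {V : zmodType}.
Variable Q : V -> V -> V -> V -> R.
Hypothesis Q12 : forall a b c d, Q b a c d = - Q a b c d.
Hypothesis Q34 : forall a b c d, Q a b d c = - Q a b c d.
Hypothesis QB : forall a b c d, Q a b c d + Q b c a d + Q c a b d = 0.
(** Combination of the four Bianchi identities obtained by rotating the arguments cyclically. *)
Lemma pair_symmetry a b c d : Q a b c d = Q c d a b.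
Proof.
have := QB a b c d; have := QB b c d a; have := QB c d a b; have := QB d a b c.
have := Q34 b c a d; have := Q34 c d a b; have := Q12 b d c a; have := Q34 b d a c.
have := Q12 a d c b; have := Q34 a d b c; have := Q12 a d b c; have := Q12 c a d b.
have := Q34 c a b d; have := Q34 a b c d; lra.
Qed.

Hypothesis QD : forall a b c c' d, Q a b (c + c') d = Q a b c d + Q a b c' d.
Hypothesis Q0 : forall a b, Q a b b a = 0.

Lemma polarization a b c d : Q a b c d = 0.
Proof.
have D1 u u' v w x : Q (u + u') v w x = Q u v w x + Q u' v w x.
  by rewrite !(pair_symmetry _ v w x) QD.
have D2 u u' v w x : Q v (u + u') w x = Q v u w x + Q v u' w x.
  by have := D1 u u' v w x; rewrite !(Q12 v); lra.
have D4 u u' v w x : Q v w x (u + u') = Q v w x u + Q v w x u'.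
  by have := QD v w u u' x; rewrite !(Q34 v w x); lra.
(* Polarizes [Q0] in its repeated middle argument; the next step polarizes the outer one. Then [Q]
   is alternating enough for the three Bianchi terms to coincide, so that three times [Q]
   vanishes. *)
have H u v w : Q u v w u = 0.
  have := Q0 u (v + w); rewrite !D2 !QD !Q0.
  have := pair_symmetry u w v u; have := Q12 u v u w; have := Q34 u v w u; lra.
have S u v w x : Q u v w x = - Q u w v x.
  have := H (u + x) v w; rewrite !D1 !D4 !H.
  have := pair_symmetry x v w u; have := Q12 u w x v; have := Q34 u w v x; lra.
have := QB a b c d; have := S b c a d; have := Q12 a b c d; have := S a b c d.
have := Q12 a c b d; lra.
Qed.

End Polarization.

Section Inner.
Context {R : realFieldType} {n : nat}.
Variable G : 'M[R]_n.
Local Notation inner u v := ((u *m G *m v^T) 0 0).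

Lemma innerDl (u u' v : 'rV[R]_n) : inner (u + u') v = inner u v + inner u' v.
Proof. by rewrite !mulmxDl mxE. Qed.

Lemma innerZl a (u v : 'rV[R]_n) : inner (a *: u) v = a * inner u v.
Proof. by rewrite -!scalemxAl mxE. Qed.

Lemma innerNl (u v : 'rV[R]_n) : inner (- u) v = - inner u v.
Proof. by rewrite !mulNmx mxE. Qed.

Lemma innerDr (u v v' : 'rV[R]_n) : inner u (v + v') = inner u v + inner u v'.
Proof. by rewrite linearD/= mulmxDr mxE. Qed.

Lemma innerZr a (u v : 'rV[R]_n) : inner u (a *: v) = a * inner u v.
Proof. by rewrite linearZ/= -scalemxAr mxE. Qed.

Lemma innerNr (u v : 'rV[R]_n) : inner u (- v) = - inner u v.
Proof. by rewrite linearN/= mulmxN mxE. Qed.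

Lemma innerC (u v : 'rV[R]_n) : G^T = G -> inner u v = inner v u.
Proof.
move=> symG; rewrite -[in LHS](trmxK (u *m G *m v^T)) mxE.
by rewrite !trmx_mul trmxK symG mulmxA.
Qed.

Lemma mul_outer (u v w : 'rV[R]_n) : u *m (G *m v^T *m w) = inner u v *: w.
Proof. by rewrite mulmxA (mulmxA u) [X in X *m w = _]mx11_scalar mul_scalar_mx. Qed.

Hypothesis symG : G^T = G.
Hypothesis posG : forall v : 'rV[R]_n, v != 0 -> 0 < inner v v.

(** Equality case of Cauchy-Schwarz: the component of [u] orthogonal to [v] has squared norm equal
    to the Gram determinant over [inner v v]. *)
Lemma gram_eq0 (u v : 'rV[R]_n) : v != 0 ->
  inner u u * inner v v - inner u v ^+ 2 = 0 -> u = (inner u v / inner v v) *: v.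
Proof.
move=> v0 D0; have vv := posG v0; apply/eqP; rewrite -subr_eq0; apply: contraPT D0.
move=> /posG; rewrite !(innerDl, innerDr, innerNl, innerNr, innerZl, innerZr).
rewrite (innerC v u symG); move: (inner u u) (inner v v) (inner u v) vv => A B C B0.
have -> : A - C / B * C + (- (C / B * C) - C / B * - (C / B * B)) = (A * B - C ^+ 2) / B.
  by field; rewrite gt_eqF.
by move=> + E; rewrite E mul0r ltxx.
Qed.

Lemma gram_row_free (u v : 'rV[R]_n) :
  inner u u * inner v v - inner u v ^+ 2 != 0 -> row_free (col_mx u v).
Proof.
move=> D0; apply: inj_row_free => w.
rewrite -[w]hsubmxK mul_row_col [lsubmx w]mx11_scalar [rsubmx w]mx11_scalar !mul_scalar_mx.
move: (lsubmx w 0 0) (rsubmx w 0 0) => a b E.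
have := congr1 (fun z : 'rV[R]_n => inner z u) E; have := congr1 (fun z : 'rV[R]_n => inner z v) E.
have z0 (y : 'rV[R]_n) : inner 0 y = 0 by rewrite !mul0mx mxE.
rewrite !innerDl !innerZl (innerC v u symG) !z0.
move: D0; move: (inner u u) (inner v v) (inner u v) => A B C D0 E1 E2.
have a0 : a = 0.
  apply/eqP; have /eqP : a * (A * B - C ^+ 2) = 0.
    have -> : a * (A * B - C ^+ 2) = (a * A + b * C) * B - (a * C + b * B) * C by ring.
    by rewrite E1 E2 !mul0r subr0.
  by rewrite mulf_eq0 (negPf D0) orbF.
have b0 : b = 0.
  apply/eqP; have /eqP : b * (A * B - C ^+ 2) = 0.
    have -> : b * (A * B - C ^+ 2) = (a * C + b * B) * A - (a * A + b * C) * C by ring.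
    by rewrite E1 E2 !mul0r subr0.
  by rewrite mulf_eq0 (negPf D0) orbF.
by rewrite a0 b0 !raddf0 row_mx0.
Qed.

End Inner.

Section ConstantCurvature.
Context {R : realType} {n : nat}.
Implicit Types (g : 'rV[R]_n -> 'M[R]_n) (a b c d u v : 'rV[R]_n).

(** The endomorphism [R(a, b)], acting on row vectors from the right. *)
Definition curv_mx g x a b : 'M[R]_n :=
  \sum_i \sum_j (a 0 i * b 0 j) *: curv g i j x.

Lemma curvature_opE g x a b c : curvature_op g x a b c = c *m curv_mx g x a b.
Proof.
apply/rowP => l; rewrite !mxE.
under [RHS]eq_bigr => k _.
  rewrite /curv_mx summxE mulr_sumr.
  under eq_bigr => i _.
    rewrite summxE mulr_sumr; under eq_bigr => j _ do rewrite !mxE mulrCA mulrA.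
    over.
  over.
rewrite [RHS]exchange_big/=; apply: eq_bigr => i _.
by rewrite exchange_big/=; apply: eq_bigr => j _; apply: eq_bigr.
Qed.

Variable U : set 'rV[R]_n.
Variable g : 'rV[R]_n -> 'M[R]_n.
Hypothesis oU : open U.
Hypothesis sg : smooth_on U g.
Hypothesis symg : forall x, U x -> (g x)^T = g x.
Hypothesis posg : forall x, U x -> forall v, v != 0 -> 0 < inner (g x) v v.

Let ug x : U x -> g x \in unitmx.
Proof. by move=> Ux; apply: posdef_unit; exact: posg. Qed.

Lemma curv_mxC x a b : U x -> curv_mx g x b a = - curv_mx g x a b.
Proof.
move=> Ux; rewrite /curv_mx exchange_big/= -sumrN; apply: eq_bigr => i _.
rewrite -sumrN; apply: eq_bigr => j _.
by rewrite (curvC oU sg ug _ _ Ux) scalerN mulrC.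
Qed.

Lemma curv_mx_bianchi x a b c : U x ->
  c *m curv_mx g x a b + a *m curv_mx g x b c + b *m curv_mx g x c a = 0.
Proof.
move=> Ux.
have E u v w : w *m curv_mx g x u v =
    \sum_i \sum_j \sum_k (u 0 i * v 0 j * w 0 k) *: row k (curv g i j x).
  rewrite /curv_mx mulmx_sumr; apply: eq_bigr => i _.
  rewrite mulmx_sumr; apply: eq_bigr => j _.
  rewrite -scalemxAr [w in LHS]row_sum_delta mulmx_suml scaler_sumr; apply: eq_bigr => k _.
  by rewrite -scalemxAl -rowE scalerA.
have rot (F : 'I_n -> 'I_n -> 'I_n -> 'rV[R]_n) :
    \sum_i \sum_j \sum_k F i j k = \sum_k \sum_i \sum_j F i j k.
  by under eq_bigr do rewrite exchange_big; rewrite exchange_big.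
rewrite !E [X in _ + X + _]rot [X in _ + _ + X]rot [X in _ + _ + X]rot.
rewrite -!big_split big1// => i _; rewrite -!big_split big1// => j _.
rewrite -!big_split big1// => k _ /=.
have -> : b 0 j * c 0 k * a 0 i = a 0 i * b 0 j * c 0 k by ring.
have -> : c 0 k * a 0 i * b 0 j = a 0 i * b 0 j * c 0 k by ring.
by rewrite -!scalerDr (curv_bianchi oU sg symg ug) ?scaler0.
Qed.

Lemma curv_mx_skew x a b : U x ->
  curv_mx g x a b *m g x = - (g x *m (curv_mx g x a b)^T).
Proof.
move=> Ux; rewrite /curv_mx mulmx_suml -mulmxN.
rewrite linear_sum/= -sumrN mulmx_sumr; apply: eq_bigr => i _.
rewrite mulmx_suml linear_sum/= -sumrN mulmx_sumr; apply: eq_bigr => j _.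
rewrite linearZ/= -scalerN -scalemxAr -scalemxAl; congr (_ *: _).
by apply/eqP; rewrite mulmxN -addr_eq0 (curv_skew oU sg symg ug).
Qed.

Lemma curv_mxZl x t a b : curv_mx g x (t *: a) b = t *: curv_mx g x a b.
Proof.
rewrite /curv_mx scaler_sumr; apply: eq_bigr => i _.
by rewrite scaler_sumr; apply: eq_bigr => j _; rewrite mxE scalerA mulrA.
Qed.

Lemma curv_mx_diag x a : U x -> curv_mx g x a a = 0.
Proof.
move=> Ux; apply/eqP; have /eqP := curv_mxC a a Ux.
by rewrite -addr_eq0 -mulr2n -scaler_nat scaler_eq0 pnatr_eq0.
Qed.

Lemma constant_curvature x k : U x ->
  (forall u v, row_free (col_mx u v) -> sectional g x u v = k) ->
  forall a b, curv_mx g x a b = k *: (g x *m b^T *m a - g x *m a^T *m b).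
Proof.
move=> Ux sec a b.
pose G := g x; pose C := curv_mx g x.
(* The curvature tensor minus the model tensor of constant curvature [k]; it has all the symmetries
   required for polarization. *)
pose Q (a b c d : 'rV[R]_n) := inner G (c *m C a b) d -
  k * (inner G b c * inner G a d - inner G a c * inner G b d).
have symG := symg Ux; have posG := posg Ux.
have CC u v : C v u = - C u v by exact: curv_mxC.
have Q0 u v : Q u v v u = 0.
  have [->|v0] := eqVneq v 0.
    by rewrite /Q /inner !mul0mx trmx0 !mulmx0 !mxE; ring.
  (* For dependent vectors the hypothesis on planes is silent, but both tensors vanish. *)
  have [D0|D0] := eqVneq (inner G u u * inner G v v - inner G u v ^+ 2) 0.
    rewrite (gram_eq0 symG posG v0 D0); move: (_ / _) => t.
    rewrite /Q /C curv_mxZl curv_mx_diag// scaler0 mulmx0 /inner !mul0mx mxE.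
    by rewrite !(innerZl, innerZr); ring.
  have := sec _ _ (gram_row_free symG D0).
  rewrite /sectional curvature_opE => /(congr1 (fun t => t * (inner G u u * inner G v v - inner G u v ^+ 2))).
  rewrite divfK// => E; rewrite /Q E /inner (innerC v u symG); ring.
have H c d : Q a b c d = 0.
  apply: polarization Q0 _ _ _ _ => [u v w y|u v w y|u v w y|u v w w' y].
  - rewrite /Q CC mulmxN /inner innerNl; ring.
  - rewrite /Q; have -> : inner G (w *m C u v) y = - inner G (y *m C u v) w.
      rewrite /inner (innerC (y *m C u v) w symG).
      have -> : w *m C u v *m G *m y^T = - (w *m G *m (y *m C u v)^T).
        by rewrite -(mulmxA w) curv_mx_skew// mulmxN mulNmx trmx_mul !mulmxA.
      by rewrite mxE.
    ring.
  - have /(congr1 (fun z => inner G z y)) := curv_mx_bianchi u v w Ux.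
    have z0 : inner G 0 y = 0 by rewrite /inner !mul0mx mxE.
    rewrite z0 /Q /inner !innerDl -/C -/G (innerC v u symG) (innerC w u symG) (innerC w v symG).
    rewrite -/G; lra.
  - by rewrite /Q /inner mulmxDl !innerDl !innerDr; ring.
apply/eqP; rewrite -subr_eq0; set D := _ - _.
suff D0 (c : 'rV[R]_n) : c *m D = 0 by apply/eqP/row_matrixP => i; rewrite rowE D0 raddf0.
(* Testing with [y = c D] turns [Q = 0] into the vanishing of the norm of [c D]. *)
have QD y : Q a b c y = inner G (c *m D) y.
  have -> : c *m D = c *m C a b - k *: (inner G c b *: a - inner G c a *: b).
    by rewrite mulmxBr -scalemxAr mulmxBr !mul_outer.
  rewrite /inner innerDl innerNl innerZl innerDl innerZl innerNl innerZl -/G.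
  rewrite /Q /inner (innerC b c symG) (innerC a c symG) -/G; ring.
by apply/eqP; apply: contraPT (H c (c *m D)) => /posG/lt0r_neq0/eqP; rewrite QD.
Qed.

End ConstantCurvature.

(** * Monodromy *)

Section Monodromy.
Context {R : realType}.

(** Compactness of the interval for properties of subintervals that can be concatenated: the
    supremum of the [t] with [P a0 t] is attained, and it could be passed if it were below [b0]. *)
Lemma interval_induction (P : R -> R -> Prop) (a0 b0 : R) : a0 <= b0 ->
  (forall a b c, a0 <= a -> a <= b -> b <= c -> c <= b0 -> P a b -> P b c -> P a c) ->
  (forall x, a0 <= x -> x <= b0 -> exists2 e, 0 < e &
     forall a b, a0 <= a -> a <= x -> x <= b -> b <= b0 ->
       x - e < a -> b < x + e -> P a b) ->
  P a0 b0.
Proof.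
move=> ab0 Padd Ploc.
pose E := [set t | a0 <= t <= b0 /\ P a0 t].
have Ea : E a0.
  split; first by rewrite lexx.
  by have [e e0] := Ploc a0 (lexx _) ab0; apply; lra.
have supE : has_sup E.
  by split; [exists a0|exists b0 => t [/andP[]]].
set s := sup E.
have as_ : a0 <= s by apply: ub_le_sup => //; exact: supE.2.
have sb : s <= b0 by apply: ge_sup; [exists a0|move=> t [/andP[]]].
have [e e0 eP] := Ploc s as_ sb.
have [t [/andP[at_ tb] Pt] st] := sup_adherent e0 supE.
have ts : t <= s by apply: ub_le_sup; [exact: supE.2|split => //; rewrite at_].
have Ps : P a0 s.
  by apply: (Padd a0 t s) => //; apply: eP => //; rewrite -/s; lra.
have [sb'|bs] := ltP (s + e / 2) b0; last first.
  apply: (Padd a0 s b0) => //; apply: eP => //; lra.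
have Pb : P a0 (s + e / 2).
  by apply: (Padd a0 s (s + e / 2)) => //; try lra; apply: eP; lra.
have : s + e / 2 <= s.
  apply: ub_le_sup; first exact: supE.2.
  by split => //; lra.
lra.
Qed.

(** Relative continuity phrased with neighbourhoods of the ambient space, which is convenient for
    gluing and reparametrizing. *)
Definition cont_on (T X : topologicalType) (D : set T) (f : T -> X) :=
  forall z, D z -> forall U, nbhs (f z) U -> \forall y \near z, D y -> U (f y).

Lemma within_cont_on (T X : topologicalType) (D : set T) (f : T -> X) :
  {within D, continuous f} -> cont_on D f.
Proof.
move=> cf z Dz U Uz; have := cf z; rewrite /continuous_at => /(_ U Uz).
by rewrite /nbhs/= -nbhs_subspace_in.
Qed.

Lemma cont_on_comp (T T' X : topologicalType) (D : set T) (D' : set T')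
    (c : T' -> T) (f : T -> X) :
  (forall z, D' z -> D (c z)) -> cont_on D' c -> cont_on D f -> cont_on D' (f \o c).
Proof.
move=> DD cc cf z D'z U Uz; have /(cc z D'z) := cf _ (DD _ D'z) U Uz.
by apply: filterS => y H D'y; apply: H => //; exact: DD.
Qed.

Lemma continuous_cont_on (T X : topologicalType) (D : set T) (f : T -> X) :
  continuous f -> cont_on D f.
Proof.
move=> cf z _ U Uz; have H : \forall y \near z, U (f y) := cf z U Uz.
by apply: filterS H.
Qed.

Lemma continuous_pair (T A B : topologicalType) (f : T -> A) (g : T -> B) :
  continuous f -> continuous g -> continuous (fun t => (f t, g t)).
Proof.
move=> cf cg t U [[V W] [/= nV nW] sub].
have H1 : \forall y \near t, V (f y) := cf t V nV.
have H2 : \forall y \near t, W (g y) := cg t W nW.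
by apply: filterS2 H1 H2 => y Vy Wy; exact: (sub (f y, g y)).
Qed.

Definition I01 : set R := [set t | 0 <= t <= 1].

Definition path_concat (X : Type) (g h : R -> X) (t : R) : X :=
  if t <= 2^-1 then g (2 * t) else h (2 * t - 1).

Lemma cont_on_concat (X : topologicalType) (g h : R -> X) :
  cont_on I01 g -> cont_on I01 h -> g 1 = h 0 -> cont_on I01 (path_concat g h).
Proof.
move=> cg ch gh z z01 U; rewrite /path_concat.
have c1 : continuous (fun t : R => 2 * t) by move=> t; exact: mulrl_continuous.
have c2 : continuous (fun t : R => 2 * t - 1).
  by move=> t; apply: cvgB; [exact: mulrl_continuous|exact: cvg_cst].
have L : z <= 2^-1 -> nbhs (g (2 * z)) U ->
    \forall y \near z, I01 y -> y <= 2^-1 -> U (g (2 * y)).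
  move=> zh Uz; have Iz : I01 (2 * z) by move: z01; rewrite /I01/=; lra.
  have H0 : \forall y \near z, I01 (2 * y) -> U (g (2 * y)) := c1 z _ (cg _ Iz U Uz).
  apply: filterS H0 => y H; rewrite /I01/= => y01 yh.
  by apply: H; rewrite /I01/=; lra.
have G : 2^-1 <= z -> nbhs (h (2 * z - 1)) U ->
    \forall y \near z, I01 y -> 2^-1 <= y -> U (h (2 * y - 1)).
  move=> zh Uz; have Iz : I01 (2 * z - 1) by move: z01; rewrite /I01/=; lra.
  have H0 : \forall y \near z, I01 (2 * y - 1) -> U (h (2 * y - 1)) :=
    c2 z _ (ch _ Iz U Uz).
  apply: filterS H0 => y H; rewrite /I01/= => y01 yh.
  by apply: H; rewrite /I01/=; lra.
have [zh|zh|zh] := ltgtP z 2^-1 => Uz.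
- apply: filterS2 (L (ltW zh) Uz) (lt_nbhsl zh) => y H yh y01.
  by rewrite (ltW yh); apply: H => //; exact: ltW.
- apply: filterS2 (G (ltW zh) Uz) (lt_nbhsr zh) => y H yh y01.
  by rewrite leNgt yh /=; apply: H => //; exact: ltW.
- have Uz' : nbhs (h (2 * z - 1)) U.
    have zE : 2 * z - 1 = 0 by lra.
    have zE2 : 2 * z = 1 by lra.
    by rewrite zE -gh -zE2.
  have zl : z <= 2^-1 by lra.
  have zg : 2^-1 <= z by lra.
  apply: filterS2 (L zl Uz) (G zg Uz') => y H1 H2 y01.
  by case: leP => yh; [exact: H1|apply: H2 => //; exact: ltW].
Qed.

Context {X : topologicalType} {N : nat}.
Variable Phi : X -> X -> 'M[R]_N.
Hypothesis Phi1 : forall p, Phi p p = 1%:M.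
Hypothesis PhiM : forall p, \forall y \near p, Phi p y \in unitmx /\
  \forall y' \near y, Phi p y' = Phi p y *m Phi y y'.

(** [Phi p y] plays the role of parallel transport from [p] to a nearby [y], in arbitrary frames at
    the two points. Hence no continuity of [s] is asked for. *)
Definition flat_along (T : topologicalType) (D : set T) (h : T -> X)
    (s : T -> 'rV[R]_N) :=
  forall z, D z -> \forall y \near z, D y -> s y = s z *m Phi (h z) (h y).

Lemma flat_comp (T T' : topologicalType) (D : set T) (D' : set T')
    (c : T' -> T) h s :
  (forall z, D' z -> D (c z)) -> cont_on D' c ->
  flat_along D h s -> flat_along D' (h \o c) (s \o c).
Proof.
move=> DD cc fs z D'z; have /(cc z D'z) := fs _ (DD _ D'z).
by apply: filterS => y H D'y; apply: H => //; exact: DD.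
Qed.

Lemma eq_flat (T : topologicalType) (D : set T) (h h' : T -> X) s :
  (forall z, D z -> h z = h' z) -> flat_along D h s -> flat_along D h' s.
Proof.
move=> hh fs z Dz; have := fs z Dz; apply: filterS => y H Dy.
by rewrite -!hh//; exact: H.
Qed.

Lemma near_interval (x : R) (P : R -> Prop) : (\forall y \near x, P y) ->
  exists2 e, 0 < e & forall y, x - e < y -> y < x + e -> P y.
Proof.
move=> /nbhs_ballP[e e0 eP]; exists e => // y ? ?.
by apply: eP; rewrite /ball/= ltr_distlC; lra.
Qed.

Lemma near_rectangle (z : R * R) (P : R * R -> Prop) : (\forall y \near z, P y) ->
  exists2 e, 0 < e & forall a b, z.1 - e < a -> a < z.1 + e ->
    z.2 - e < b -> b < z.2 + e -> P (a, b).
Proof.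
move=> /nbhs_ballP[e e0 eP]; exists e => // a b ? ? ? ?.
by apply: eP; split; rewrite /ball/= ltr_distlC; lra.
Qed.

(** Near each parameter the transport is invertible, so agreement at one nearby point passes to the
    centre and from there to all other nearby points. *)
Lemma flat_unique (a b : R) (h : R -> X) s1 s2 : a <= b ->
  cont_on [set t | a <= t <= b] h ->
  flat_along [set t | a <= t <= b] h s1 -> flat_along [set t | a <= t <= b] h s2 ->
  s1 a = s2 a -> forall t, a <= t <= b -> s1 t = s2 t.
Proof.
move=> ab ch f1 f2.
apply: (@interval_induction (fun a b => s1 a = s2 a -> forall t, a <= t <= b -> s1 t = s2 t)) => //.
  move=> x y w ax xy yw wb H1 H2 /[dup] /H1 {}H1 Hx t /andP[xt tw].
  have [ty|yt] := leP t y; first by apply: H1; rewrite xt.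
  by apply: H2; [apply: H1; rewrite xy lexx|rewrite (ltW yt)].
move=> x ax xb; have Dx : a <= x <= b by rewrite ax.
have U : \forall y \near x, a <= y <= b -> Phi (h x) (h y) \in unitmx.
  have := ch x Dx _ (PhiM (h x)); apply: filterS => y H Dy.
  by have [] := H Dy.
have [e e0 eP] := near_interval (filterI U (filterI (f1 x Dx) (f2 x Dx))).
exists e => // c d ac cx xd db ec ed scd t /andP[ct td].
have Dc : a <= c <= b by lra.
have Dt : a <= t <= b by lra.
have [Uc [Ec1 Ec2]] := eP c ltac:(lra) ltac:(lra).
have [Ut [Et1 Et2]] := eP t ltac:(lra) ltac:(lra).
rewrite (Et1 Dt) (Et2 Dt); congr (_ *m _).
by move: scd; rewrite (Ec1 Dc) (Ec2 Dc); move/(can_inj (mulmxK (Uc Dc))).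
Qed.

Definition rect (a b c d : R) : set (R * R) :=
  [set z | a <= z.1 <= b /\ c <= z.2 <= d].

(** The value is prescribed at the lower left corner so that adjacent rectangles can be chained. *)
Definition good H a b c d := forall v, exists2 s,
  flat_along (rect a b c d) H s & s (a, c) = v.

(** By the cocycle law, transport from the centre is itself a flat section on a small rectangle; a
    constant left factor then adjusts its value at the corner. *)
Lemma good_local H (x t : R) : cont_on (rect 0 1 0 1) H -> rect 0 1 0 1 (x, t) ->
  exists2 e, 0 < e & forall a b c d, 0 <= a -> a <= x -> x <= b -> b <= 1 ->
    0 <= c -> c <= t -> t <= d -> d <= 1 ->
    x - e < a -> b < x + e -> t - e < c -> d < t + e -> good H a b c d.
Proof.
move=> cH Dxt; set p := H (x, t).
have [e e0 eP] := near_rectangle (cH _ Dxt _ (PhiM p)).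
exists e => // a b c d a0 ax xb b1 c0 ct td d1 ea eb ec ed v.
have sub z : rect a b c d z -> rect 0 1 0 1 z.
  by rewrite /rect/= => -[z1 z2]; split; lra.
have good z : rect a b c d z -> Phi p (H z) \in unitmx /\
    \forall y' \near H z, Phi p y' = Phi p (H z) *m Phi (H z) y'.
  case: z => z1 z2 /[dup] rz /sub r1; apply: eP => //;
  by move: rz; rewrite /rect/=; lra.
have rac : rect a b c d (a, c) by rewrite /rect/=; lra.
exists (fun z => v *m invmx (Phi p (H (a, c))) *m Phi p (H z)); last first.
  by rewrite mulmxKV//; have [] := good _ rac.
move=> z rz; have [_ /(cH _ (sub _ rz))] := good z rz.
by apply: filterS => y H1 ry; rewrite H1 ?mulmxA//; exact: sub.
Qed.

(** The second section starts from the value of the first at the foot of the common edge, and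
    [flat_unique] makes them agree along that edge. *)
Lemma good_glue H a b b' c d : cont_on (rect 0 1 0 1) H ->
  0 <= a -> a <= b -> b <= b' -> b' <= 1 -> 0 <= c -> c <= d -> d <= 1 ->
  good H a b c d -> good H b b' c d -> good H a b' c d.
Proof.
move=> cH a0 ab bb b1 c0 cd d1 G1 G2 v.
have [s1 f1 s1v] := G1 v; have [s2 f2 s2v] := G2 (s1 (b, c)).
have cpair : cont_on [set t | c <= t <= d] (fun t => (b, t)).
  by apply: continuous_cont_on; apply: continuous_pair => t; [exact: cvg_cst|exact: cvg_id].
have edge t : c <= t <= d -> s1 (b, t) = s2 (b, t).
  apply: (@flat_unique c d (fun t => H (b, t)) (fun t => s1 (b, t)) (fun t => s2 (b, t))) => //.
  - apply: (cont_on_comp (D := rect 0 1 0 1) _ cpair cH) => z; rewrite /rect/=; lra.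
  - by apply: (flat_comp (D := rect a b c d) _ cpair f1) => z; rewrite /rect/=; lra.
  - by apply: (flat_comp (D := rect b b' c d) _ cpair f2) => z; rewrite /rect/=; lra.
exists (fun z => if z.1 <= b then s1 z else s2 z); last by rewrite /= ab.
have c1 (z : R * R) : fst @ z --> z.1 by exact: cvg_fst.
move=> [x t] [/= /andP[ax xb] tcd].
have [xb'|xb'|xb'] := ltgtP x b.
- have r1 : rect a b c d (x, t) by split => //=; lra.
  have N1 : \forall y \near (x, t), y.1 < b by exact: (c1 (x, t) _ (lt_nbhsl xb')).
  apply: filterS2 (f1 _ r1) N1 => y H1 yb [y1 y2].
  by rewrite (ltW yb); apply: H1; split=> //; lra.
- have r1 : rect b b' c d (x, t) by split => //=; lra.
  have N1 : \forall y \near (x, t), b < y.1 by exact: (c1 (x, t) _ (lt_nbhsr xb')).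
  apply: filterS2 (f2 _ r1) N1 => y H1 yb [y1 y2].
  by rewrite leNgt yb/=; apply: H1; split=> //; lra.
- rewrite {}xb' in ax xb *.
  have r1 : rect a b c d (b, t) by split => //=; lra.
  have r2 : rect b b' c d (b, t) by split => //=; lra.
  apply: filterS2 (f1 _ r1) (f2 _ r2) => y H1 H2 [y1 y2].
  case: leP => yb; first by apply: H1; split=> //; lra.
  by rewrite edge//; apply: H2; split=> //; lra.
Qed.

Definition swap (z : R * R) : R * R := (z.2, z.1).

Lemma continuous_swap : continuous swap.
Proof. by apply: continuous_pair => z; [exact: cvg_snd|exact: cvg_fst]. Qed.

Lemma good_swap H a b c d : good H a b c d -> good (H \o swap) c d a b.
Proof.
move=> G v; have [s fs sv] := G v; exists (s \o swap) => //.
apply: flat_comp fs; last exact/continuous_cont_on/continuous_swap.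
by move=> z [].
Qed.

(** The outer induction stacks horizontal strips, the inner one builds a strip. The inner property
    carries a height [e], of which the minimum is taken at each gluing; this replaces a Lebesgue
    number. *)
Lemma good_square H : cont_on (rect 0 1 0 1) H -> good H 0 1 0 1.
Proof.
move=> cH.
have cHs : cont_on (rect 0 1 0 1) (H \o swap).
  apply: cont_on_comp cH; last exact/continuous_cont_on/continuous_swap.
  by move=> z [].
have Hss : (H \o swap) \o swap = H by apply/funext => -[].
apply: (@interval_induction (fun c d => good H 0 1 c d)); first exact: ler01.
  move=> a b c a0 ab bc c1 G1 G2; rewrite -Hss; apply: good_swap.
  by apply: good_glue (good_swap G1) (good_swap G2); rewrite ?lexx ?ler01.
move=> t t0 t1.
apply: (@interval_induction (fun a b => exists2 e, 0 < e & forall c d,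
  0 <= c -> c <= t -> t <= d -> d <= 1 -> t - e < c -> d < t + e -> good H a b c d)).
- exact: ler01.
- move=> a b c a0 ab bc c1 [e1 e10 G1] [e2 e20 G2].
  exists (Num.min e1 e2); first by rewrite lt_min e10.
  move=> c' d' c0 ct td d1 ec ed.
  have m1 : Num.min e1 e2 <= e1 by rewrite ge_min lexx.
  have m2 : Num.min e1 e2 <= e2 by rewrite ge_min lexx orbT.
  by apply: (@good_glue H a b c) => //; [lra|apply: G1; lra|apply: G2; lra].
- move=> x x0 x1; have [|e e0 eP] := @good_local H x t cH.
    by rewrite /rect/=; lra.
  exists e => // a b a0 ax xb b1 ea eb; exists e => // c d c0 ct td d1 ec ed.
  exact: eP.
Qed.

(** A path is a homotopy that does not depend on its second variable. *)
Lemma path_lift (g : R -> X) v : cont_on I01 g ->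
  exists2 s, flat_along I01 g s & s 0 = v.
Proof.
move=> cg; have cH : cont_on (rect 0 1 0 1) (g \o fst).
  apply: cont_on_comp cg; first by move=> z [].
  by apply: continuous_cont_on => z; exact: cvg_fst.
have [s fs sv] := good_square cH v; exists (fun t => s (t, 0)) => //.
have cpair : cont_on I01 (fun t : R => (t, 0 : R)).
  by apply: continuous_cont_on; apply: continuous_pair => t; [exact: cvg_id|exact: cvg_cst].
by apply: (flat_comp (D := rect 0 1 0 1) _ cpair fs) => z; rewrite /rect/= lexx ler01.
Qed.

Lemma flat_cst (p : X) v (D : set R) : flat_along D (cst p) (cst v).
Proof. by move=> z _; apply: filterE => y _ /=; rewrite Phi1 mulmx1. Qed.

(** Lift the whole square. Its section is constant along the three sides that [H] maps to [p], so it
    takes the same value at both ends of the bottom side, where it coincides with [s]. *)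
Lemma loop_lift (H : R * R -> X) (p : X) s v : cont_on (rect 0 1 0 1) H ->
  (forall t, I01 t -> H (t, 1) = p) ->
  (forall t, I01 t -> H (0, t) = p /\ H (1, t) = p) ->
  flat_along I01 (fun t => H (t, 0)) s -> s 0 = v -> s 1 = v.
Proof.
move=> cH Htop Hside fs s0.
have [S fS S0] := good_square cH v.
have cl (a b : R * R) : cont_on I01 (fun t : R => (a.1 + t * b.1, a.2 + t * b.2)).
  apply: continuous_cont_on; apply: continuous_pair => t.
    by apply: cvgD; [exact: cvg_cst|exact: mulrr_continuous].
  by apply: cvgD; [exact: cvg_cst|exact: mulrr_continuous].
have edge (a b : R * R) : (forall t, I01 t -> rect 0 1 0 1 (a.1 + t * b.1, a.2 + t * b.2)) ->
    (forall t, I01 t -> H (a.1 + t * b.1, a.2 + t * b.2) = p) ->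
    S (a.1 + b.1, a.2 + b.2) = S a.
  move=> ra Ha.
  have f1 := flat_comp ra (cl a b) fS.
  have f2 := eq_flat Ha f1.
  have := @flat_unique 0 1 (cst p) _ (cst (S a)) ler01 _ f2 (@flat_cst p (S a) I01).
  move=> /(_ _ _ 1); rewrite /= !mul1r !mul0r !addr0 => ->//; last by rewrite lexx ler01.
    by apply: continuous_cont_on => t; exact: cvg_cst.
  by case: (a).
have E1 : S (0, 1) = v.
  rewrite -S0 -(edge (0, 0) (0, 1)) /= ?addr0 ?add0r// => t t01;
  move: (t01); rewrite /I01/= !mulr0 !mulr1 !add0r => t01'; last exact: (Hside _ t01).1.
  by rewrite /rect/= t01' lexx ler01.
have E2 : S (1, 1) = v.
  rewrite -E1 -(edge (0, 1) (1, 0)) /= ?addr0 ?add0r// => t t01;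
  move: (t01); rewrite /I01/= !mulr0 !mulr1 !add0r ?addr0 => t01'; last exact: Htop.
  by rewrite /rect/= t01' lexx ler01.
have E3 : S (1, 0) = v.
  rewrite -E2 -(edge (1, 1) (0, -1)) /= ?addr0 ?subrr// => t t01;
  have t01' : I01 (1 + t * -1) by move: t01; rewrite /I01/=; lra.
    by move: t01'; rewrite mulr0 addr0 /rect/= => ->; rewrite lexx ler01.
  by rewrite mulr0 addr0; exact: (Hside _ t01').2.
have cpair : cont_on I01 (fun t : R => (t, 0 : R)).
  by apply: continuous_cont_on; apply: continuous_pair => t; [exact: cvg_id|exact: cvg_cst].
have sub t : I01 t -> rect 0 1 0 1 (t, 0) by rewrite /rect/= lexx ler01.
have f1 := flat_comp sub cpair fS.
have c1 := cont_on_comp sub cpair cH.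
rewrite (@flat_unique 0 1 _ _ _ ler01 c1 fs f1) ?lexx ?ler01//=.
by rewrite s0 S0.
Qed.

Definition homotopic_loops := forall g : R -> X, cont_on I01 g -> g 0 = g 1 ->
  exists H : R * R -> X, [/\ cont_on (rect 0 1 0 1) H,
    forall t, I01 t -> H (t, 0) = g t,
    forall t, I01 t -> H (t, 1) = g 0 &
    forall t, I01 t -> H (0, t) = g 0 /\ H (1, t) = g 0].

Hypothesis null : homotopic_loops.

(** The loop [g] followed by [h] reversed lifts to a closed section; its two halves restrict to [s1]
    and, reversed, to [s2], and they meet at the parameter 1/2. *)
Lemma lift_endpoint (p q : X) (g h : R -> X) s1 s2 :
  cont_on I01 g -> cont_on I01 h -> g 0 = h 0 -> g 1 = h 1 ->
  flat_along I01 g s1 -> flat_along I01 h s2 -> s1 0 = s2 0 -> s1 1 = s2 1.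
Proof.
move=> cg ch gh0 gh1 f1 f2 s0.
have crev : continuous (fun t : R => 1 - t).
  by move=> t; apply: cvgB; [exact: cvg_cst|exact: cvg_id].
pose k := path_concat g (fun t => h (1 - t)).
have ck : cont_on I01 k.
  apply: cont_on_concat => //; last by rewrite subr0.
  apply: (cont_on_comp (D := I01) _ (continuous_cont_on crev) ch).
  by move=> t; rewrite /I01/=; lra.
have k0 : k 0 = g 0 by rewrite /k /path_concat mulr0 invr_ge0 ler0n.
have k1 : k 1 = h 0.
  rewrite /k /path_concat ifF; last by apply/negbTE; rewrite -ltNge; lra.
  by congr (h _); lra.
have [|H [cH H0 H1 H2]] := null ck; first by rewrite k0 k1.
have [s fs ss] := path_lift (s1 0) ck.
have s1e : s 1 = s1 0.
  apply: (@loop_lift H (k 0) s) => //.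
  by apply: eq_flat fs => t t01; rewrite H0.
have chalf (a b : R) : cont_on I01 (fun t : R => a + t * b).
  by apply: continuous_cont_on => t; apply: cvgD; [exact: cvg_cst|exact: mulrr_continuous].
have fg : flat_along I01 g (s \o (fun t : R => 0 + t * 2^-1)).
  have := flat_comp (D := I01) _ (chalf 0 2^-1) fs.
  move=> /(_ ltac:(by move=> t; rewrite /I01/=; lra))/eq_flat; apply.
  move=> t; rewrite /I01/= => t01; rewrite /k /path_concat ifT; last lra.
  by congr (g _); lra.
have fh : flat_along I01 h (s \o (fun t : R => 1 + t * - 2^-1)).
  have := flat_comp (D := I01) _ (chalf 1 (- 2^-1)) fs.
  move=> /(_ ltac:(by move=> t; rewrite /I01/=; lra))/eq_flat; apply.
  move=> t; rewrite /I01/= => t01; rewrite /k /path_concat.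
  have [tl|tg] := leP; last by congr (h _); lra.
  have -> : t = 1 by lra.
  by rewrite -gh1; congr (g _); lra.
have i1 : (0 : R) <= (1 : R) <= (1 : R) by rewrite ler01 lexx.
rewrite (@flat_unique 0 1 _ _ _ ler01 cg f1 fg) ?i1//=; last by rewrite mul0r addr0 ss.
rewrite (@flat_unique 0 1 _ _ _ ler01 ch f2 fh) ?i1//=; last by rewrite mul0r addr0 s1e.
by congr s; lra.
Qed.

Hypothesis pconn : forall p q : X, exists g : R -> X,
  [/\ cont_on I01 g, g 0 = p & g 1 = q].
Hypothesis lpconn : forall (p : X) U, nbhs p U -> \forall y \near p,
  exists g : R -> X, [/\ cont_on I01 g, g 0 = p, g 1 = y & forall t, I01 t -> U (g t)].

Lemma global_flat_section (p0 : X) v0 : exists2 s : X -> 'rV[R]_N,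
  s p0 = v0 & forall p, \forall y \near p, s y = s p *m Phi p y.
Proof.
have /choice[G GP] p : exists gl : (R -> X) * (R -> 'rV[R]_N),
    [/\ cont_on I01 gl.1, gl.1 0 = p0, gl.1 1 = p, flat_along I01 gl.1 gl.2 & gl.2 0 = v0].
  have [g [cg g0 g1]] := pconn p0 p; have [s fs s0] := path_lift v0 cg.
  by exists (g, s).
exists (fun p => (G p).2 1).
  have [cg g0 g1 fs s0] := GP p0; rewrite -[RHS]/((cst v0 : R -> _) 1).
  apply: (@lift_endpoint p0 p0 (G p0).1 (cst p0)) => //.
    by apply: continuous_cont_on => t; exact: cvg_cst.
  exact: flat_cst.
(* The chosen path to [y] may be replaced by the one to [p] followed by a short path [d], along
   which the section is given by [Phi p]. *)
move=> p; have := lpconn (PhiM p); apply: filterS => y [d [cd d0 d1 dU]].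
have [cg g0 g1 fs s0] := GP p; have [cg' g0' g1' fs' s0'] := GP y.
pose k := path_concat (G p).1 d.
have ck : cont_on I01 k by apply: cont_on_concat => //; rewrite g1 d0.
have [s fk ks] := path_lift v0 ck.
have chalf (a b : R) : cont_on I01 (fun t : R => a + t * b).
  by apply: continuous_cont_on => t; apply: cvgD; [exact: cvg_cst|exact: mulrr_continuous].
have i1 : (0 : R) <= (1 : R) <= (1 : R) by rewrite ler01 lexx.
have fg : flat_along I01 (G p).1 (s \o (fun t : R => 0 + t * 2^-1)).
  have := flat_comp (D := I01) _ (chalf 0 2^-1) fk.
  move=> /(_ ltac:(by move=> t; rewrite /I01/=; lra))/eq_flat; apply.
  move=> t; rewrite /I01/= => t01; rewrite /k /path_concat ifT; last lra.
  by congr ((G p).1 _); lra.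
have fd : flat_along I01 d (s \o (fun t : R => 2^-1 + t * 2^-1)).
  have := flat_comp (D := I01) _ (chalf 2^-1 2^-1) fk.
  move=> /(_ ltac:(by move=> t; rewrite /I01/=; lra))/eq_flat; apply.
  move=> t; rewrite /I01/= => t01; rewrite /k /path_concat.
  have [tl|tg] := leP; last by congr (d _); lra.
  have -> : t = 0 by lra.
  by rewrite d0 -[RHS]g1; congr ((G p).1 _); lra.
have fd' : flat_along I01 d (fun t => (G p).2 1 *m Phi p (d t)).
  move=> t t01; have [_ /(cd t t01)] := dU t t01.
  by apply: filterS => t' H t'01; rewrite H// mulmxA.
have k1 : k 1 = y.
  rewrite /k /path_concat ifF; last by apply/negbTE; rewrite -ltNge; lra.
  by rewrite -d1; congr (d _); lra.
have k0 : k 0 = p0 by rewrite /k /path_concat mulr0 invr_ge0 ler0n.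
have -> : (G y).2 1 = s 1.
  by apply: (@lift_endpoint p0 y (G y).1 k) => //; rewrite ?k0 ?k1 ?s0' ?ks.
have -> : s 1 = (s \o (fun t : R => 2^-1 + t * 2^-1)) 1 by congr s; lra.
rewrite (@flat_unique 0 1 _ _ _ ler01 cd fd fd') ?i1//=; last first.
  rewrite d0 Phi1 mulmx1 (@flat_unique 0 1 _ _ _ ler01 cg fs fg) ?i1//=.
    by congr s; lra.
  by rewrite mul0r addr0 ks.
by rewrite d1.
Qed.

End Monodromy.

(** * Change of charts *)

Lemma smooth_schwarz (R : realType) n m p (U : set 'rV[R]_n) (F : 'rV[R]_n -> 'M[R]_(m, p)) i j x :
  open U -> smooth_on U F -> U x ->
  partial i (partial j F) x = partial j (partial i F) x.
Proof.
move=> oU sF Ux; apply: schwarz_mx.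
- by apply: filterS (near_open oU Ux) => y; exact: C1_differentiable (smooth_C1 sF).
- exact: (C1_differentiable (smooth_C1 (smooth_partial i sF)) Ux).
- exact: (C1_differentiable (smooth_C1 (smooth_partial j sF)) Ux).
Qed.

Section Scale.
Context {R : realType} {n m p : nat}.
Variables (c : 'rV[R]_n -> R) (F : 'rV[R]_n -> 'M[R]_(m, p)) (x : 'rV[R]_n).
Hypotheses (dc : differentiable c x) (dF : differentiable F x).

Lemma differentiable_scale : differentiable (fun y => c y *: F y) x.
Proof.
apply/differentiable_mxP => a b.
have -> : (fun y => (c y *: F y) a b) = c * (fun y => F y a b).
  by apply/funext => y; rewrite mxE.
by apply: differentiableM => //; move/differentiable_mxP: dF; exact.
Qed.

Lemma partial_scale i :
  partial i (fun y => c y *: F y) x = partial i c x *: F x + c x *: partial i F x.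
Proof.
apply/matrixP => a b; rewrite (@partial_entry _ _ _ _ (fun y => c y *: F y) i x a b differentiable_scale).
have -> : (fun y => (c y *: F y) a b) = c * (fun y => F y a b).
  by apply/funext => y; rewrite mxE.
rewrite partialE deriveM; last 2 first.
- exact: diff_derivable.
- by apply: diff_derivable; move/differentiable_mxP: dF; exact.
rewrite mxE [X in _ = X + _]mxE [X in _ = _ + X]mxE (@partial_entry _ _ _ _ F i x a b dF) addrC.
by congr (_ + _); exact: mulrC.
Qed.

End Scale.

(** The premise equates the mixed second derivatives of the Jacobian [J], both expanded by
    [jacobian_gam]; [a], [b], [c], [d] are the derivatives of [Gi], [Gj], [Bi], [Bj]. *)
Lemma curv_jacobian_algebra (R : comPzRingType) n (J a b Gi Gj Bi Bj c d : 'M[R]_n) :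
  a *m J + Gi *m (Gj *m J - J *m Bj) - ((Gj *m J - J *m Bj) *m Bi + J *m c) =
  b *m J + Gj *m (Gi *m J - J *m Bi) - ((Gi *m J - J *m Bi) *m Bj + J *m d) ->
  (b - a + Gj *m Gi - Gi *m Gj) *m J = J *m (d - c + Bj *m Bi - Bi *m Bj).
Proof.
rewrite !(mulmxDl, mulmxDr, mulmxBl, mulmxBr, mulNmx, mulmxN) !mulmxA.
move: (a *m J) (b *m J) (J *m c) (J *m d) (Gi *m Gj *m J) (Gj *m Gi *m J) => t1 t2 t3 t4 t5 t6.
move: (Gi *m J *m Bj) (Gj *m J *m Bi) (J *m Bi *m Bj) (J *m Bj *m Bi) => t7 t8 t9 t10.
move=> /matrixP E; apply/matrixP => k l; have := E k l; rewrite !mxE => {}E.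
apply/eqP; rewrite -subr_eq0; apply/eqP; move/eqP: E; rewrite -subr_eq0 => /eqP E.
by rewrite -[RHS]oppr0 -E; ring.
Qed.

Section Jacobian.
Context {R : realType} {n m : nat}.
Variables (U : set 'rV[R]_n) (F : 'rV[R]_n -> 'rV[R]_m).
Hypotheses (oU : open U) (sF : smooth_on U F).

Let rowJ i x : U x -> row i ('J F x) = partial i F x.
Proof. by move=> Ux; rewrite row_jacobian//; exact: C1_differentiable (smooth_C1 sF) Ux. Qed.

Lemma C1_jacobian : Ck_on 1 U (fun x => 'J F x).
Proof.
apply: C1_mxP => // i j.
have H := C1_entry oU 0 j (smooth_C1 (smooth_partial i sF)).
by apply: eq_Ck H => // x Ux; rewrite -rowJ// mxE.
Qed.

Lemma row_partial_jacobian i j x : U x ->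
  row i (partial j (fun x => 'J F x) x) = partial j (partial i F) x.
Proof.
move=> Ux; refine (etrans (esym (partial_row j i (C1_differentiable C1_jacobian Ux))) _).
by apply: near_eq_partial; apply: filterS (near_open oU Ux) => y; exact: rowJ.
Qed.

End Jacobian.

Section ChartChange.
Context {R : realType} {n : nat}.
Variables (U U' : set 'rV[R]_n) (g g' : 'rV[R]_n -> 'M[R]_n) (tau : 'rV[R]_n -> 'rV[R]_n).
Hypothesis oU : open U.
Hypothesis sg : smooth_on U g.
Hypothesis symg : forall x, U x -> (g x)^T = g x.
Hypothesis ug : forall x, U x -> g x \in unitmx.
Hypothesis oU' : open U'.
Hypothesis sg' : smooth_on U' g'.
Hypothesis symg' : forall x, U' x -> (g' x)^T = g' x.
Hypothesis ug' : forall x, U' x -> g' x \in unitmx.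
Hypothesis stau : smooth_on U tau.
Hypothesis tauU : forall x, U x -> U' (tau x).
Let J x := 'J tau x.
Hypothesis gE : forall x, U x -> g x = J x *m g' (tau x) *m (J x)^T.

Let dtau x : U x -> differentiable tau x.
Proof. exact: C1_differentiable (smooth_C1 stau). Qed.

Let rowJ i x : U x -> row i (J x) = partial i tau x.
Proof. by move=> Ux; rewrite row_jacobian//; exact: dtau. Qed.

Let C1J : Ck_on 1 U J.
Proof. exact: C1_jacobian. Qed.

Let dJ x : U x -> differentiable J x.
Proof. exact: C1_differentiable C1J. Qed.

Let smooth_jacobian_partial i j x : U x -> row i (partial j J x) = partial j (partial i tau) x.
Proof. exact: row_partial_jacobian. Qed.

Let schwarz_tau i j x : U x -> partial j (partial i tau) x = partial i (partial j tau) x.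
Proof. by move=> Ux; exact: smooth_schwarz Ux. Qed.

Lemma unit_jacobian x : U x -> J x \in unitmx.
Proof. by move=> Ux; have := ug Ux; rewrite gE// !unitmx_mul => /andP[/andP[]]. Qed.

(** Component [i] of the connection form of [g'], pulled back by [tau]. *)
Definition pullback_gam i x : 'M[R]_n := \sum_a J x i a *: gam g' a (tau x).

(** Transformation law of the Christoffel symbols. The matrices [T] are the connection of [g']
    transported to the coordinates of [g]; they are compatible with [g] and torsion-free, so
    uniqueness applies. *)
Lemma jacobian_gam i x : U x -> partial i J x = gam g i x *m J x - J x *m pullback_gam i x.
Proof.
move=> Ux; have Ju := unit_jacobian Ux; have Ux' := tauU Ux.
pose T i := (partial i J x + J x *m pullback_gam i x) *m invmx (J x).
suff /(_ i) <- : forall i, T i = gam g i x by rewrite /T mulmxKV// addrK.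
apply: levi_civita_unique => [||j|a b]; [exact: symg|exact: ug| |].
  have dg' : differentiable (fun y => g' (tau y)) x.
    by apply: differentiable_comp; [exact: dtau|exact: C1_differentiable (smooth_C1 sg') Ux'].
  have -> : partial j g x = partial j (fun y => J y *m g' (tau y) *m (J y)^T) x.
    by apply: near_eq_partial; apply: filterS (near_open oU Ux) => y; exact: gE.
  rewrite !partial_mulmx ?partial_trmx; try exact: dJ; try exact: dg'; last 2 first.
  - by apply: differentiable_mulmx; [exact: dJ|exact: dg'].
  - by apply: differentiable_trmx; exact: dJ.
  have -> : partial j (fun y => g' (tau y)) x =
      pullback_gam j x *m g' (tau x) + g' (tau x) *m (pullback_gam j x)^T.
    rewrite (partial_comp j (dtau Ux) (C1_differentiable (smooth_C1 sg') Ux')).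
    rewrite /pullback_gam mulmx_suml linear_sum/= mulmx_sumr -big_split; apply: eq_bigr => a _ /=.
    by rewrite (gam_metric oU' sg' symg' ug' _ Ux') scalerDr linearZ/= scalemxAl scalemxAr.
  have trD (A B : 'M[R]_n) : (A + B)^T = A^T + B^T by rewrite linearD.
  have TJ : T j *m J x = partial j J x + J x *m pullback_gam j x by rewrite mulmxKV.
  rewrite gE// !mulmxA TJ -(mulmxA _ _ (T j)^T) -trmx_mul TJ trD trmx_mul.
  rewrite !(mulmxDl, mulmxDr) !mulmxA.
  by rewrite -!addrA; do 2!congr (_ + _); exact: addrC.
rewrite /T !row_mul; congr (_ *m _).
have rD (A B : 'M[R]_n) c : row c (A + B) = row c A + row c B by rewrite linearD.
rewrite !rD !smooth_jacobian_partial// schwarz_tau//; congr (_ + _).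
have E c d : row d (J x *m pullback_gam c x) = \sum_i \sum_j (J x c i * J x d j) *: row j (gam g' i (tau x)).
  rewrite row_mul /pullback_gam mulmx_sumr; apply: eq_bigr => e _.
  rewrite -scalemxAr [row d _]row_sum_delta mulmx_suml scaler_sumr; apply: eq_bigr => e' _.
  by rewrite -scalemxAl -rowE scalerA [row d _ _ _]mxE.
rewrite !E exchange_big/=; apply: eq_bigr => c _; apply: eq_bigr => d _.
by rewrite mulrC (gam_row oU' sg' symg' _ _ Ux').
Qed.

Let dgam i x : U x -> differentiable (gam g i) x.
Proof. by move=> Ux; exact: (C1_differentiable (C1_gam oU sg ug i) Ux). Qed.

Let dgam' i x : U' x -> differentiable (gam g' i) x.
Proof. by move=> Ux; exact: (C1_differentiable (C1_gam oU' sg' ug' i) Ux). Qed.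

Let dJe i a x : U x -> differentiable (fun y => J y i a) x.
Proof. by move=> /dJ/differentiable_mxP; exact. Qed.

Let dgamtau a x : U x -> differentiable (fun y => gam g' a (tau y)) x.
Proof.
move=> Ux; apply: (@differentiable_comp _ _ _ _ tau (gam g' a)); first exact: dtau.
exact: dgam' (tauU Ux).
Qed.

Let dB i x : U x -> differentiable (pullback_gam i) x.
Proof.
move=> Ux; apply: differentiable_bigsum => a.
by apply: differentiable_scale; [exact: dJe|exact: dgamtau].
Qed.

Let partialB i j x : U x -> partial j (pullback_gam i) x =
  \sum_a (partial j J x i a *: gam g' a (tau x)
    + J x i a *: \sum_b J x j b *: partial b (gam g' a) (tau x)).
Proof.
move=> Ux; rewrite partialE derive_bigsum => [|a]; last first.
  apply: diff_derivable.
  by apply: differentiable_scale; [exact: dJe|exact: dgamtau].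
apply: eq_bigr => a _.
rewrite -[LHS]/(partial j (fun y => J y i a *: gam g' a (tau y)) x).
rewrite partial_scale; [|exact: dJe|exact: dgamtau].
rewrite (@partial_entry _ _ _ _ J j x i a (dJ Ux)).
by rewrite -(partial_comp j (dtau Ux) (dgam' a (tauU Ux))).
Qed.

Let partialJJ i j x : U x -> partial j (partial i J) x =
   partial j (gam g i) x *m J x + gam g i x *m (gam g j x *m J x - J x *m pullback_gam j x)
   - ((gam g j x *m J x - J x *m pullback_gam j x) *m pullback_gam i x + J x *m partial j (pullback_gam i) x).
Proof.
move=> Ux.
have dG := dgam i Ux; have dJx := dJ Ux; have dBx := dB i Ux.
transitivity (partial j (fun y => gam g i y *m J y - J y *m pullback_gam i y) x).
  by apply: near_eq_partial; apply: filterS (near_open oU Ux) => y; exact: jacobian_gam.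
transitivity (partial j (fun y => gam g i y *m J y) x - partial j (fun y => J y *m pullback_gam i y) x).
  by rewrite !partialE -deriveB//; apply: diff_derivable; exact: differentiable_mulmx.
by rewrite !partial_mulmx// -!jacobian_gam.
Qed.

(** Tensoriality of the curvature, as the integrability condition of [jacobian_gam]. *)
Lemma curv_jacobian i j x : U x ->
  curv g i j x *m J x = J x *m curv_mx g' (tau x) (row i (J x)) (row j (J x)).
Proof.
move=> Ux.
have sJ : partial j (partial i J) x = partial i (partial j J) x.
  apply/row_matrixP => a.
  have E c d : row a (partial c (partial d J) x) = partial c (partial d (partial a tau)) x.
    have dpJ : differentiable (partial d J) x.
      apply: (@near_eq_differentiable _ _ _ (fun y => gam g d y *m J y - J y *m pullback_gam d y)).
        by apply: filterS (near_open oU Ux) => y Uy; rewrite jacobian_gam.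
      have dG := dgam d Ux; have dJx := dJ Ux; have dBx := dB d Ux.
      by apply: differentiableB; exact: differentiable_mulmx.
    rewrite -(partial_row c a dpJ); apply: near_eq_partial.
    by apply: filterS (near_open oU Ux) => y; exact: smooth_jacobian_partial.
  refine (etrans (E j i) (etrans _ (esym (E i j)))).
  exact: (@smooth_schwarz R n 1 n U (partial a tau) j i x oU (smooth_partial a stau) Ux).
rewrite (curvE oU sg ug i j Ux).
rewrite (@curv_jacobian_algebra _ _ _ _ _ _ _ (pullback_gam i x) (pullback_gam j x)
  (partial j (pullback_gam i) x) (partial i (pullback_gam j) x)); last first.
  exact: (etrans (esym (partialJJ i j Ux)) (etrans sJ (partialJJ j i Ux))).
congr (_ *m _).
have sJe a : partial i J x j a = partial j J x i a.
  have /rowP/(_ a) : row j (partial i J x) = row i (partial j J x).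
    refine (etrans (smooth_jacobian_partial j i Ux) (etrans _ (esym (smooth_jacobian_partial i j Ux)))).
    exact: (schwarz_tau j i Ux).
  by rewrite [LHS]mxE [RHS]mxE.
have BB c d : pullback_gam c x *m pullback_gam d x =
    \sum_a \sum_b (J x c a * J x d b) *: (gam g' a (tau x) *m gam g' b (tau x)).
  rewrite /pullback_gam mulmx_suml; apply: eq_bigr => a _.
  rewrite mulmx_sumr; apply: eq_bigr => b _.
  by rewrite -scalemxAl -scalemxAr scalerA.
have DE c d : partial c (pullback_gam d) x = \sum_a partial c J x d a *: gam g' a (tau x)
    + \sum_a \sum_b (J x d a * J x c b) *: partial b (gam g' a) (tau x).
  refine (etrans (partialB d c Ux) _); rewrite big_split/=.
  apply: (f_equal (fun z => _ + z)); apply: eq_bigr => a _.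
  by rewrite scaler_sumr; apply: eq_bigr => b _; rewrite scalerA.
rewrite (DE i j) (DE j i) (BB j i) BB /curv_mx.
under [X in _ - (X + _)]eq_bigr do rewrite -sJe.
rewrite opprD addrACA subrr add0r.
rewrite [X in X - _ + _]exchange_big [X in _ + X - _]exchange_big/=.
rewrite -sumrB -big_split/= -sumrB; apply: eq_bigr => a _.
rewrite -sumrB -big_split/= -sumrB; apply: eq_bigr => b _.
rewrite (curvE oU' sg' ug' _ _ (tauU Ux)) ![row _ _ _ _]mxE [J x j b * _]mulrC.
by rewrite -scalerBr -scalerDr -scalerBr.
Qed.

End ChartChange.

(** * The system Hess u = (c - k u) g *)

Section LocallyConstant.
Context {R : realType} {n : nat}.

Lemma locally_constant m p (F : 'rV[R]_n -> 'M[R]_(m, p)) x :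
  (\forall y \near x, differentiable F y /\ forall i, partial i F y = 0) ->
  \forall y \near x, F y = F x.
Proof.
move=> H; have [e /= e0 He] := iffLR (nbhs_ballP _ _) H.
apply/nbhs_ballP; exists e => //= y; rewrite -ball_normE/= => xy.
have B (t : R) : t \in `[0, 1] -> ball x e (x + t *: (y - x)).
  rewrite in_itv/= => /andP[t0 t1]; rewrite -ball_normE/= opprD addNKr normrN normrZ ger0_norm//.
  by rewrite (le_lt_trans _ xy)// distrC ler_piMl.
pose f (t : R) := F (x + t *: (y - x)).
have Df (t : R) : t \in `[0, 1] -> is_derive t 1 f 0.
  move=> /B/He [dF pF]; have := is_derive_line dF.
  by rewrite derive_partial// big1// => i _; rewrite pF scaler0.
have f1 : f 1 = F y by rewrite /f scale1r addrC subrK.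
have f0 : f 0 = F x by rewrite /f scale0r addr0.
have := @mvt_mx R m p f 0 1 0 ler01.
rewrite mul0r f1 f0 normr_le0 subr_eq0 => H1; apply/eqP/H1.
  by move=> t /Df[].
by move=> t /Df[_ ->]; rewrite normr0.
Qed.

Definition solves N (A : 'I_n -> 'rV[R]_n -> 'M[R]_N) m (S : 'rV[R]_n -> 'M[R]_(m, N)) (x : 'rV[R]_n) :=
  \forall y \near x, differentiable S y /\ forall i, partial i S y = S y *m A i y.

(** The derivative of [T] times the inverse of [S] vanishes. *)
Lemma solves_unique N (A : 'I_n -> 'rV[R]_n -> 'M[R]_N) m (S : 'rV[R]_n -> 'M[R]_N) (T : 'rV[R]_n -> 'M[R]_(m, N)) x :
  solves A S x -> solves A T x -> S x \in unitmx ->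
  \forall y \near x, T y = T x *m invmx (S x) *m S y.
Proof.
move=> sS sT uS.
have nu : \forall y \near x, S y \in unitmx.
  apply: unitmx_near uS; apply: differentiable_continuous.
  by have /nbhs_singleton[] := sS.
have : \forall y \near x, T y *m invmx (S y) = T x *m invmx (S x).
  apply: (@locally_constant _ _ (fun y => T y *m invmx (S y))).
  apply: filterS3 sS sT nu => y [dS pS] [dT pT] uSy; split.
    by apply: differentiable_mulmx => //; exact: differentiable_invmx.
  move=> i; rewrite partial_mulmx//; last exact: differentiable_invmx.
  by rewrite partial_invmx// (pS i) (pT i) mulmxN !mulmxA mulmxKV// subrr.
by apply: filterS2 nu => y uSy <-; rewrite mulmxKV.
Qed.

End LocallyConstant.

Section Block.
Context {R : realType} {n : nat}.
Variables m1 m2 n1 n2 : nat.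
Variables (A : 'rV[R]_n -> 'M[R]_(m1, n1)) (B : 'rV[R]_n -> 'M[R]_(m1, n2)).
Variables (C : 'rV[R]_n -> 'M[R]_(m2, n1)) (D : 'rV[R]_n -> 'M[R]_(m2, n2)).
Let F x := block_mx (A x) (B x) (C x) (D x).

Lemma C1_block_mx U : open U -> Ck_on 1 U A -> Ck_on 1 U B -> Ck_on 1 U C -> Ck_on 1 U D -> Ck_on 1 U F.
Proof.
move=> oU cA cB cC cD; apply: C1_mxP => // i j.
case: (split_ordP i) => i' ->; case: (split_ordP j) => j' ->.
- have -> : (fun x => F x (lshift m2 i') (lshift n2 j')) = (fun x => A x i' j').
    by apply/funext => x; rewrite block_mxEul.
  exact: C1_entry.
- have -> : (fun x => F x (lshift m2 i') (rshift n1 j')) = (fun x => B x i' j').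
    by apply/funext => x; rewrite block_mxEur.
  exact: C1_entry.
- have -> : (fun x => F x (rshift m1 i') (lshift n2 j')) = (fun x => C x i' j').
    by apply/funext => x; rewrite block_mxEdl.
  exact: C1_entry.
- have -> : (fun x => F x (rshift m1 i') (rshift n1 j')) = (fun x => D x i' j').
    by apply/funext => x; rewrite block_mxEdr.
  exact: C1_entry.
Qed.

Lemma partial_block_mx U x i : open U -> U x ->
  Ck_on 1 U A -> Ck_on 1 U B -> Ck_on 1 U C -> Ck_on 1 U D ->
  partial i F x = block_mx (partial i A x) (partial i B x) (partial i C x) (partial i D x).
Proof.
move=> oU Ux cA cB cC cD; apply/matrixP => a b.
have dF := C1_differentiable (C1_block_mx oU cA cB cC cD) Ux.
rewrite (@partial_entry _ _ _ _ F i x a b dF).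
case: (split_ordP a) => a' ->; case: (split_ordP b) => b' ->.
- rewrite block_mxEul (@partial_entry _ _ _ _ A i x a' b' (C1_differentiable cA Ux)).
  by apply: (f_equal (fun f => partial i f x)); apply/funext => y; rewrite block_mxEul.
- rewrite block_mxEur (@partial_entry _ _ _ _ B i x a' b' (C1_differentiable cB Ux)).
  by apply: (f_equal (fun f => partial i f x)); apply/funext => y; rewrite block_mxEur.
- rewrite block_mxEdl (@partial_entry _ _ _ _ C i x a' b' (C1_differentiable cC Ux)).
  by apply: (f_equal (fun f => partial i f x)); apply/funext => y; rewrite block_mxEdl.
- rewrite block_mxEdr (@partial_entry _ _ _ _ D i x a' b' (C1_differentiable cD Ux)).
  by apply: (f_equal (fun f => partial i f x)); apply/funext => y; rewrite block_mxEdr.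
Qed.

End Block.

Lemma sum_block_mx (V : nmodType) (I : Type) (r : seq I) m1 m2 n1 n2 (A : I -> 'M[V]_(m1, n1))
    (B : I -> 'M[V]_(m1, n2)) (C : I -> 'M[V]_(m2, n1)) (D : I -> 'M[V]_(m2, n2)) :
  \sum_(i <- r) block_mx (A i) (B i) (C i) (D i) =
  block_mx (\sum_(i <- r) A i) (\sum_(i <- r) B i) (\sum_(i <- r) C i) (\sum_(i <- r) D i).
Proof.
elim: r => [|i r IH]; first by rewrite !big_nil block_mx0.
by rewrite !big_cons IH add_block_mx.
Qed.

Section HessianSystem.
Context {R : realType} {n : nat}.
Variable k : R.
Local Notation e i := (delta_mx 0 i : 'rV[R]_n).

(** The row [(c, u)] times [hw] is [c - k u], and [hz] places a scalar in the slot of [u]. *)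
Definition hw : 'cV[R]_(1 + 1) := col_mx 1%:M (- k%:M).
Definition hz : 'rV[R]_(1 + 1) := row_mx 0 1%:M.

Lemma hz_hw : hz *m hw = - k%:M.
Proof. by rewrite mul_row_col mul0mx add0r mul1mx. Qed.

Lemma hess_block_mul (D X X' a a' : 'rV[R]_n) (C G G' : 'M[R]_n) :
  block_mx 0 (hw *m D) 0 C + block_mx 0 (hw *m X) (a^T *m hz) G
    *m block_mx 0 (hw *m X') (a'^T *m hz) G' =
  block_mx (hw *m (X *m a'^T) *m hz) (hw *m (D + X *m G'))
    ((G *m a'^T) *m hz) (C - k *: (a^T *m X') + G *m G').
Proof.
rewrite mulmx_block add_block_mx !mul0mx !mulmx0 !add0r.
have -> : a^T *m hz *m (hw *m X') = - k *: (a^T *m X').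
  by rewrite mulmxA -(mulmxA _ hz) hz_hw mulmxN mulNmx mul_mx_scalar -scalemxAl scaleNr.
by rewrite mulmxDr !mulmxA scaleNr addrA.
Qed.

(* In the unknowns (c, u, w), the system expresses that c is constant, w = du
   and Hess u = (c - k u) g. *)
Definition hess_mx (g : 'rV[R]_n -> 'M[R]_n) i x : 'M[R]_(1 + 1 + n) :=
  block_mx 0 (hw *m (e i *m g x)) ((e i)^T *m hz) (gam g i x)^T.

Section Flat.
Variable U : set 'rV[R]_n.
Variable g : 'rV[R]_n -> 'M[R]_n.
Hypothesis oU : open U.
Hypothesis sg : smooth_on U g.
Hypothesis symg : forall x, U x -> (g x)^T = g x.
Hypothesis ug : forall x, U x -> g x \in unitmx.
Hypothesis curvg : forall x i j, U x ->
  curv g i j x = k *: (g x *m (e j)^T *m e i - g x *m (e i)^T *m e j).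

Let C1g : Ck_on 1 U g. Proof. exact: smooth_C1. Qed.

Let C1mul m p q (A : 'M[R]_(m, p)) (B : 'rV[R]_n -> 'M[R]_(p, q)) :
  Ck_on 1 U B -> Ck_on 1 U (fun x => A *m B x).
Proof. by move=> cB; apply: (C1_mulmx oU (C1_cst oU A)). Qed.

Let partial_mul m p q (A : 'M[R]_(m, p)) (B : 'rV[R]_n -> 'M[R]_(p, q)) j x :
  differentiable B x -> partial j (fun x => A *m B x) x = A *m partial j B x.
Proof.
move=> dB; refine (etrans (partial_mulmx j (differentiable_cst A x) dB) _).
by rewrite -[X in X *m _ + _]/(partial j (cst A) x) partial_cst mul0mx add0r.
Qed.

Lemma C1_hess_mx i : Ck_on 1 U (hess_mx g i).
Proof.
exact: (C1_block_mx oU (C1_cst oU (0 : 'M[R]_(1 + 1))) (C1mul hw (C1mul (e i) C1g))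
  (C1_cst oU ((e i)^T *m hz)) (C1_trmx oU (C1_gam oU sg ug i))).
Qed.

Lemma partial_hess_mx i j x : U x -> partial j (hess_mx g i) x =
  block_mx 0 (hw *m (e i *m partial j g x)) 0 (partial j (gam g i) x)^T.
Proof.
move=> Ux.
refine (etrans (partial_block_mx j oU Ux (C1_cst oU (0 : 'M[R]_(1 + 1))) (C1mul hw (C1mul (e i) C1g))
  (C1_cst oU ((e i)^T *m hz)) (C1_trmx oU (C1_gam oU sg ug i))) _).
have dg := C1_differentiable C1g Ux.
have dG := C1_differentiable (C1_gam oU sg ug i) Ux.
apply: (f_equal4 (@block_mx _ _ _ _ _)).
- exact: partial_cst.
- refine (etrans (partial_mul _ _ _) _).
    exact: (differentiable_mulmx (differentiable_cst _ _) dg).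
  by apply: (f_equal (mulmx hw)); exact: partial_mul.
- exact: partial_cst.
- exact: partial_trmx.
Qed.

(** Block by block: symmetry of the metric, metric compatibility, vanishing torsion, and, in the
    last block, constant curvature [k]. *)
Lemma hess_mx_flat i j x : U x ->
  partial j (hess_mx g i) x + hess_mx g j x *m hess_mx g i x =
  partial i (hess_mx g j) x + hess_mx g i x *m hess_mx g j x.
Proof.
move=> Ux; have eG a b : e a *m gam g b x = e b *m gam g a x.
  by rewrite -!rowE (gam_row oU sg symg _ _ Ux).
have C := curvg j i Ux.
rewrite (curvE oU sg ug j i Ux) in C.
refine (etrans (f_equal2 +%R (partial_hess_mx i j Ux) erefl) _).
refine (etrans _ (esym (f_equal2 +%R (partial_hess_mx j i Ux) erefl))).
refine (etrans (hess_block_mul _ _ _ _ _ _ _ _) (etrans _ (esym (hess_block_mul _ _ _ _ _ _ _ _)))).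
apply: (f_equal4 (@block_mx _ _ _ _ _)).
- apply: (f_equal (fun z => _ *m z *m _)).
  by apply/matrixP => a b; rewrite !ord1; exact: innerC (symg Ux).
- apply: (f_equal (mulmx hw)).
  rewrite !(gam_metric oU sg symg ug _ Ux) !mulmxDr !mulmxA eG -!addrA.
  by apply: (f_equal (fun z => _ + z)); exact: addrC.
- apply: (f_equal (fun z => z *m hz)).
  by apply: trmx_inj; rewrite !trmx_mul !trmxK.
- have := congr1 trmx C.
  have trB (A B : 'M[R]_n) : (A - B)^T = A^T - B^T by rewrite linearB.
  have trD (A B : 'M[R]_n) : (A + B)^T = A^T + B^T by rewrite linearD.
  have trZ a (B : 'M[R]_n) : (a *: B)^T = a *: B^T by rewrite linearZ.
  rewrite !(trB, trD, trZ, trmx_mul, trmxK) symg// !mulmxA.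
  move: (partial j _ x)^T (partial i _ x)^T (_ *m g x) (_ *m g x) (_ *m _^T) (_ *m _^T).
  move=> t1 t2 t3 t4 t5 t6 /matrixP E; apply/matrixP => a b; move: (E a b); rewrite !mxE; lra.
Qed.

End Flat.

(* Expresses the unknowns (c, u, w) in new coordinates. *)
Definition frame_mx (J : 'M[R]_n) : 'M[R]_(1 + 1 + n) := block_mx 1%:M 0 0 J^T.

Lemma frame_mxM A B : frame_mx B *m frame_mx A = frame_mx (A *m B).
Proof.
by rewrite /frame_mx mulmx_block !(mul0mx, mulmx0, addr0, add0r) mul1mx trmx_mul.
Qed.

Lemma frame_mx1 : frame_mx 1%:M = 1%:M.
Proof. by rewrite /frame_mx trmx1 -scalar_mx_block. Qed.

Lemma frame_mx_unit A : A \in unitmx -> frame_mx A \in unitmx.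
Proof. by move=> uA; rewrite unitmxE det_ublock det1 mul1r det_tr -unitmxE. Qed.

Section Pullback.
Variables (U U' : set 'rV[R]_n) (g g' : 'rV[R]_n -> 'M[R]_n) (tau : 'rV[R]_n -> 'rV[R]_n).
Hypothesis oU : open U.
Hypothesis sg : smooth_on U g.
Hypothesis symg : forall x, U x -> (g x)^T = g x.
Hypothesis ug : forall x, U x -> g x \in unitmx.
Hypothesis oU' : open U'.
Hypothesis sg' : smooth_on U' g'.
Hypothesis symg' : forall x, U' x -> (g' x)^T = g' x.
Hypothesis ug' : forall x, U' x -> g' x \in unitmx.
Hypothesis stau : smooth_on U tau.
Hypothesis tauU : forall x, U x -> U' (tau x).
Hypothesis gE : forall x, U x -> g x = 'J tau x *m g' (tau x) *m ('J tau x)^T.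

Let C1J : Ck_on 1 U (fun x => 'J tau x).
Proof. exact: C1_jacobian. Qed.

Let C1K : Ck_on 1 U (fun x => frame_mx ('J tau x)).
Proof.
exact: (C1_block_mx oU (C1_cst oU (1%:M : 'M[R]_(1 + 1))) (C1_cst oU 0) (C1_cst oU 0) (C1_trmx oU C1J)).
Qed.

Let partialK i x : U x ->
  partial i (fun x => frame_mx ('J tau x)) x = block_mx 0 0 0 (partial i (fun y => 'J tau y) x)^T.
Proof.
move=> Ux.
refine (etrans (partial_block_mx i oU Ux (C1_cst oU (1%:M : 'M[R]_(1 + 1)))
   (C1_cst oU 0) (C1_cst oU 0) (C1_trmx oU C1J)) _).
apply: (f_equal4 (@block_mx _ _ _ _ _)); [exact: partial_cst|exact: partial_cst|exact: partial_cst|].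
exact: (partial_trmx i (C1_differentiable C1J Ux)).
Qed.

Lemma hess_frame_algebra (J G B : 'M[R]_n) (a X : 'rV[R]_n) :
  block_mx 0 (hw *m X) ((a *m J)^T *m hz) B^T *m frame_mx J + block_mx 0 0 0 (G *m J - J *m B)^T =
  frame_mx J *m block_mx 0 (hw *m (X *m J^T)) (a^T *m hz) G^T.
Proof.
rewrite /frame_mx !mulmx_block add_block_mx !(mul0mx, mulmx0, mul1mx, mulmx1, addr0, add0r).
apply: (f_equal4 (@block_mx _ _ _ _ _)) => //.
- by rewrite mulmxA.
- by rewrite trmx_mul mulmxA.
by rewrite linearB/= !trmx_mul addrC subrK.
Qed.

(** Gauge transformation of the connection [hess_mx] under [frame_mx]; the block that carries a
    derivative is [jacobian_gam]. *)
Lemma hess_mx_pullback i x : U x ->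
  (\sum_a 'J tau x i a *: hess_mx g' a (tau x)) *m frame_mx ('J tau x)
  + partial i (fun x => frame_mx ('J tau x)) x = frame_mx ('J tau x) *m hess_mx g i x.
Proof.
move=> Ux; rewrite partialK// (jacobian_gam oU symg ug oU' sg' symg' ug' stau tauU gE i Ux).
have -> : \sum_a 'J tau x i a *: hess_mx g' a (tau x) =
    block_mx 0 (hw *m (e i *m 'J tau x *m g' (tau x))) ((e i *m 'J tau x)^T *m hz)
      (pullback_gam g' tau i x)^T.
  under eq_bigr do rewrite /hess_mx scale_block_mx.
  have rJ : e i *m 'J tau x = \sum_a 'J tau x i a *: e a.
    by rewrite -rowE [LHS]row_sum_delta; apply: eq_bigr => a _; rewrite mxE.
  rewrite sum_block_mx; apply: (f_equal4 (@block_mx _ _ _ _ _)).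
  - by rewrite big1// => a _; rewrite scaler0.
  - rewrite rJ mulmx_suml mulmx_sumr; apply: eq_bigr => a _.
    by rewrite -!scalemxAl -scalemxAr.
  - rewrite rJ linear_sum/= mulmx_suml; apply: eq_bigr => a _.
    by rewrite linearZ/= -scalemxAl.
  - by rewrite /pullback_gam linear_sum/=; apply: eq_bigr => a _; rewrite linearZ.
refine (etrans (hess_frame_algebra _ _ _ _ _) _).
by rewrite -!(mulmxA (e i)) -gE.
Qed.

Let near_tau (P : 'rV[R]_n -> Prop) (x : 'rV[R]_n) :
  U x -> (\forall z \near tau x, P z) -> \forall y \near x, P (tau y).
Proof.
move=> Ux H.
have dtau : differentiable tau x by exact: C1_differentiable (smooth_C1 stau) Ux.
exact: (differentiable_continuous dtau : tau y @[y --> x] --> tau x) _ H.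
Qed.

Section Step.
Variables (m : nat) (S : 'rV[R]_n -> 'M[R]_(m, 1 + 1 + n)) (y : 'rV[R]_n).
Hypotheses (Uy : U y) (dS : differentiable S (tau y)).
Hypothesis pS : forall i, partial i S (tau y) = S (tau y) *m hess_mx g' i (tau y).

Let dt : differentiable tau y.
Proof. exact: C1_differentiable (smooth_C1 stau) Uy. Qed.

Let dSt : differentiable (fun y => S (tau y)) y.
Proof. exact: (@differentiable_comp _ _ _ _ tau S). Qed.

Let partialSt i : partial i (fun y => S (tau y)) y =
  S (tau y) *m \sum_a 'J tau y i a *: hess_mx g' a (tau y).
Proof.
refine (etrans (partial_comp i dt dS) _); rewrite mulmx_sumr; apply: eq_bigr => a _.
by rewrite -scalemxAr -pS.
Qed.

Lemma pullback_solves_at :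
  differentiable (fun y => S (tau y) *m frame_mx ('J tau y)) y /\
  forall i, partial i (fun y => S (tau y) *m frame_mx ('J tau y)) y =
    S (tau y) *m frame_mx ('J tau y) *m hess_mx g i y.
Proof.
have dK := C1_differentiable C1K Uy.
split; first exact: differentiable_mulmx.
move=> i; rewrite (partial_mulmx i dSt dK) partialSt -!mulmxA -mulmxDr.
by rewrite (hess_mx_pullback i Uy).
Qed.

End Step.

Lemma pullback_solves m (S : 'rV[R]_n -> 'M[R]_(m, 1 + 1 + n)) (x : 'rV[R]_n) :
  U x -> solves (hess_mx g') S (tau x) ->
  solves (hess_mx g) (fun y => S (tau y) *m frame_mx ('J tau y)) x.
Proof.
move=> Ux /(near_tau Ux); apply: filterS2 (near_open oU Ux) => y Uy [dS pS].
exact: pullback_solves_at.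
Qed.

End Pullback.

End HessianSystem.

(** * Constant curvature *)

Section Charts.
Context {R : realType} {n : nat}.

Lemma chart_invK (X : topologicalType) (c : chart R X n) x : chart_img c x ->
  chart_to c (chart_inv c x) = x /\ chart_dom c (chart_inv c x).
Proof. by move=> [p dp <-]; rewrite chart_toK// inE. Qed.

Variable M : smoothManifold R n.
Implicit Types p q y : M.

Definition overlap p q : set 'rV[R]_n :=
  chart_to (chart_at p) @` (chart_dom (chart_at p) `&` chart_dom (chart_at q)).

Definition transition p q : 'rV[R]_n -> 'rV[R]_n :=
  chart_to (chart_at q) \o chart_inv (chart_at p).

Local Notation to p := (chart_to (chart_at p)).
Local Notation inv p := (chart_inv (chart_at p)).
Local Notation dom p := (chart_dom (chart_at p)).

Lemma chart_atK p y : dom p y -> inv p (to p y) = y.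
Proof. by move=> py; rewrite chart_toK// inE. Qed.

Lemma overlap_img p q : overlap p q `<=` chart_img (chart_at p).
Proof. by move=> _ [y [py _] <-]; exists y. Qed.

Lemma overlapE p q x : overlap p q x <-> chart_img (chart_at p) x /\ dom q (inv p x).
Proof.
split=> [[y [py qy] <-]|[px qx]]; first by rewrite chart_atK//; split => //; exists y.
by have [E d] := chart_invK px; exists (inv p x).
Qed.

Lemma overlap_open p q : open (overlap p q).
Proof.
rewrite openE => x /overlapE[px qx].
have n1 : \forall z \near x, chart_img (chart_at p) z.
  by apply: open_nbhs_nbhs; split => //; exact: chart_img_open.
have n2 : \forall y \near inv p x, dom q y.
  by apply: open_nbhs_nbhs; split => //; exact: chart_dom_open.
have n3 : \forall z \near x, dom q (inv p z).
  exact: (chart_inv_continuous px : inv p z @[z --> x] --> inv p x) _ n2.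
by apply: filterS2 n1 n3 => z pz qz; apply/overlapE.
Qed.

Lemma transition_to p q y : dom p y -> transition p q (to p y) = to q y.
Proof. by move=> py; rewrite /transition/= chart_atK. Qed.

Lemma transition_img p q x : overlap p q x -> chart_img (chart_at q) (transition p q x).
Proof. by move=> [y [py qy] <-]; rewrite transition_to//; exists y. Qed.

Lemma near_dom p q : dom p q -> \forall y \near q, dom p y.
Proof. by move=> pq; apply: open_nbhs_nbhs; split => //; exact: chart_dom_open. Qed.

Lemma near_to p y (P : 'rV[R]_n -> Prop) : dom p y ->
  (\forall x \near to p y, P x) -> \forall z \near y, P (to p z).
Proof.
move=> py H; exact: (chart_to_continuous py : to p z @[z --> y] --> to p y) _ H.
Qed.

Lemma near_inv p x (P : M -> Prop) : chart_img (chart_at p) x ->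
  (\forall y \near inv p x, P y) -> \forall z \near x, P (inv p z).
Proof.
move=> px H; exact: (chart_inv_continuous px : inv p z @[z --> x] --> inv p x) _ H.
Qed.

Lemma chart_coord_img p : chart_img (chart_at p) (chart_coord p).
Proof. by exists p => //; exact: chart_at_dom. Qed.

Lemma inv_chart_coord p : inv p (chart_coord p) = p.
Proof. by apply: chart_atK; exact: chart_at_dom. Qed.

Lemma transition_cocycle p y y' : dom p y' -> dom y y' ->
  'J (transition p y') (to p y') =
  'J (transition p y) (to p y') *m 'J (transition y y') (to y y').
Proof.
move=> py' yy'; have y'y' := chart_at_dom y'.
have o1 : overlap p y (to p y') by exists y'.
have o2 : overlap y y' (to y y') by exists y'.
have d1 : differentiable (transition p y) (to p y').
  exact: C1_differentiable (smooth_C1 (chart_at_compatible p y)) o1.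
have d2 : differentiable (transition y y') (transition p y (to p y')).
  rewrite transition_to//; exact: C1_differentiable (smooth_C1 (chart_at_compatible y y')) o2.
refine (etrans _ (etrans (jacobian_comp d1 d2) (f_equal (fun z => _ *m 'J _ z) (transition_to y py')))).
apply/esym/near_eq_jacobian; last exact: differentiable_comp.
apply: filterS (near_open (@overlap_open p y) o1) => _ [z [pz yz] <-].
by rewrite -[LHS]/(transition y y' (transition p y (to p z))) !transition_to.
Qed.

Lemma transition_id p : 'J (transition p p) (chart_coord p) = 1%:M.
Proof.
have E : 'J (id : 'rV[R]_n -> 'rV[R]_n) (chart_coord p) = 1%:M.
  have did : differentiable (id : 'rV[R]_n -> 'rV[R]_n) (chart_coord p) by exact: ex_diff.
  apply/row_matrixP => i; rewrite row_jacobian//.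
  by rewrite partialE derive_id row1.
rewrite -E; apply/esym/near_eq_jacobian; last exact: ex_diff.
have o : overlap p p (chart_coord p) by exists p => //; split; exact: chart_at_dom.
by apply: filterS (near_open (@overlap_open p p) o) => _ [z [pz _] <-]; rewrite transition_to.
Qed.

(** The paths are radial segments of a ball in the chart at [p]. *)
Lemma local_paths p (U : set M) : nbhs p U -> \forall y \near p, exists g : R -> M,
  [/\ cont_on I01 g, g 0 = p, g 1 = y & forall t, I01 t -> U (g t)].
Proof.
move=> nU; have cp := chart_coord_img p.
have := near_inv cp; rewrite inv_chart_coord => /(_ U nU) nU'.
have [e /= e0 He] := iffLR (nbhs_ballP _ _)
  (filterI (near_open (@chart_img_open _ _ _ (chart_at p)) cp) nU').
have B (t : R) x : ball (chart_coord p) e x -> I01 t ->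
    ball (chart_coord p) e (chart_coord p + t *: (x - chart_coord p)).
  rewrite -!ball_normE/= => xe /andP[t0 t1].
  rewrite opprD addNKr normrN normrZ ger0_norm//.
  by rewrite (le_lt_trans _ xe)// distrC ler_piMl.
have pd : \forall y \near p, ball (chart_coord p) e (to p y).
  apply: near_to; first exact: chart_at_dom.
  exact: nbhsx_ballx.
apply: filterS2 (near_dom (chart_at_dom p)) pd => y py yb.
exists (fun t => inv p (chart_coord p + t *: (to p y - chart_coord p))); split.
- apply: (cont_on_comp (D := chart_img (chart_at p)) (c := fun t : R => chart_coord p + t *: (to p y - chart_coord p))).
  + by move=> t /(B t _ yb)/He[].
  + apply: continuous_cont_on => t; apply: cvgD; first exact: cvg_cst.
    by apply: cvgZr_tmp; exact: cvg_id.
  + move=> z pz V nV; apply: filterS (near_inv (p := p) pz nV) => ? ? _ //.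
- by rewrite scale0r addr0 inv_chart_coord.
- by rewrite scale1r addrC subrK chart_atK.
- by move=> t /(B t _ yb)/He[].
Qed.

End Charts.

Lemma transport_algebra (R : comUnitRingType) N (Sp Sp' Sy K Ky Kp' F : 'M[R]_N) :
  Sp \in unitmx -> K \in unitmx -> Ky \in unitmx -> Kp' \in unitmx ->
  Sy *m F = K *m invmx Sp *m Sp' -> Kp' = Ky *m F ->
  Sp' *m invmx Kp' = Sp *m invmx K *m (Sy *m invmx Ky).
Proof.
move=> uS uK uKy uKp E K'E; apply: (can_inj (mulmxK uKp)); rewrite mulmxKV// K'E.
rewrite -!mulmxA (mulmxA (invmx Ky)) mulVmx// mul1mx E !mulmxA.
by rewrite mulmxKV// mulmxV// mul1mx.
Qed.

(* The covariant Hessian of u at x is lam times the metric. *)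
Definition hessian_at (R : realType) n (g : 'rV[R]_n -> 'M[R]_n) (x : 'rV[R]_n)
    (u : 'rV[R]_n -> R) (lam : R) :=
  [/\ \forall y \near x, differentiable u y,
      forall i, differentiable (partial i u) x &
      forall i j, partial i (partial j u) x =
        lam * g x i j + \sum_s christoffel g i j s x * partial s u x].

Section ConstantCurvatureManifold.
Context {R : realType} {n : nat}.
Variables (M : riemannianManifold R n) (k : R).
Hypothesis ck : constant_sectional_curvature M k.

Local Notation to p := (chart_to (chart_at p)).
Local Notation inv p := (chart_inv (chart_at p)).
Local Notation dom p := (chart_dom (chart_at p)).
Local Notation img p := (chart_img (chart_at p)).
Local Notation e i := (delta_mx 0 i : 'rV[R]_n).

Lemma metric_unit (p : M) x : img p x -> metric p x \in unitmx.
Proof. by move=> px; apply: posdef_unit; exact: metric_posdef. Qed.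

Lemma smooth_sub (W : normedModType R) (U V : set 'rV[R]_n) (F : 'rV[R]_n -> W) :
  U `<=` V -> smooth_on V F -> smooth_on U F.
Proof.
move=> UV sF j; elim: j F sF => [|j IH] F sF.
  by move=> x /UV; exact: (sF 0).
split; first by move=> x /UV; exact: (sF 1).1.
by move=> i; apply: IH; exact: smooth_partial.
Qed.

Section Transition.
Variables (p q : M).
Let oU := @overlap_open _ _ M p q.
Let sg : smooth_on (overlap p q) (metric p).
Proof. exact: smooth_sub (@overlap_img _ _ M p q) (metric_smooth p). Qed.
Let symg x : overlap p q x -> (metric p x)^T = metric p x.
Proof. by move=> /overlap_img; exact: Defs.metric_sym. Qed.
Let ug x : overlap p q x -> metric p x \in unitmx.
Proof. by move=> /overlap_img; exact: metric_unit. Qed.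
Let oU' := @chart_img_open _ _ _ (chart_at q).
Let sg' := metric_smooth q.
Let symg' x : img q x -> (metric q x)^T = metric q x.
Proof. exact: Defs.metric_sym. Qed.
Let ug' x : img q x -> metric q x \in unitmx.
Proof. exact: metric_unit. Qed.
Let stau : smooth_on (overlap p q) (transition p q).
Proof. exact: chart_at_compatible. Qed.
Let tauU x : overlap p q x -> img q (transition p q x).
Proof. exact: transition_img. Qed.
Let gE x : overlap p q x -> metric p x =
  'J (transition p q) x *m metric q (transition p q x) *m ('J (transition p q) x)^T.
Proof. exact: metric_compatible. Qed.

Lemma transition_unit x : overlap p q x -> 'J (transition p q) x \in unitmx.
Proof. exact: (unit_jacobian ug gE). Qed.

Lemma curv_transition i j x : overlap p q x ->
  curv (metric p) i j x *m 'J (transition p q) x = 'J (transition p q) x *m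
  curv_mx (metric q) (transition p q x) (row i ('J (transition p q) x)) (row j ('J (transition p q) x)).
Proof. exact: (curv_jacobian oU sg symg ug oU' sg' symg' ug' stau tauU gE). Qed.

Lemma hess_transition m (S : 'rV[R]_n -> 'M[R]_(m, 1 + 1 + n)) x :
  overlap p q x -> solves (hess_mx k (metric q)) S (transition p q x) ->
  solves (hess_mx k (metric p)) (fun y => S (transition p q y) *m frame_mx ('J (transition p q) y)) x.
Proof. exact: (pullback_solves oU symg ug oU' sg' symg' ug' stau tauU gE). Qed.

End Transition.

Lemma constant_curvature_center (p : M) (a b : 'rV[R]_n) :
  curv_mx (metric p) (chart_coord p) a b =
  k *: (metric p (chart_coord p) *m b^T *m a - metric p (chart_coord p) *m a^T *m b).
Proof.
apply: (constant_curvature (@chart_img_open _ _ _ (chart_at p)) (metric_smooth p)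
  (@Defs.metric_sym _ _ M p) (@metric_posdef _ _ M p) (chart_coord_img p)).
exact: ck.
Qed.

(** The hypothesis concerns the point [y] only in the chart at [y]; tensoriality carries the
    identity to the chart at [p]. *)
Lemma constant_curvature_chart (p : M) x i j : img p x ->
  curv (metric p) i j x =
  k *: (metric p x *m (e j)^T *m e i - metric p x *m (e i)^T *m e j).
Proof.
move=> [y py <-].
have o : overlap p y (to p y) by exists y => //; split => //; exact: chart_at_dom.
have uJ := transition_unit o.
apply: (can_inj (mulmxK uJ)); rewrite curv_transition// transition_to//.
rewrite constant_curvature_center (metric_compatible o) -/(transition p y) transition_to//.
move: ('J _ _) (metric y _) => J g.
rewrite !rowE -!scalemxAr -scalemxAl mulmxBl mulmxBr !trmx_mul !mulmxA.
by [].
Qed.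

Lemma local_solution (p : M) : exists S : 'rV[R]_n -> 'M[R]_(1 + 1 + n),
  S (chart_coord p) = 1%:M /\ solves (hess_mx k (metric p)) S (chart_coord p).
Proof.
have oU := @chart_img_open _ _ _ (chart_at p); have sg := metric_smooth p.
have symg := @Defs.metric_sym _ _ M p; have ug := @metric_unit p.
apply: flat_section; apply: filterS (near_open oU (chart_coord_img p)) => x px i.
have cA := C1_hess_mx k oU sg ug i.
split; first exact: C1_differentiable cA px.
move=> j; split; first exact: C1_continuous cA px.
apply: (hess_mx_flat oU sg symg ug _ _ _ px) => y a b; exact: constant_curvature_chart.
Qed.

Let local_solutions : exists S : M -> 'rV[R]_n -> 'M[R]_(1 + 1 + n), forall p,
  S p (chart_coord p) = 1%:M /\ solves (hess_mx k (metric p)) (S p) (chart_coord p).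
Proof. by have /choice[S SP] := local_solution; exists S. Qed.

Let sol : M -> 'rV[R]_n -> 'M[R]_(1 + 1 + n) := sval (cid local_solutions).

Let sol1 p : sol p (chart_coord p) = 1%:M.
Proof. by have [] := svalP (cid local_solutions) p. Qed.

Let sol_solves p : solves (hess_mx k (metric p)) (sol p) (chart_coord p).
Proof. by have [] := svalP (cid local_solutions) p. Qed.

Let frame (p y : M) := frame_mx ('J (transition p y) (to p y)).

(* Parallel transport from p to the nearby point y, in the frames of the
   charts at p and at y. *)
Definition transport (p y : M) : 'M[R]_(1 + 1 + n) := sol p (to p y) *m invmx (frame p y).

Let frame_unit p y : dom p y -> frame p y \in unitmx.
Proof.
move=> py; apply/frame_mx_unit/transition_unit.
by exists y => //; split => //; exact: chart_at_dom.
Qed.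

Lemma transport_refl p : transport p p = 1%:M.
Proof.
rewrite /transport -/(chart_coord p) sol1 mul1mx /frame -/(chart_coord p) transition_id.
by rewrite frame_mx1 invmx1.
Qed.

(** In the chart at [p], the solution based at [p] and the pulled-back solution based at [y] differ
    by a constant left factor. Evaluating at [y] identifies that factor and yields the cocycle
    law. *)
Lemma transport_flat p : \forall y \near p, transport p y \in unitmx /\
  \forall y' \near y, transport p y' = transport p y *m transport y y'.
Proof.
have dp := chart_at_dom p.
have sp : \forall x \near chart_coord p, solves (hess_mx k (metric p)) (sol p) x.
  exact: nbhs_interior (sol_solves p).
have up : \forall x \near chart_coord p, sol p x \in unitmx.
  apply: unitmx_near; last by rewrite sol1 unitmx1.
  by apply: differentiable_continuous; have /nbhs_singleton[] := sol_solves p.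
have := near_to dp sp; have := near_to dp up.
apply: filterS3 (near_dom dp) => y py uy sy.
split; first by rewrite unitmx_mul uy unitmx_inv frame_unit.
have dy := chart_at_dom y.
have o : overlap p y (to p y) by exists y.
have sT := hess_transition o; rewrite transition_to// in sT.
have sT' := sT _ _ (sol_solves y).
have E := near_to py (solves_unique sy sT' uy).
apply: filterS3 (near_dom py) (near_dom dy) E => y' py' yy' /=.
rewrite !transition_to// -/(chart_coord y) sol1 mul1mx => E.
have uf := frame_unit py; have ufy := frame_unit yy'; have ufp := frame_unit py'.
have cf : frame p y' = frame y y' *m frame_mx ('J (transition p y) (to p y')).
  by rewrite /frame frame_mxM -transition_cocycle.
exact: (transport_algebra uy uf ufy ufp E cf).
Qed.

Local Notation cc := (lshift n (lshift 1 0)).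
Local Notation cu := (lshift n (rshift 1 0)).

(** A change of frame does not touch [c] and [u], which are therefore genuine functions on [M]. *)
Let frame_lshift (v : 'rV[R]_(1 + 1 + n)) J a : (v *m frame_mx J) 0 (lshift n a) = v 0 (lshift n a).
Proof.
rewrite -[v]hsubmxK /frame_mx mul_row_block !mulmx0 mulmx1 addr0 add0r.
by rewrite !row_mxEl.
Qed.

Let hess_mx_c (v : 'rV[R]_(1 + 1 + n)) g i x : (v *m hess_mx k g i x) 0 cc = 0.
Proof.
rewrite -[v]hsubmxK /hess_mx mul_row_block row_mxEl mulmx0 add0r mulmxA /hz mul_mx_row.
by rewrite row_mxEl mulmx0 mxE.
Qed.

Let hess_mx_u (v : 'rV[R]_(1 + 1 + n)) g i x : (v *m hess_mx k g i x) 0 cu = v 0 (rshift _ i).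
Proof.
rewrite -[v]hsubmxK /hess_mx mul_row_block row_mxEl mulmx0 add0r mulmxA /hz mul_mx_row.
rewrite row_mxEr mulmx1 row_mxEr trmx_delta -colE mxE //.
Qed.

Let hess_mx_w (v : 'rV[R]_(1 + 1 + n)) g i j x : (v *m hess_mx k g i x) 0 (rshift _ j) =
  (v 0 cc - k * v 0 cu) * g x i j + \sum_s christoffel g i j s x * v 0 (rshift _ s).
Proof.
rewrite -[v]hsubmxK /hess_mx mul_row_block row_mxEr mxE; congr (_ + _).
  rewrite -[lsubmx v]hsubmxK /hw mulmxA mul_row_col mulmx1 mulmxN mul_mx_scalar.
  rewrite mxE big_ord1 -rowE [row i _ _ _]mxE; congr (_ * _).
  by rewrite mxE [X in _ + X]mxE [X in _ - X]mxE !(row_mxEl, row_mxEr) !ord1.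
rewrite mxE; apply: eq_bigr => s _.
by rewrite row_mxEr !mxE mulrC.
Qed.

Lemma hessian_function (p0 : M) : simply_connected R M -> exists c u : M -> R,
  [/\ c p0 = 1, u p0 = 0, forall p, \forall y \near p, c y = c p &
      forall p, hessian_at (metric p) (chart_coord p) (u \o inv p) (c p - k * u p)].
Proof.
move=> [_ pc sc].
have pconn (p q : M) : exists g : R -> M, [/\ cont_on I01 g, g 0 = p & g 1 = q].
  by have [g [/within_cont_on cg g0 g1]] := pc p q; exists g; split.
have null : @homotopic_loops R M.
  move=> g cg g01; have [|//|H [/within_cont_on cH H0 H1 H2]] := sc g.
    by apply/subspace_continuousP => t t01 U /(cg t t01).
  by exists H; split.
have [s s0 sP] := global_flat_section transport_refl transport_flat null pconn (@local_paths _ _ M)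
  p0 (row_mx (row_mx 1%:M 0) 0).
(* Expressed in the single frame of the chart at [p], the global section is a differentiable
   solution of the system. *)
have sT p : \forall y \near p, s y *m frame p y = s p *m sol p (to p y).
  apply: filterS2 (near_dom (chart_at_dom p)) (sP p) => y py ->.
  by rewrite /transport -!mulmxA mulVmx ?mulmx1// frame_unit.
have sl p a : \forall y \near p, s y 0 (lshift n a) = (s p *m sol p (to p y)) 0 (lshift n a).
  by apply: filterS (sT p) => y <-; rewrite frame_lshift.
have solT p : solves (hess_mx k (metric p)) (fun x => s p *m sol p x) (chart_coord p).
  apply: filterS (sol_solves p) => x [dS pS].
  have dsp : differentiable (cst (s p)) x by exact: differentiable_cst.
  split; first exact: (differentiable_mulmx dsp dS).
  move=> i; have E := partial_mulmx i dsp dS.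
  have E0 : partial i (cst (s p)) x = 0 := partial_cst _ _ _.
  by rewrite E0 mul0mx add0r (pS i) mulmxA in E.
have solTe p a : \forall x \near chart_coord p,
    differentiable (fun z => (s p *m sol p z) 0 a) x /\
    forall i, partial i (fun z => (s p *m sol p z) 0 a) x =
      (s p *m sol p x *m hess_mx k (metric p) i x) 0 a.
  apply: filterS (solT p) => x [dT pT].
  split; first by move/differentiable_mxP: dT; exact.
  by move=> i; rewrite -pT -(@partial_entry _ _ _ _ (fun z => s p *m sol p z) i x 0 a dT).
have invT p a : \forall x \near chart_coord p,
    s (inv p x) 0 (lshift n a) = (s p *m sol p x) 0 (lshift n a).
  have cp := chart_coord_img p.
  have := near_inv cp; rewrite inv_chart_coord => /(_ _ (sl p a)) H.
  apply: filterS2 (near_open (@chart_img_open _ _ _ (chart_at p)) cp) H => x px ->.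
  by have [-> _] := chart_invK px.
have atp p : s p *m sol p (chart_coord p) = s p by rewrite sol1 mulmx1.
exists (fun p => s p 0 cc), (fun p => s p 0 cu); split.
- by rewrite s0 !row_mxEl mxE.
- by rewrite s0 row_mxEl row_mxEr mxE.
- move=> p; have lc : \forall x \near chart_coord p,
      (s p *m sol p x) 0 cc = (s p *m sol p (chart_coord p)) 0 cc.
    pose D : 'cV[R]_(1 + 1 + n) := delta_mx cc 0.
    have GE x : (s p *m sol p x *m D) 0 0 = (s p *m sol p x) 0 cc by rewrite -colE mxE.
    suff : \forall x \near chart_coord p,
        s p *m sol p x *m D = s p *m sol p (chart_coord p) *m D.
      by apply: filterS => x E; rewrite -!GE E.
    apply: (@locally_constant _ _ _ _ (fun x => s p *m sol p x *m D)).
    apply: filterS (solT p) => x [dT pT].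
    have dD : differentiable (cst D) x by exact: differentiable_cst.
    split; first exact: (differentiable_mulmx dT dD).
    move=> i; have E := partial_mulmx i dT dD.
    have E0 : partial i (cst D) x = 0 := partial_cst _ _ _.
    rewrite E0 mulmx0 addr0 (pT i) -colE in E; refine (etrans E _).
    by apply/matrixP => a b; rewrite !ord1 [LHS]mxE hess_mx_c mxE.
  apply: filterS2 (sl p (lshift 1 0)) (near_to (chart_at_dom p) lc) => y -> ->.
  by rewrite atp.
move=> p; pose U x := s (inv p x) 0 cu.
have UT : \forall x \near chart_coord p, (fun z => (s p *m sol p z) 0 cu) x = U x.
  by apply: filterS (invT p (rshift 1 0)) => x E; exact: esym E.
have dU : \forall x \near chart_coord p, differentiable U x /\
    forall i, partial i U x = (s p *m sol p x) 0 (rshift _ i).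
  apply: filterS2 (nbhs_interior UT) (solTe p cu) => x UTx [dT pT].
  split; first exact: near_eq_differentiable UTx dT.
  by move=> i; rewrite -(near_eq_partial i UTx) pT hess_mx_u.
have UTi i : \forall x \near chart_coord p, (fun z => (s p *m sol p z) 0 (rshift _ i)) x = partial i U x.
  by apply: filterS dU => x [_ ->].
have [dUc pUc] := nbhs_singleton dU.
split.
- by apply: filterS dU => x [].
- move=> i; have [dT _] := nbhs_singleton (solTe p (rshift _ i)).
  exact: near_eq_differentiable (UTi i) dT.
move=> i j; rewrite -(near_eq_partial i (UTi j)).
have [_ ->] := nbhs_singleton (solTe p (rshift _ j)); rewrite hess_mx_w atp.
by congr (_ + _); apply: eq_bigr => t _; rewrite pUc atp.
Qed.

End ConstantCurvatureManifold.

(** * The maximum principle *)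

(** Induction by Schur complement: [P] is a positive multiple of a square [c^T c] plus a smaller
    positive definite block [S]. The square contributes a value of the form [Q] at [c]. *)
Lemma trace_posdef_mul (R : realFieldType) n (P Q : 'M[R]_n) : P^T = P ->
  (forall v : 'rV[R]_n, v != 0 -> 0 < (v *m P *m v^T) 0 0) ->
  (forall v : 'rV[R]_n, (v *m Q *m v^T) 0 0 <= 0) -> \tr (P *m Q) <= 0.
Proof.
elim: n P Q => [|n IH] P Q symP posP negQ.
  by rewrite /mxtrace big_ord0.
rewrite -[n.+1]/(1 + n)%N in P Q symP posP negQ *.
pose a := P 0 0; pose b := ursubmx P; pose D := drsubmx P.
have a0 : 0 < a.
  have := posP (delta_mx 0 0); rewrite -rowE trmx_delta -colE !mxE; apply.
  by apply/negP => /eqP/matrixP/(_ 0 0); rewrite !mxE !eqxx => /eqP; rewrite oner_eq0.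
have ul : ulsubmx P = a%:M.
  by rewrite [LHS]mx11_scalar !mxE; congr (P _ _)%:M; exact: val_inj.
have dl : dlsubmx P = b^T by rewrite -[in LHS]symP trmx_ursub.
have PE : P = block_mx a%:M b b^T D by rewrite -[LHS]submxK ul dl.
have symD : D^T = D by rewrite trmx_drsub symP.
pose c := row_mx a%:M b; pose S := D - a^-1 *: (b^T *m b).
have E : P = a^-1 *: (c^T *m c) + block_mx 0 0 0 S.
  rewrite PE /c tr_row_mx mul_col_row scale_block_mx add_block_mx !addr0 tr_scalar_mx.
  rewrite -scalar_mxM !mul_scalar_mx mul_mx_scalar scale_scalar_mx !scalerA mulrA mulVf ?gt_eqF// mul1r !scale1r.
  by rewrite /S addrC subrK.
have vE (v : 'rV[R]_n) w : row_mx w v *m P *m (row_mx w v)^T =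
    w *m (a *: w^T) + w *m b *m v^T + v *m b^T *m w^T + v *m D *m v^T.
  rewrite PE mul_row_block tr_row_mx mul_row_col !mulmxDl mul_mx_scalar -scalemxAl scalemxAr -!addrA.
  by congr (_ + _); rewrite addrCA.
rewrite E mulmxDl mxtraceD -[leRHS]addr0; apply: lerD.
  rewrite -scalemxAl mxtraceZ -mulmxA mxtrace_mulC mulr_ge0_le0 ?invr_ge0 ?(ltW a0)//.
  by rewrite /mxtrace big_ord1; exact: negQ.
rewrite -[Q]submxK mulmx_block !mul0mx !add0r mxtrace_block mxtrace0 add0r.
apply: IH.
- rewrite /S linearB/= linearZ/= trmx_mul trmxK symD //.
(* The first entry that completes the square, so that [P] takes at this vector the value of [S] at
   [v]. *)
- move=> v v0; have := posP (row_mx (- a^-1 *: (v *m b^T)) v).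
  rewrite vE => /(_ _)/lt_le_trans; apply.
    by apply: contra_neq v0; rewrite -row_mx0 => /eq_row_mx[].
  rewrite le_eqVlt; apply/orP; left; apply/eqP.
  have [s sE] : exists s, v *m b^T = s%:M by exists ((v *m b^T) 0 0); exact: mx11_scalar.
  have bv : b *m v^T = s%:M by rewrite -[LHS]trmxK trmx_mul trmxK sE tr_scalar_mx.
  have SE : v *m S *m v^T = v *m D *m v^T - a^-1 *: (s%:M *m s%:M).
    by rewrite /S mulmxBr mulmxBl -scalemxAr -scalemxAl mulmxA -!(mulmxA _ b) bv sE.
  rewrite SE sE scale_scalar_mx tr_scalar_mx -(mulmxA _ b) bv !scale_scalar_mx -!scalar_mxM.
  rewrite scale_scalar_mx; move: (v *m D *m v^T) => z.
  rewrite !mxE eqxx !mulr1n.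
  by field; rewrite gt_eqF.
- move=> v; have := negQ (row_mx 0 v).
  by rewrite -[in X in X -> _](submxK Q) mul_row_block tr_row_mx mul_row_col !mul0mx trmx0 mulmx0 !add0r.
Qed.

Section LocalMaximum.
Context {R : realType} {n : nat}.
Variables (psi : 'rV[R]_n -> R) (x : 'rV[R]_n).
Hypothesis dpsi : \forall y \near x, differentiable psi y.
Hypothesis pmax : \forall y \near x, psi y <= psi x.

Let near_line (v : 'rV[R]_n) : \forall t \near (0 : R)^'+, psi (x + t *: v) <= psi x.
Proof.
apply: (@cvg_at_right_filter _ _ (fun t : R => x + t *: v)) pmax.
have H : x + t *: v @[t --> (0 : R)] --> x + 0 *: v.
  by apply: cvgD; [exact: cvg_cst|apply: cvgZr_tmp; exact: cvg_id].
by rewrite scale0r addr0 in H.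
Qed.

Let derive_le0 v : 'D_v psi x <= 0.
Proof.
have dx := nbhs_singleton dpsi.
have dv := diff_derivable (v := v) dx.
rewrite leNgt; apply/negP => d0.
have H1 : \forall t \near (0 : R)^', 0 < t^-1 *: ((psi \o shift x) (t *: v) - psi x).
  exact: cvgr_gt dv 0 d0.
have H2 : \forall t \near (0 : R)^'+, 0 < t^-1 *: (psi (x + t *: v) - psi x).
  move: H1; rewrite !near_withinE; apply: filterS => t Ht t0.
  by rewrite [x + _]addrC; exact: Ht (lt0r_neq0 t0).
have [t [Ht Pt t0]] : exists t : R, [/\ 0 < t^-1 *: (psi (x + t *: v) - psi x), psi (x + t *: v) <= psi x & 0 < t].
  apply: (@filter_ex _ ((0 : R)^'+)); apply: filterS3 H2 (near_line v) (nbhs_right_gt 0) => t *; split => //.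
  by have := Ht; rewrite -[_ *: _]/(_ * _) ltNge mulr_ge0_le0// ?invr_ge0 ?subr_le0// ltW.
Qed.

Lemma partial_max i : partial i psi x = 0.
Proof.
have dx := nbhs_singleton dpsi.
apply/eqP; rewrite eq_le derive_le0/= -oppr_le0.
have := derive_le0 (- delta_mx 0 i); rewrite !deriveE// linearN.
by rewrite partialE deriveE.
Qed.

Hypothesis dppsi : forall i, differentiable (partial i psi) x.

(** In the directions [w] and [-w] the second difference is
    [2 psi x - psi (x + t w) - psi (x - t w)], which is nonnegative and approximates minus the
    Hessian times [t^2]. The vector is first rescaled into the unit ball, as [second_difference]
    requires. *)
Lemma hessian_max (v : 'rV[R]_n) : \sum_i \sum_j v 0 i * v 0 j * partial i (partial j psi) x <= 0.
Proof.
pose c := (`|v| + 1)^-1; pose w := c *: v.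
have c0 : 0 < c by rewrite invr_gt0 ltr_wpDl.
have w1 : `|w| <= 1.
  rewrite normrZ gtr0_norm// ler_pdivrMl ?ltr_wpDl// mulr1 lerDl //.
have pw : \forall y \near x, \sum_j w 0 j *: partial j psi y = 'D_w psi y.
  by apply: filterS dpsi => y dy; rewrite derive_partial.
have dDw : differentiable ('D_w psi) x.
  apply: near_eq_differentiable pw _; apply: differentiable_bigsum => j.
  by apply: differentiableZ.
have DD : 'D_(- w) ('D_w psi) x = - \sum_i \sum_j w 0 i * w 0 j * partial i (partial j psi) x.
  rewrite deriveE// linearN; congr (- _); rewrite -deriveE// derive_partial//.
  apply: eq_bigr => i _; rewrite -(near_eq_partial i pw) partialE derive_bigsum.
    rewrite scaler_sumr; apply: eq_bigr => j _.
    by rewrite deriveZ /=; [rewrite -partialE /GRing.scale/= mulrA|exact: diff_derivable].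
  by move=> j; apply: derivableZ; exact: diff_derivable.
suff : \sum_i \sum_j w 0 i * w 0 j * partial i (partial j psi) x <= 0.
  have -> : \sum_i \sum_j w 0 i * w 0 j * partial i (partial j psi) x =
      c * c * \sum_i \sum_j v 0 i * v 0 j * partial i (partial j psi) x.
    rewrite mulr_sumr; apply: eq_bigr => i _; rewrite mulr_sumr; apply: eq_bigr => j _.
    by rewrite !mxE; ring.
  by rewrite pmulr_rle0// mulr_gt0.
rewrite -oppr_ge0 -DD; apply/ler_addgt0Pr => e e0.
have w1' : `|- w| <= 1 by rewrite normrN.
have e3 : 0 < e / 3 by rewrite divr_gt0.
have H := second_difference w1 w1' dpsi dDw e3.
have [t [Ht Pt Pt' t0]] : exists t : R, [/\ `|psi (x + t *: w + t *: (- w)) - psi (x + t *: w) - psi (x + t *: (- w)) + psi x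
    - t * t * 'D_(- w) ('D_w psi) x| <= 3 * (e / 3) * (t * t), psi (x + t *: w) <= psi x, psi (x + t *: (- w)) <= psi x & 0 < t].
  apply: (@filter_ex _ ((0 : R)^'+)); near=> t; split.
  - by near: t.
  - by near: t; exact: near_line.
  - by near: t; exact: near_line.
  - by near: t; exact: nbhs_right_gt.
move: Ht; rewrite scalerN addrK ler_norml => /andP[_].
have -> : 3 * (e / 3) = e by field.
have tt : 0 < t * t by rewrite mulr_gt0.
rewrite scalerN in Pt' => Ht.
rewrite -(pmulr_rge0 _ tt) mulrDr; lra.
Unshelve. all: by end_near.
Qed.

End LocalMaximum.

Section MaximumPrinciple.
Context {R : realType} {m n : nat}.
Variables (N : smoothManifold R m) (M : riemannianManifold R n) (f : N -> M) (q : N).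
Hypothesis m0 : (0 < m)%N.
Hypothesis immf : immersion f.
Hypothesis minf : mean_curvature f q = 0.
Variables (v : 'rV[R]_n -> R) (lam : R).
Hypothesis hv : hessian_at (metric (f q)) (chart_coord (f q)) v lam.

Let F := local_rep f q.
Let x0 := chart_coord q.
Let y0 := chart_coord (f q).
Let J := 'J F x0.
Let h := induced_metric f q.
Let psi := v \o F.

Let Fx0 : F x0 = y0.
Proof. by rewrite /F /local_rep /= inv_chart_coord. Qed.

Let smoothF : \forall x \near x0, differentiable F x /\ forall i, differentiable (partial i F) x.
Proof.
have [[_ /(_ q)[U [oU Ux] sF]] _] := immf.
apply: filterS (near_open oU Ux) => x {}Ux; split.
  exact: C1_differentiable (smooth_C1 sF) Ux.
by move=> i; exact: C1_differentiable (smooth_C1 (smooth_partial i sF)) Ux.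
Qed.

Let near_F (P : 'rV[R]_n -> Prop) : (\forall y \near y0, P y) -> \forall x \near x0, P (F x).
Proof.
have [dF _] := nbhs_singleton smoothF; rewrite -Fx0 => H.
exact: (differentiable_continuous dF : F x @[x --> x0] --> F x0) _ H.
Qed.

Let dpsi : \forall x \near x0, differentiable psi x /\
  forall i, partial i psi x = \sum_a partial i F x 0 a * partial a v (F x).
Proof.
have [dv _ _] := hv; apply: filterS2 smoothF (near_F dv) => x [dF _] dvF.
split; first exact: differentiable_comp.
move=> i; rewrite /psi partial_comp//; apply: eq_bigr => a _.
by rewrite -(row_jacobian i dF) [row _ _ _ _]mxE.
Qed.

Let JE i a : J i a = partial i F x0 0 a.
Proof. by have [dF _] := nbhs_singleton smoothF; rewrite -(row_jacobian i dF) [RHS]mxE. Qed.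

Let dpsi0 i : partial i psi x0 = \sum_a J i a * partial a v y0.
Proof.
have [_ ->] := nbhs_singleton dpsi; apply: eq_bigr => a _.
by rewrite JE Fx0.
Qed.

Let dFe i a : differentiable (fun x => partial i F x 0 a) x0.
Proof.
by have [_ /(_ i)/differentiable_mxP] := nbhs_singleton smoothF; exact.
Qed.

Let dvF a : differentiable (partial a v \o F) x0.
Proof.
have [_ dpv _] := hv; have [dF _] := nbhs_singleton smoothF.
by apply: differentiable_comp => //; rewrite Fx0.
Qed.

Let ppsi i : \forall x \near x0,
  \sum_a (fun x => partial i F x 0 a) x * (partial a v \o F) x = partial i psi x.
Proof. by apply: filterS dpsi => x [_ ->]. Qed.

Let dppsi i : differentiable (partial i psi) x0.
Proof.
apply: near_eq_differentiable (ppsi i) _; apply: differentiable_bigsum => a.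
by apply: differentiableM.
Qed.

(** The Christoffel symbols in the covariant Hessian of [v] are exactly those that complete the
    second derivative of [F] to [ambient_derivative]. *)
Let hessian_psi i j : partial i (partial j psi) x0 =
  lam * h i j + \sum_c ambient_derivative f q i j 0 c * partial c v y0.
Proof.
have [dF dpF] := nbhs_singleton smoothF; have [_ dpv hess] := hv.
rewrite -(near_eq_partial i (ppsi j)) partialE derive_bigsum => [|a]; last first.
  by apply: diff_derivable; exact: differentiableM.
under eq_bigr => a _.
  rewrite deriveM; [|exact: diff_derivable|exact: diff_derivable].
  rewrite -(derive_entry 0 a (diff_derivable (dpF j))) -!partialE.
  rewrite (partial_comp i dF); last by rewrite Fx0.
  rewrite /= Fx0 -JE.
  over.
rewrite /= big_split /=.
have -> : ambient_derivative f q i j = partial i (partial j F) x0 +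
    \row_c \sum_a \sum_b J i a * J j b * christoffel (metric (f q)) a b c y0 by [].
under [X in _ = _ + X]eq_bigr => c _ do rewrite mxE mulrDl.
rewrite big_split/= addrCA [LHS]addrC; congr (_ + _).
  by apply: eq_bigr => c _; rewrite /GRing.scale/= mulrC.
have hE : h i j = \sum_a \sum_b J i b * metric (f q) y0 b a * J j a.
  rewrite /h /induced_metric mxE; apply: eq_bigr => a _.
  by rewrite [_^T _ _]mxE mxE mulr_suml.
rewrite hE mulr_sumr.
under [X in _ = _ + X]eq_bigr do rewrite mxE exchange_big mulr_suml/=.
rewrite [X in _ = _ + X]exchange_big -big_split; apply: eq_bigr => a _ /=.
rewrite [LHS]scaler_sumr mulr_sumr.
under [X in _ = _ + X]eq_bigr do rewrite mulr_suml.
rewrite [X in _ = _ + X]exchange_big -big_split; apply: eq_bigr => b _ /=.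
rewrite hess /GRing.scale/= -/J -/y0 !mulrDr; congr (_ + _).
  by move: (metric _ _ _ _) (J _ _) (J _ _) => t1 t2 t3; ring.
rewrite !mulr_sumr; apply: eq_bigr => s _.
by move: (christoffel _ _ _ _ _) (J _ _) (J _ _) (partial _ _ _) => t1 t2 t3 t4; ring.
Qed.

Let symh : h^T = h.
Proof.
rewrite /h /induced_metric !trmx_mul trmxK mulmxA Defs.metric_sym//.
exact: chart_coord_img.
Qed.

Let posh (w : 'rV[R]_m) : w != 0 -> 0 < (w *m h *m w^T) 0 0.
Proof.
move=> w0; have [_ /(_ q) fJ] := immf.
have wJ : w *m J != 0 by apply: contra_neq w0 => wJ; apply: (row_free_inj fJ); rewrite wJ mul0mx.
have := metric_posdef (chart_coord_img (f q)) wJ.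
by rewrite /inner /h /induced_metric trmx_mul !mulmxA.
Qed.

Let unith : h \in unitmx.
Proof. by apply: posdef_unit => w; exact: posh. Qed.

Let trace_h : \sum_i \sum_j invmx h i j * h i j = m%:R.
Proof.
rewrite -[RHS](mxtrace1 R m) -(mulVmx unith); apply: eq_bigr => i _.
rewrite mxE; apply: eq_bigr => j _.
by rewrite -[in h i j]symh mxE.
Qed.

(** Minimality: the normal part of the traced ambient derivative vanishes, so that it is tangent to
    the submanifold. *)
Let trace_ambient : exists w : 'rV[R]_m,
  \sum_i \sum_j invmx h i j *: ambient_derivative f q i j = w *m J.
Proof.
move: minf; rewrite /mean_curvature -/h => /eqP; rewrite scaler_eq0 invr_eq0 pnatr_eq0.
rewrite -[(m == 0)%N]negbK -lt0n m0/= => /eqP.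
rewrite /second_fundamental_form /normal_part -/h.
set D := ambient_derivative f q; set g := metric _ _; rewrite -/x0 -/F -/J => E.
exists ((\sum_i \sum_j invmx h i j *: D i j) *m g *m J^T *m invmx h).
apply/eqP; rewrite -subr_eq0; apply/eqP; rewrite -[RHS]E.
rewrite !mulmx_suml -sumrB; apply: eq_bigr => i _.
rewrite !mulmx_suml -sumrB; apply: eq_bigr => j _.
by rewrite scalerBr -!scalemxAl.
Qed.

Lemma maximum_principle :
  (\forall x \near x0, psi x <= psi x0) -> lam <= 0.
Proof.
move=> pmax; have dpsi' : \forall x \near x0, differentiable psi x.
  by apply: filterS dpsi => x [].
have p0 := partial_max dpsi' pmax.
pose Q : 'M[R]_m := \matrix_(a, b) partial b (partial a psi) x0.
have negQ (w : 'rV[R]_m) : (w *m Q *m w^T) 0 0 <= 0.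
  have := hessian_max dpsi' pmax dppsi w; congr (_ <= 0).
  rewrite mxE; apply: eq_bigr => b _.
  rewrite [_^T _ _]mxE mxE mulr_suml; apply: eq_bigr => a _.
  by rewrite [Q _ _]mxE; move: (partial _ _ _) => X; ring.
have posh' (w : 'rV[R]_m) : w != 0 -> 0 < (w *m invmx h *m w^T) 0 0.
  move=> w0; have wh : w *m invmx h != 0.
    by apply: contra_neq w0 => wh; rewrite -[w](mulmxKV unith) wh mul0mx.
  by have := posh wh; rewrite trmx_mul trmx_inv symh mulmxKV// mulmxA.
have symh' : (invmx h)^T = invmx h by rewrite trmx_inv symh.
have := trace_posdef_mul symh' posh' negQ.
have -> : \tr (invmx h *m Q) = lam * m%:R.
  have [w wE] := trace_ambient.
  have -> : \tr (invmx h *m Q) = \sum_i \sum_j invmx h i j * partial i (partial j psi) x0.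
    by apply: eq_bigr => i _; rewrite mxE; apply: eq_bigr => j _; rewrite [Q _ _]mxE.
  under eq_bigr do under eq_bigr do rewrite hessian_psi mulrDr mulrCA.
  under eq_bigr do rewrite big_split/= -mulr_sumr.
  rewrite big_split/= -mulr_sumr trace_h -[RHS]addr0; congr (_ + _).
  (* The tangent term is the derivative of [psi] along [w], zero at a maximum; so the Christoffel
     symbols of the induced metric never enter. *)
  transitivity (\sum_c (w *m J) 0 c * partial c v y0).
    rewrite -wE; under [RHS]eq_bigr do rewrite summxE mulr_suml.
    rewrite [RHS]exchange_big; apply: eq_bigr => i _.
    under [RHS]eq_bigr do rewrite summxE mulr_suml.
    rewrite [RHS]exchange_big; apply: eq_bigr => j _.
    by rewrite mulr_sumr; apply: eq_bigr => c _; rewrite [in RHS]mxE mulrA.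
  under eq_bigr do rewrite mxE mulr_suml.
  rewrite exchange_big big1// => a _.
  by under eq_bigr do rewrite -mulrA; rewrite -mulr_sumr -dpsi0 p0 mulr0.
by rewrite pmulr_lle0// ltr0n.
Qed.

End MaximumPrinciple.

Lemma connected_locally_constant (T : topologicalType) (V : eqType) (c : T -> V) :
  connected [set: T] -> (forall x, \forall y \near x, c y = c x) -> forall x y, c x = c y.
Proof.
move=> conn lc x y.
have op (P : pred V) : open [set z | P (c z)].
  by rewrite openE => z Pz; apply: filterS (lc z) => w /= ->.
have H : [set z | c z == c y] = setT.
  apply: conn.
  - by exists y => /=.
  - by exists [set z | c z == c y]; [exact: (op (fun v => v == c y))|rewrite setTI].
  - exists [set z | c z == c y]; last by rewrite setTI.
    rewrite -openC; have -> : ~` [set z | c z == c y] = [set z | c z != c y].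
      by apply/seteqP; split => z /= /negP.
    exact: (op (fun v => v != c y)).
by apply/eqP; have : [set z | c z == c y] x by rewrite H.
Qed.

Section Submanifold.
Context {R : realType} {m n : nat}.
Variables (N : smoothManifold R m) (M : riemannianManifold R n) (f : N -> M).
Hypothesis minf : compact_minimal_submanifold f.

Lemma minimal_maximum (u : M -> R) lam q :
  hessian_at (metric (f q)) (chart_coord (f q)) (u \o chart_inv (chart_at (f q))) lam ->
  (forall x, u (f x) <= u (f q)) -> lam <= 0.
Proof.
move=> hu umax; have [[[/andP[m0 _] _ _ immf] H0] _] := minf.
apply: (maximum_principle m0 immf (H0 q) hu).
have [[cf _] _] := immf.
have cq := chart_coord_img q.
have H : \forall x \near chart_coord q, chart_dom (chart_at (f q)) (f (chart_inv (chart_at q) x)).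
  apply: (near_inv (P := fun x => chart_dom (chart_at (f q)) (f x)) cq); rewrite inv_chart_coord.
  by apply: cf; exact: near_dom (chart_at_dom _).
apply: filterS H => x dx.
by rewrite /local_rep/= inv_chart_coord !chart_atK//; exact: chart_at_dom.
Qed.

Lemma compact_maximum (u : M -> R) : continuous u -> exists q, forall x, u (f x) <= u (f q).
Proof.
move=> cu; have [[[_ [q0 _] _ [[cf _] _]] _] cN] := minf.
have N0 : [set: N] !=set0 by exists q0.
have cuf : continuous (u \o f) by move=> x; apply: continuous_comp; [exact: cf|exact: cu].
have [q _ qmax] := compact_EVT_max N0 cN (continuous_subspaceT cuf).
by exists q => x; apply: qmax; rewrite inE.
Qed.

End Submanifold.

Lemma hessian_continuous (R : realType) n (M : riemannianManifold R n) (u : M -> R) (lam : M -> R) :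
  (forall p, hessian_at (metric p) (chart_coord p) (u \o chart_inv (chart_at p)) (lam p)) ->
  continuous u.
Proof.
move=> hu p; have [/nbhs_singleton du _ _] := hu p.
have cu := differentiable_continuous du.
have H : \forall y \near p, u y = (u \o chart_inv (chart_at p)) (chart_to (chart_at p) y).
  by apply: filterS (near_dom (chart_at_dom p)) => y py /=; rewrite chart_atK.
move=> A /= nA.
have := cu A; rewrite /= inv_chart_coord => /(_ nA) /(near_to (chart_at_dom p)) => nA'.
rewrite -[nbhs _ _]/(\forall y \near p, A (u y)).
by apply: filterS2 H nA' => y ->.
Qed.

Lemma no_minimal_nonpositive (R : realType) n (M : riemannianManifold R n) (k : R) :
  simply_connected R M -> constant_sectional_curvature M k -> k <= 0 ->
  ~ (exists (m : nat) (N : smoothManifold R m) (f : N -> M),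
          compact_minimal_submanifold f).
Proof.
move=> sc ck k0 [m [N [f minf]]].
have [[[_ [q0 _] connN [[cf _] _]] _] _] := minf.
have [c [u [c1 u0 lc hu]]] := hessian_function ck (f q0) sc.
have [q umax] := compact_maximum minf (hessian_continuous hu).
have := minimal_maximum minf (hu (f q)) umax.
have -> : c (f q) = 1.
  rewrite -c1; apply: (@connected_locally_constant _ _ (c \o f)) => // x.
  exact: cf _ _ (lc (f x)).
have := umax q0; rewrite u0 => uq; apply/negP; rewrite -ltNge.
by rewrite subr_gt0 (le_lt_trans _ ltr01)// mulr_le0_ge0.
Qed.

(** * The round sphere *)

Lemma unitmx_diag_block (R : comUnitRingType) m n (A : 'M[R]_m) (B : 'M[R]_n) :
  A \in unitmx -> B \in unitmx -> block_mx A 0 0 B \in unitmx.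
Proof. by move=> uA uB; rewrite unitmxE det_ublock unitrM -!unitmxE uA uB. Qed.

Section Gauss.
Context {R : realType} {n : nat}.
Variables (U : set 'rV[R]_n) (g : 'rV[R]_n -> 'M[R]_n) (F : 'rV[R]_n -> 'rV[R]_n.+1) (k : R).
Hypothesis k0 : k != 0.
Hypothesis oU : open U.
Hypothesis sF : smooth_on U F.
Hypothesis gE : forall x, U x -> 'J F x *m ('J F x)^T = g x.
Hypothesis ug : forall x, U x -> g x \in unitmx.
Hypothesis FF : forall x, U x -> F x *m (F x)^T = k^-1%:M.
Local Notation e i := (delta_mx 0 i : 'rV[R]_n).
Local Notation J x := ('J F x).

Let dF x : U x -> differentiable F x.
Proof. exact: C1_differentiable (smooth_C1 sF). Qed.

Let rowJ i x : U x -> row i (J x) = partial i F x.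
Proof. by move=> Ux; rewrite row_jacobian//; exact: dF. Qed.

Let C1J : Ck_on 1 U (fun x => J x).
Proof. exact: C1_jacobian. Qed.

Let dJ x : U x -> differentiable (fun x => J x) x.
Proof. exact: C1_differentiable C1J. Qed.

Let row_partialJ i j x : U x -> row i (partial j (fun x => J x) x) = partial j (partial i F) x.
Proof. exact: row_partial_jacobian. Qed.

Let JF x : U x -> J x *m (F x)^T = 0.
Proof.
move=> Ux; apply/row_matrixP => i; rewrite row_mul rowJ// row0.
have dFT := differentiable_trmx (dF Ux).
have H : partial i (fun y => F y *m (F y)^T) x = 0.
  refine (etrans _ (partial_cst (k^-1%:M : 'M[R]_1) i x)).
  by apply: near_eq_partial; apply: filterS (near_open oU Ux) => y; exact: FF.
have := partial_mulmx i (dF Ux) dFT; rewrite H (partial_trmx i (dF Ux)).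
move=> /matrixP/(_ 0 0); rewrite mxE [in X in _ = X]mxE.
have -> : (F x *m (partial i F x)^T) 0 0 = (partial i F x *m (F x)^T) 0 0.
  by rewrite -[in LHS](trmxK (F x *m _)) trmx_mul trmxK mxE.
move=> E; apply/matrixP => a b; rewrite !ord1 [RHS]mxE; lra.
Qed.

(** The tangential part of the Euclidean second derivative is a torsion-free metric connection,
    hence the Levi-Civita one. *)
Let gam_jacobian i x : U x -> partial i (fun x => J x) x *m (J x)^T = gam g i x *m g x.
Proof.
move=> Ux; pose T i := partial i (fun x => J x) x *m (J x)^T *m invmx (g x).
suff /(_ i) <- : forall i, T i = gam g i x by rewrite /T mulmxKV ?ug.
have symg : (g x)^T = g x by rewrite -gE// trmx_mul trmxK.
apply: levi_civita_unique => [||j|a b]; [exact: symg|exact: ug| |].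
  have dJT := differentiable_trmx (dJ Ux).
  have -> : partial j g x = partial j (fun y => J y *m (J y)^T) x.
    by apply: near_eq_partial; apply: filterS (near_open oU Ux) => y Uy; rewrite gE.
  refine (etrans (partial_mulmx j (dJ Ux) dJT) _); rewrite (partial_trmx j (dJ Ux)).
  rewrite /T mulmxKV ?ug//; apply: (f_equal (fun z => _ + z)).
  by rewrite !trmx_mul trmxK trmx_inv symg mulKVmx ?ug.
rewrite /T !row_mul; apply: (f_equal (fun z => z *m _ *m _)).
refine (etrans (row_partialJ b a Ux) (etrans _ (esym (row_partialJ a b Ux)))).
exact: (@smooth_schwarz R n 1 n.+1 U F a b x oU sF Ux).
Qed.

(** The difference [D] of the two sides is orthogonal to the position vector and to the tangent
    vectors, which together span the Euclidean space. *)
Let partialJ i x : U x ->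
  partial i (fun x => J x) x = gam g i x *m J x - k *: (g x *m (e i)^T *m F x).
Proof.
move=> Ux; pose D := partial i (fun x => J x) x - (gam g i x *m J x - k *: (g x *m (e i)^T *m F x)).
apply/eqP; rewrite -subr_eq0 -/D; apply/eqP.
have FJ : F x *m (J x)^T = 0 by apply: trmx_inj; rewrite trmx_mul trmxK JF// trmx0.
have DJ : D *m (J x)^T = 0.
  rewrite /D !mulmxBl -scalemxAl -!(mulmxA _ (F x)) FJ mulmx0 scaler0 subr0.
  by rewrite gam_jacobian// -mulmxA gE// subrr.
have DF : D *m (F x)^T = 0.
  rewrite /D !mulmxBl -scalemxAl -!(mulmxA _ (F x)) -(mulmxA _ (J x)) JF// mulmx0 FF// sub0r opprK.
  rewrite mul_mx_scalar scalerA mulfV// scale1r.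
  have := partial_mulmx i (dJ Ux) (differentiable_trmx (dF Ux)).
  have -> : partial i (fun y => J y *m (F y)^T) x = 0.
    refine (etrans _ (partial_cst (0 : 'M[R]_(n, 1)) i x)).
    by apply: near_eq_partial; apply: filterS (near_open oU Ux) => y; exact: JF.
  rewrite (partial_trmx i (dF Ux)) -rowJ// rowE trmx_mul mulmxA gE// => /esym.
pose B : 'M[R]_n.+1 := col_mx (F x) (J x).
have uB : B \in unitmx.
  have : B *m B^T \in unitmx.
    have -> : B *m B^T = @block_mx R 1 n 1 n (k^-1%:M) 0 0 (g x).
      refine (etrans (f_equal (mulmx B) (tr_col_mx (F x) (J x))) _).
      refine (etrans (mul_col_row (F x) (J x) (F x)^T (J x)^T) _).
      by rewrite gE// JF// FJ FF.
    apply: (@unitmx_diag_block _ 1 n); last exact: ug.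
    by rewrite unitmxE det_scalar expr1 unitfE invr_eq0.
  by rewrite unitmx_mul => /andP[].
have : D *m B^T = 0.
  refine (etrans (f_equal (mulmx D) (tr_col_mx (F x) (J x))) _).
  by refine (etrans (mul_mx_row D (F x)^T (J x)^T) _); rewrite DJ DF row_mx0.
by move=> /(congr1 (mulmx^~ (invmx B^T))); rewrite mul0mx mulmxK// unitmx_tr.
Qed.

Lemma gauss_formula i j x : U x ->
  partial i (partial j F) x = \sum_s christoffel g i j s x *: partial s F x - (k * g x i j) *: F x.
Proof.
move=> Ux; refine (etrans (esym (row_partialJ j i Ux)) _); rewrite partialJ//.
have rB (A B : 'M[R]_(n, n.+1)) c : row c (A - B) = row c A - row c B by rewrite linearB.
rewrite rB linearZ/= !row_mul; congr (_ - _).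
  rewrite [row j _]row_sum_delta mulmx_suml; apply: eq_bigr => s _.
  by rewrite -scalemxAl -rowE rowJ// !mxE.
have -> : row j (g x) *m (e i)^T = (g x i j)%:M.
  have symg : (g x)^T = g x by rewrite -gE// trmx_mul trmxK.
  rewrite trmx_delta -colE; apply/matrixP => a b.
  by rewrite !ord1 !mxE eqxx mulr1n -[in LHS]symg mxE.
by rewrite mul_scalar_mx scalerA.
Qed.

Lemma linear_hessian (b : 'rV[R]_n.+1) x : U x ->
  hessian_at g x (fun y => (b *m (F y)^T) 0 0) (- k * (b *m (F x)^T) 0 0).
Proof.
have dB (G : 'rV[R]_n -> 'rV[R]_n.+1) y : differentiable G y ->
    differentiable (fun z => b *m (G z)^T) y.
  by move=> dG; exact: (differentiable_mulmx (differentiable_cst b y) (differentiable_trmx dG)).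
have db (G : 'rV[R]_n -> 'rV[R]_n.+1) y : differentiable G y ->
    differentiable (fun z => (b *m (G z)^T) 0 0) y.
  by move=> /dB/differentiable_mxP; exact.
have pb (G : 'rV[R]_n -> 'rV[R]_n.+1) i y : differentiable G y ->
    partial i (fun z => (b *m (G z)^T) 0 0) y = (b *m (partial i G y)^T) 0 0.
  move=> dG; refine (etrans (esym (@partial_entry _ _ _ _ _ i y 0 0 (dB _ _ dG))) _).
  have := partial_mulmx i (differentiable_cst b y) (differentiable_trmx dG).
  have E0 : partial i (cst b) y = 0 := partial_cst _ _ _.
  by rewrite E0 mul0mx add0r (partial_trmx i dG) => ->.
have dpF i y : U y -> differentiable (partial i F) y.
  by move=> Uy; exact: (C1_differentiable (smooth_C1 (smooth_partial i sF)) Uy).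
move=> Ux.
have pF i : \forall y \near x, (fun z => (b *m (partial i F z)^T) 0 0) y =
    partial i (fun z => (b *m (F z)^T) 0 0) y.
  by apply: filterS (near_open oU Ux) => y Uy; rewrite pb//; exact: dF.
split.
- by apply: filterS (near_open oU Ux) => y Uy; apply: db; exact: dF.
- by move=> i; apply: near_eq_differentiable (pF i) _; apply: db; exact: dpF.
move=> i j; rewrite -(near_eq_partial i (pF j)) pb; last exact: dpF.
rewrite gauss_formula// linearB/= mulmxBr linearZ/= -scalemxAr linear_sum/= mulmx_sumr mxE [X in _ + X]mxE.
rewrite [X in _ - X]mxE summxE addrC; congr (_ + _); first by ring.
apply: eq_bigr => s _; rewrite pb; last exact: dF.
by rewrite linearZ/= -scalemxAr mxE.
Qed.

End Gauss.

Lemma sphere_hessian (R : realType) n (k : R) (M : riemannianManifold R n)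
    (iota : M -> 'rV[R]_n.+1) (a : 'rV[R]_n.+1) : 0 < k ->
  (forall p, euclidean_sphere k (iota p)) ->
  (forall p, let F := iota \o chart_inv (chart_at p) in
     smooth_on (chart_img (chart_at p)) F /\
     (forall x, chart_img (chart_at p) x -> 'J F x *m ('J F x)^T = metric p x)) ->
  forall p, hessian_at (metric p) (chart_coord p)
    ((fun y => - (a *m (iota y)^T) 0 0) \o chart_inv (chart_at p))
    (k * (a *m (iota p)^T) 0 0).
Proof.
move=> k0 sph HF p; have [sF gE] := HF p.
have oU := @chart_img_open _ _ _ (chart_at p).
have FF x : chart_img (chart_at p) x -> (iota \o chart_inv (chart_at p)) x *m
   ((iota \o chart_inv (chart_at p)) x)^T = k^-1%:M.
  by move=> _; rewrite [LHS]mx11_scalar; congr (_%:M); exact: sph.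
have := linear_hessian (lt0r_neq0 k0) oU sF gE (@metric_unit _ _ M p) FF (- a) (chart_coord_img p).
rewrite /= inv_chart_coord mulNmx mxE mulrNN.
have -> // : (fun y => (- a *m (iota (chart_inv (chart_at p) y))^T) 0 0) =
    (fun y => - (a *m (iota y)^T) 0 0) \o chart_inv (chart_at p).
by apply/funext => y; rewrite mulNmx mxE.
Qed.

(** * Comparison of angle and arc length *)

Section Crossing.
Context {R : realType}.

Lemma derive_gt0_left (G : R -> R) (t d : R) : is_derive t 1 G d -> 0 < d ->
  \forall x \near t, x < t -> G x < G t.
Proof.
move=> [dG <-] d0.
have H : \forall h \near (0 : R)^', 0 < h^-1 *: ((G \o shift t) (h *: 1) - G t).
  exact: cvgr_gt dG 0 d0.
move: H; rewrite near_withinE => H.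
have H' : \forall x \near t, x - t != 0 -> 0 < (x - t)^-1 *: ((G \o shift t) ((x - t) *: 1) - G t).
  have cs : x - t @[x --> t] --> (0 : R).
    by rewrite -[X in _ --> X](subrr t); apply: cvgB; [exact: cvg_id|exact: cvg_cst].
  exact: cs _ H.
apply: filterS H' => x Hx xt; have x0 : x - t != 0 by rewrite subr_eq0 lt_eqF.
have := Hx x0; rewrite /= /GRing.scale/= mulr1 subrK.
by rewrite nmulr_rgt0 ?invr_lt0 ?subr_lt0// subr_lt0.
Qed.

(** A function whose derivative is positive at each of its zeros cannot come down through zero. *)
Lemma positive_crossing (G dG : R -> R) (a b : R) : a <= b ->
  (forall t, a <= t <= b -> is_derive t 1 G (dG t)) -> 0 < G a ->
  (forall t, a <= t <= b -> G t = 0 -> 0 < dG t) -> 0 < G b.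
Proof.
move=> ab dGP Ga H.
apply: (@interval_induction R (fun x y => 0 < G x -> 0 < G y) a b ab) => //.
  by move=> x y z _ _ _ _ xy yz /xy/yz.
move=> t ta tb; have tab : a <= t <= b by rewrite ta tb.
have dGt := dGP t tab.
have cG : {for t, continuous G}.
  by apply: differentiable_continuous; apply/derivable1_diffP; case: dGt.
(* The last clause uses the derivative: just before a zero the function is negative, so no positive
   value leads to it. *)
have loc : \forall x \near t, (0 < G t -> 0 < G x) /\ (G t < 0 -> G x < 0) /\ (G t = 0 -> x < t -> G x < 0).
  have [Gn|Gp|G0] := ltgtP (G t) 0.
  - by apply: filterS (cvgr_lt _ cG 0 Gn) => x Gx; split=> [//|]; split=> // E; rewrite E ltxx in Gn.
  - by apply: filterS (cvgr_gt _ cG 0 Gp) => x Gx; split=> //; split=> // E; rewrite E ltxx in Gp.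
  - apply: filterS (derive_gt0_left dGt (H t tab G0)) => x Gx; split => //; split => // _ /Gx.
    by rewrite G0.
have [e /= e0 He] := iffLR (nbhs_ballP _ _) loc.
exists e => // x y ax xt ty yb ex ey Gx.
have bx : ball t e x by rewrite /ball/= ger0_norm ?subr_ge0//; lra.
have by_ : ball t e y by rewrite /ball/= ler0_norm ?subr_le0//; lra.
have [px [nx zx]] := He _ bx; have [py [ny zy]] := He _ by_.
have [Gn|/py//|G0] := ltgtP (G t) 0.
  by have := nx Gn; rewrite ltNge ltW.
have [xt'|] := ltP x t; first by have := zx G0 xt'; rewrite ltNge ltW.
move=> tx; have E : x = t by apply/eqP; rewrite eq_le xt tx.
by rewrite E G0 ltxx in Gx.
Qed.

Lemma derivable_nondecreasing (A s : R -> R) (a b : R) :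
  (forall t, a <= t <= b -> is_derive t 1 A (s t)) -> (forall t, a <= t <= b -> 0 <= s t) ->
  forall x y, a <= x -> x <= y -> y <= b -> A x <= A y.
Proof.
move=> dA s0 x y ax xy yb.
have dA' t : t \in `[x, y] -> is_derive t 1 A (s t).
  by rewrite in_itv/= => /andP[xt ty]; apply: dA; rewrite (le_trans ax)//= (le_trans ty).
have H1 (t : R) : t \in `]x, y[ -> is_derive t 1 A (s t) by move=> /subset_itv_oo_cc; exact: dA'.
have H2 : {within `[x, y], continuous A}.
  by apply: derivable_within_continuous => t /dA'[].
have [z zxy E] := MVT_segment xy H1 H2.
rewrite -subr_ge0 E mulr_ge0 ?subr_ge0//; apply: s0.
by move: zxy; rewrite in_itv/= => /andP[xz zy]; rewrite (le_trans ax)//= (le_trans zy).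
Qed.

End Crossing.

Section SphereComparison.
Context {R : realType} {n : nat}.
Definition dot (u v : 'rV[R]_n) : R := (u *m v^T) 0 0.

Lemma dotC u v : dot u v = dot v u.
Proof. by rewrite /dot -[in LHS](trmxK (u *m v^T)) trmx_mul trmxK mxE. Qed.

Lemma dot_ge0 u : 0 <= dot u u.
Proof. by rewrite /dot mxE sumr_ge0// => i _; rewrite mxE -expr2 sqr_ge0. Qed.

Lemma dot_eq0 u : dot u u = 0 -> u = 0.
Proof.
move=> /eqP; rewrite /dot mxE psumr_eq0 => [/allP H|i _]; last by rewrite mxE -expr2 sqr_ge0.
apply/rowP => i; have := H i (mem_index_enum i).
by rewrite !mxE -expr2 sqrf_eq0 => /eqP.
Qed.

Lemma dotDl u v w : dot (u + v) w = dot u w + dot v w.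
Proof. by rewrite /dot mulmxDl mxE. Qed.

Lemma dotZl a u v : dot (a *: u) v = a * dot u v.
Proof. by rewrite /dot -scalemxAl mxE. Qed.

Lemma dotDr u v w : dot u (v + w) = dot u v + dot u w.
Proof. by rewrite !(dotC u) dotDl. Qed.

Lemma dotZr a u v : dot u (a *: v) = a * dot u v.
Proof. by rewrite !(dotC u) dotZl. Qed.

Lemma cauchy_schwarz u v : dot u v ^+ 2 <= dot u u * dot v v.
Proof.
have [->|v0] := eqVneq v 0; first by rewrite /dot trmx0 !mulmx0 mxE expr2 !mulr0.
have vv : 0 < dot v v by rewrite lt_neqAle dot_ge0 andbT eq_sym; apply: contra_neq v0 => /dot_eq0.
have := dot_ge0 (dot v v *: u + - dot u v *: v).
rewrite !(dotDl, dotDr, dotZl, dotZr) (dotC v u).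
move: (dot u u) (dot v v) (dot u v) vv => A B C B0.
have -> : B * (B * A + - C * C) + (B * (- C * C) + - C * (- C * B)) = B * (A * B - C ^+ 2) by ring.
by rewrite pmulr_rge0// subr_ge0.
Qed.

Lemma is_derive_dot (c d : R -> 'rV[R]_n) (dc dd : 'rV[R]_n) (t : R) :
  is_derive t 1 c dc -> is_derive t 1 d dd ->
  is_derive t 1 (fun t => dot (c t) (d t)) (dot dc (d t) + dot (c t) dd).
Proof.
move=> [dc1 <-] [dd1 <-].
have dT : derivable (fun t => (d t)^T) t 1 by exact: derivable_trmx.
have dM := derivable_mulmx dc1 dT.
have E := derive_mulmx dc1 dT.
rewrite /dot; apply: DeriveDef.
  by move/derivable_mxP: dM; exact.
rewrite -(derive_entry 0 0 dM) E mxE; congr (_ + _).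
by rewrite derive_trmx.
Qed.

Section Comparison.
Variables (c dc : R -> 'rV[R]_n) (A s : R -> R) (p : 'rV[R]_n) (a b : R).
Hypothesis ab : a <= b.
Hypothesis cP : forall t, a <= t <= b -> is_derive t 1 c (dc t).
Hypothesis c1 : forall t, dot (c t) (c t) = 1.
Hypothesis p1 : dot p p = 1.
Hypothesis AP : forall t, a <= t <= b -> is_derive t 1 A (s t).
Hypothesis s0 : forall t, a <= t <= b -> 0 <= s t.
Hypothesis dcs : forall t, a <= t <= b -> dot (dc t) (dc t) <= s t ^+ 2.

Let c_dc t : a <= t <= b -> dot (c t) (dc t) = 0.
Proof.
move=> /cP dct; have [_] := is_derive_dot dct dct.
under eq_fun do rewrite c1.
rewrite derive_cst (dotC (dc t)); lra.
Qed.

(** The velocity is orthogonal to [c t], so only the component [w] of [p] orthogonal to [c t]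
    matters; then Cauchy-Schwarz. *)
Let dot_derivative t : a <= t <= b ->
  dot p (dc t) ^+ 2 <= (1 - dot p (c t) ^+ 2) * s t ^+ 2.
Proof.
move=> tab; pose w := p + - dot p (c t) *: c t.
have ww : dot w w = 1 - dot p (c t) ^+ 2.
  rewrite /w dotDl dotZl !(dotC _ (_ + _)) !dotDl !dotZl (dotC (c t) p) c1 p1; ring.
have <- : dot w (dc t) = dot p (dc t) by rewrite /w dotDl dotZl c_dc// mulr0 addr0.
rewrite (le_trans (cauchy_schwarz _ _))// ww ler_wpM2l//; last exact: dcs.
by rewrite -ww dot_ge0.
Qed.

(** The angle [T] runs at speed [s + e] and starts [e] ahead. Where the cosine touches the product,
    the product falls at rate at most [s sin T], the cosine at [(s + e) sin T], so contact is never
    a downward crossing. *)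
Let strict_comparison (th e : R) : 0 <= th -> 0 < e ->
  th + (A b - A a) + e * (1 + b - a) < pi -> cos th <= dot p (c a) ->
  cos (th + (A b - A a) + e * (1 + b - a)) < dot p (c b).
Proof.
move=> th0 e0 thpi ca.
pose T t := th + (A t - A a) + e * (1 + t - a).
have Amon := derivable_nondecreasing AP s0.
have T0 t : a <= t <= b -> 0 < T t < pi.
  move=> /andP[ta tb]; have := Amon _ _ (lexx a) ta tb; have := Amon _ _ ta tb (lexx b).
  rewrite /T => H1 H2.
  have e1 : 0 < e * (1 + t - a) by rewrite mulr_gt0//; lra.
  have e2 : e * (1 + t - a) <= e * (1 + b - a) by rewrite ler_wpM2l//; lra.
  by apply/andP; split; lra.
have TP t : a <= t <= b -> is_derive t 1 T (s t + e).
  move=> /AP AP'; rewrite /T; apply: is_derive_eq.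
  by rewrite /GRing.scale/=; ring.
pose G t := dot p (c t) - cos (T t).
rewrite -subr_gt0 -/(T b) -/(G b).
apply: (@positive_crossing R G (fun t => dot p (dc t) - (- sin (T t)) * (s t + e)) a b ab).
- move=> t tab; have := is_derive_dot (is_derive_cst p t 1) (cP tab).
  have -> : dot 0 (c t) = 0 by rewrite /dot mul0mx mxE.
  rewrite add0r => d1.
  have d2 := is_derive1_comp (is_derive_cos (T t)) (TP t tab).
  exact: is_deriveB d1 d2.
- rewrite subr_gt0 (lt_le_trans _ ca)// /T subrr addr0 addrK mulr1 ltr_cos ?in_itv/=.
  + lra.
  + by have := T0 a; rewrite lexx ab => /(_ isT); rewrite /T subrr addr0 addrK mulr1 => /andP[? ?]; lra.
  + by have := T0 a; rewrite lexx ab => /(_ isT); rewrite /T subrr addr0 addrK mulr1 => /andP[? ?]; lra.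
move=> t tab /eqP; rewrite subr_eq0 => /eqP E.
have /andP[Tt0 Ttpi] := T0 t tab; have sT : 0 < sin (T t) by apply: sin_gt0_pi; rewrite Tt0.
have := dot_derivative tab; rewrite E -sin2cos2 -exprMn => H.
have st := s0 tab; have y0 : 0 <= sin (T t) * s t by rewrite mulr_ge0// ltW.
have : - (sin (T t) * s t) <= dot p (dc t).
  rewrite leNgt; apply/negP => Hn; move: H; rewrite !expr2; nra.
have : 0 < e * sin (T t) by rewrite mulr_gt0.
by move: (sin _) (s t) (dot _ _) => x y z; nra.
Qed.

Lemma sphere_comparison th : 0 <= th -> th + (A b - A a) < pi ->
  cos th <= dot p (c a) -> cos (th + (A b - A a)) <= dot p (c b).
Proof.
move=> th0 thpi ca; rewrite leNgt; apply/negP => Hc.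
pose X := th + (A b - A a); pose h e := X + e * (1 + b - a) : R.
have ch : h e @[e --> (0 : R)] --> X.
  have H : h e @[e --> (0 : R)] --> X + 0 * (1 + b - a).
    by apply: cvgD; [exact: cvg_cst|apply: cvgMl; exact: cvg_id].
  by rewrite mul0r addr0 in H.
have cc : cos (h e) @[e --> (0 : R)] --> cos X.
  by apply: cvg_comp ch _; exact: continuous_cos.
have H1 := cvgr_gt _ cc _ Hc; have H2 := cvgr_lt _ ch _ thpi.
have [e [He1 He2 e0]] : exists e : R, [/\ dot p (c b) < cos (h e), h e < pi & 0 < e].
  apply: (@filter_ex _ ((0 : R)^'+)); near=> e; split.
  - by near: e; apply: cvg_within; exact: H1.
  - by near: e; apply: cvg_within; exact: H2.
  - by near: e; exact: nbhs_right_gt.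
have := strict_comparison th0 e0 He2 ca.
by rewrite ltNge (ltW He1).
Unshelve. all: by end_near.
Qed.

End Comparison.

End SphereComparison.

(** * Lengths of curves and balls in the sphere *)

Section RoundSphere.
Context {R : realType} {n : nat}.
Variables (k : R) (M : riemannianManifold R n) (iota : M -> 'rV[R]_n.+1).
Hypothesis k0 : 0 < k.
Hypothesis sph : forall p, euclidean_sphere k (iota p).
Hypothesis isom : forall p, let F := iota \o chart_inv (chart_at p) in
  smooth_on (chart_img (chart_at p)) F /\
  (forall x, chart_img (chart_at p) x -> 'J F x *m ('J F x)^T = metric p x).

Local Notation to p := (chart_to (chart_at p)).
Local Notation inv p := (chart_inv (chart_at p)).
Local Notation dom p := (chart_dom (chart_at p)).
Local Notation img p := (chart_img (chart_at p)).
Local Notation F p := (iota \o inv p).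

Let sk : Num.sqrt k ^+ 2 = k. Proof. by rewrite sqr_sqrtr// ltW. Qed.
Let sk0 : 0 < Num.sqrt k. Proof. by rewrite sqrtr_gt0. Qed.

Lemma dot_iota p : dot (Num.sqrt k *: iota p) (Num.sqrt k *: iota p) = 1.
Proof.
rewrite dotZl dotZr mulrA -expr2 sk.
by have := sph p; rewrite /euclidean_sphere/= -/(dot _ _) => ->; rewrite mulfV// gt_eqF.
Qed.

Section Curve.
Variables (gamma : R -> M) (t : R).
Let u := to (gamma t) \o gamma.
Hypothesis cg : {for t, continuous gamma}.
Hypothesis du : \forall s \near t, derivable u s 1.
Hypothesis cdu : {for t, continuous (derive1 u)}.

Let near_gamma : \forall s \near t, dom (gamma t) (gamma s).
Proof. exact: (cg : gamma s @[s --> t] --> gamma t) _ (near_dom (chart_at_dom (gamma t))). Qed.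

Let dF s : dom (gamma t) (gamma s) -> differentiable (F (gamma t)) (u s).
Proof.
move=> ds; have [sF _] := isom (gamma t).
by apply: (C1_differentiable (smooth_C1 sF)); exists (gamma s).
Qed.

Lemma derive_iota_curve : \forall s \near t, derivable (iota \o gamma) s 1 /\
  'D_1 (iota \o gamma) s = derive1 u s *m 'J (F (gamma t)) (u s).
Proof.
apply: filterS2 (nbhs_interior near_gamma) du => s ns dus.
have E : \forall z \near s, (F (gamma t) \o u) z = (iota \o gamma) z.
  by apply: filterS ns => z dz; rewrite /= /u/= chart_atK.
have dsu : differentiable u s by exact/derivable1_diffP.
have dFs := dF (nbhs_singleton ns).
have dFu : differentiable (F (gamma t) \o u) s by exact: differentiable_comp.
split; first by apply/derivable1_diffP; exact: near_eq_differentiable E dFu.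
have E1 : 'D_1 (F (gamma t) \o u) s = 'D_1 (iota \o gamma) s by exact: near_eq_derive.
refine (etrans (esym E1) (etrans (@derive_comp R _ _ _ u (F (gamma t)) s (1 : R) dsu dFs) (etrans (deriveEjacobian _ dFs) _))).
by rewrite derive1E.
Qed.

Lemma speed_iota : dot ('D_1 (iota \o gamma) t) ('D_1 (iota \o gamma) t) = speed gamma t ^+ 2.
Proof.
have [_ ->] := nbhs_singleton derive_iota_curve.
have [_ gE] := isom (gamma t); have cp := chart_coord_img (gamma t).
have E : dot (derive1 u t *m 'J (F (gamma t)) (u t)) (derive1 u t *m 'J (F (gamma t)) (u t)) =
    inner (metric (gamma t) (chart_coord (gamma t))) (derive1 u t) (derive1 u t).
  by rewrite /dot /inner -gE// trmx_mul !mulmxA.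
by rewrite /speed -/u sqr_sqrtr -E// dot_ge0.
Qed.

Lemma continuous_derive_iota : {for t, continuous ('D_1 (iota \o gamma))}.
Proof.
have E : \forall s \near t, derive1 u s *m 'J (F (gamma t)) (u s) = 'D_1 (iota \o gamma) s.
  by apply: filterS derive_iota_curve => s [_ ->].
rewrite /prop_for/= /continuous_at -(nbhs_singleton E).
apply: cvg_trans (near_eq_cvg E) _.
have cu : {for t, continuous u}.
  by apply: differentiable_continuous; apply/derivable1_diffP; exact: nbhs_singleton du.
have [sF _] := isom (gamma t); have cp := chart_coord_img (gamma t).
have oU := @chart_img_open _ _ _ (chart_at (gamma t)).
have dJ := C1_differentiable (C1_jacobian oU sF) cp.
have cJ : {for t, continuous (fun s => 'J (F (gamma t)) (u s))}.
  apply: (@continuous_comp _ _ _ u (fun x => 'J (F (gamma t)) x)); first exact: cu.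
  exact: differentiable_continuous dJ.
exact: (continuous_mulmx cdu cJ).
Qed.

End Curve.

Section Length.
Variables (gamma : R -> M) (a b : R).
Hypothesis ab : a <= b.
Hypothesis C1g : C1_curve gamma a b.

Let c (t : R) := Num.sqrt k *: iota (gamma t).
Let v (t : R) := Num.sqrt (dot ('D_1 (iota \o gamma) t) ('D_1 (iota \o gamma) t)).

Let vE t : t \in `[a, b] -> speed gamma t = v t.
Proof.
move=> /C1g[cg du cdu]; rewrite /v speed_iota// sqrtr_sqr ger0_norm//.
exact: sqrtr_ge0.
Qed.

Let cv t : t \in `[a, b] -> {for t, continuous v}.
Proof.
move=> /C1g[cg du cdu]; have cD := continuous_derive_iota cg du cdu.
apply: (@continuous_comp _ _ _ (fun t => dot ('D_1 (iota \o gamma) t) ('D_1 (iota \o gamma) t)) Num.sqrt).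
  have := continuous_mulmx cD (continuous_trmx cD).
  by move=> /continuous_mxP; exact.
exact: sqrt_continuous.
Qed.

(** [C1_curve] controls the speed at points of [[a, b]] only; this retraction extends it to a
    continuous function on the line. *)
Let project (t : R) := Num.max a (Num.min b t).

Let project_itv t : project t \in `[a, b].
Proof. by rewrite /project in_itv/= le_max lexx ge_max ab/= ge_min lexx. Qed.

Let project_id t : t \in `[a, b] -> project t = t.
Proof. by rewrite in_itv/= /project => /andP[ta tb]; rewrite min_r// max_r. Qed.

Let cproject : continuous project.
Proof.
move=> t; apply: (@continuous_max _ _ (cst a) (fun t => Num.min b t)); first exact: cst_continuous.
by apply: (@continuous_min _ _ (cst b) id); [exact: cst_continuous|exact: cvg_id].
Qed.

Lemma length_antiderivative : exists2 A : R -> R,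
  forall t, t \in `[a, b] -> is_derive t 1 A (speed gamma t) &
  curve_length gamma a b = (A b - A a)%:E.
Proof.
have cvp : continuous (v \o project).
  by move=> t; apply: continuous_comp; [exact: cproject|exact: cv].
have [A _ dA] := antiderivative a b cvp; exists A.
  by move=> t tab; rewrite vE// -[v t]/(v t) -{2}(project_id tab); exact: dA.
rewrite /curve_length.
have -> : (\int[lebesgue_measure]_(t in `[a, b]) (speed gamma t)%:E)%E =
    (\int[lebesgue_measure]_(t in `[a, b]) ((v \o project) t)%:E)%E.
  apply: eq_integral => t; rewrite inE/= => tab.
  by rewrite (vE tab) /comp (project_id tab).
(* Curves over a single point are allowed, while the fundamental theorem needs [a < b]. *)
have [ba|ltab] := leP b a.
  have -> : b = a by apply/eqP; rewrite eq_le ab ba.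
  by rewrite set_itv1 integral_set1 subrr.
apply: continuous_FTC2 => //.
- exact: continuous_subspaceT.
- split.
  + by move=> t /subset_itv_oo_cc /dA[].
  + apply: cvg_at_right_filter; apply: differentiable_continuous; apply/derivable1_diffP.
    by have [] := dA a; rewrite // in_itv/= lexx ab.
  + apply: cvg_at_left_filter; apply: differentiable_continuous; apply/derivable1_diffP.
    by have [] := dA b; rewrite // in_itv/= lexx ab.
- by move=> t /subset_itv_oo_cc /dA[_]; rewrite derive1E.
Qed.

Lemma curve_comparison (p : M) (th : R) : exists2 L : R,
  curve_length gamma a b = L%:E /\ 0 <= L &
  0 <= th -> th + Num.sqrt k * L < pi ->
    cos th <= dot (Num.sqrt k *: iota p) (c a) ->
    cos (th + Num.sqrt k * L) <= dot (Num.sqrt k *: iota p) (c b).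
Proof.
have [A dA LE] := length_antiderivative.
have dA' t : a <= t <= b -> is_derive t 1 A (speed gamma t) by move=> tab; apply: dA; rewrite in_itv.
have s0 t : a <= t <= b -> 0 <= speed gamma t by move=> _; exact: sqrtr_ge0.
exists (A b - A a).
  by rewrite subr_ge0; split => //; exact: (derivable_nondecreasing dA' s0).
rewrite mulrBr => th0 thpi ca.
apply: (@sphere_comparison R n.+1 c (fun t => Num.sqrt k *: 'D_1 (iota \o gamma) t)
  (fun t => Num.sqrt k * A t) (fun t => Num.sqrt k * speed gamma t)) => //.
- move=> t tab; have [cg du cdu] : _ := C1g (tab : t \in `[a, b]).
  have [dc _] := nbhs_singleton (derive_iota_curve cg du).
  exact: is_deriveZ (derivableP dc).
- by move=> t; exact: dot_iota.
- exact: dot_iota.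
- by move=> t /dA' AP; exact: is_deriveZ.
- by move=> t tab; rewrite mulr_ge0 ?s0// ltW.
- move=> t tab; have [cg du cdu] : _ := C1g (tab : t \in `[a, b]).
  by rewrite dotZl dotZr speed_iota// mulrA -expr2 exprMn.
Qed.

End Length.

(** The angle [th] already accumulated is kept general so that the estimate passes from one piece of
    the curve to the next. *)
Lemma joined_comparison (p q p0 : M) l : joined_by p q l ->
  (0 <= l)%E /\ forall th r, l = r%:E -> 0 <= th -> th + Num.sqrt k * r < pi ->
    cos th <= dot (Num.sqrt k *: iota p0) (Num.sqrt k *: iota p) ->
    cos (th + Num.sqrt k * r) <= dot (Num.sqrt k *: iota p0) (Num.sqrt k *: iota q).
Proof.
elim=> [{}p|gamma a b {}q {}l ab C1g _ [l0 IH]].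
  by split => // th r [<-] _ _; rewrite mulr0 addr0.
split.
  have [L [-> L0] _] := curve_comparison ab C1g p0 0.
  by rewrite adde_ge0// lee_fin.
move=> th r E th0 thpi ca; have [L [LE L0] H] := curve_comparison ab C1g p0 th.
move: E; rewrite LE; case: l l0 IH => [l| |] // l0 IH [rE].
rewrite lee_fin in l0; have kl : 0 <= Num.sqrt k * l by rewrite mulr_ge0// ltW.
have kL : 0 <= Num.sqrt k * L by rewrite mulr_ge0// ltW.
rewrite -rE mulrDr addrA in thpi *.
apply: IH => //; first lra.
by apply: H => //; lra.
Qed.

Lemma ball_dot (p q : M) (r : R) : (riemannian_dist p q < r%:E)%E ->
  r <= pi / 2 / Num.sqrt k -> 0 < dot (iota p) (iota q).
Proof.
move=> /ereal_inf_lt[l /= pq lr] rpi.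
have [l0 H] := joined_comparison p pq.
case: l l0 lr pq H => [l| |] // l0 lr pq H.
rewrite lte_fin in lr; rewrite lee_fin in l0.
have pi2 := pi_gt0 R.
have kl : Num.sqrt k * l < pi / 2.
  rewrite mulrC -ltr_pdivlMr//; exact: lt_le_trans lr rpi.
have kl0 : 0 <= Num.sqrt k * l by rewrite mulr_ge0// ltW.
have := H 0 l erefl (lexx 0); rewrite add0r cos0 dot_iota => /(_ _ _)/lt_le_trans H'.
have : 0 < dot (Num.sqrt k *: iota p) (Num.sqrt k *: iota q).
  apply: H' => //; last lra.
  by apply: cos_gt0_pihalf; apply/andP; split; lra.
by rewrite dotZl dotZr !pmulr_rgt0.
Qed.

End RoundSphere.

(** * Great circles *)

Section InverseDerivative.
Context {R : realType}.

Lemma is_derive_bound (V : normedModType R) (u : R -> V) (t : R) (w : V) :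
  (forall e : R, 0 < e -> \forall h \near (0 : R), `|u (h + t) - u t - h *: w| <= e * `|h|) ->
  is_derive t 1 u w.
Proof.
move=> H.
have C : h^-1 *: ((u \o shift t) (h *: 1) - u t) @[h --> (0 : R)^'] --> w.
  apply/cvgrPdist_le => e e0; rewrite near_withinE; apply: filterS (H e e0) => h Hh h0.
  rewrite /= /GRing.scale/= mulr1 -[w](scalerK h0) -scalerBr normrZ normrV ?unitfE//.
  by rewrite distrC ler_pdivrMl ?normr_gt0// mulrC.
by split; [exact: cvgP C|exact: cvg_lim C].
Qed.

Lemma is_derive_scale_vector (V : normedModType R) (f : R -> R) (t d : R) (y : V) :
  is_derive t 1 f d -> is_derive t 1 (fun s => f s *: y) (d *: y).
Proof.
move=> [df <-].
have C : h^-1 *: (((fun s => f s *: y) \o shift t) (h *: 1) - f t *: y) @[h --> (0 : R)^'] --> 'D_1 f t *: y.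
  have -> : (fun h : R => h^-1 *: (((fun s => f s *: y) \o shift t) (h *: 1) - f t *: y)) =
      (fun h => (h^-1 *: ((f \o shift t) (h *: 1) - f t)) *: y).
    by apply/funext => h; rewrite [in RHS]/GRing.scale/= -[RHS]scalerA scalerBl.
  by apply: cvgZr_tmp; exact: df.
by split; [exact: cvgP C|exact: cvg_lim C].
Qed.

(** Recovers the derivative of a merely continuous [u] from that of its image under an immersion:
    [L] inverts the Jacobian, first giving a Lipschitz bound on [u] and then the derivative. *)
Lemma derivable_inverse n m (u : R -> 'rV[R]_n) (F : 'rV[R]_n -> 'rV[R]_m)
    (L : 'M[R]_(m, n)) (t : R) (w : 'rV[R]_m) :
  {for t, continuous u} -> differentiable F (u t) -> 'J F (u t) *m L = 1%:M ->
  is_derive t 1 (F \o u) w -> is_derive t 1 u (w *m L).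
Proof.
move=> cu dF JL [dc cw]; apply: is_derive_bound => e e0.
pose B := m%:R * `|L| + 1; pose K := 2 * (`|w *m L| + 1).
have B0 : 0 < B by rewrite ltr_wpDl// mulr_ge0.
have K0 : 0 < K by rewrite mulr_gt0// ltr_wpDl.
(* The first bound lets the increment of [u] on the right be absorbed, which gives [N2]; the second
   turns the resulting error into [e]. *)
pose d := Num.min (2^-1 / B) (e / (B * (1 + K))).
have d0 : 0 < d by rewrite lt_min !divr_gt0// mulr_gt0// addr_gt0.
have dB : d * B <= 2^-1 by rewrite -ler_pdivlMr// ge_min lexx.
have BK : 0 < B * (1 + K) by rewrite mulr_gt0// addr_gt0.
have de : d * (B * (1 + K)) <= e by rewrite -ler_pdivlMr// ge_min lexx orbT.
have dcf : differentiable (F \o u) t by exact/derivable1_diffP.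
have H1 := differentiable_bound dcf d0; have H2 := differentiable_bound dF d0.
have cs : u (h + t) - u t @[h --> (0 : R)] --> (0 : 'rV[R]_n).
  rewrite -[X in _ --> X](subrr (u t)); apply: cvgB; last exact: cvg_cst.
  have ch : h + t @[h --> (0 : R)] --> t.
    by rewrite -[X in _ --> X]add0r; apply: cvgD; [exact: cvg_id|exact: cvg_cst].
  exact: cvg_comp ch cu.
have H2' : \forall h \near (0 : R), `|F (u (h + t) - u t + u t) - F (u t) - 'd F (u t) (u (h + t) - u t)| <=
    d * `|u (h + t) - u t| := cs _ H2.
apply: filterS2 H1 H2' => h; rewrite subrK.
have -> : 'd (F \o u) t h = h *: w.
  by rewrite -[h in LHS]mulr1 -[h * 1]/(h *: (1 : R)) linearZ/= -deriveE// cw.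
have -> : 'd F (u t) (u (h + t) - u t) = (u (h + t) - u t) *m 'J F (u t).
  by rewrite -deriveE// deriveEjacobian.
rewrite /comp; move: (u (h + t) - u t) (F (u (h + t)) - F (u t)) => D C Hs Hr.
have DE : D - h *: (w *m L) = (C - h *: w - (C - D *m 'J F (u t))) *m L.
  have -> : C - h *: w - (C - D *m 'J F (u t)) = D *m 'J F (u t) - h *: w.
    by rewrite opprB addrC addrA subrK.
  by rewrite mulmxBl -mulmxA JL mulmx1 -scalemxAl.
have N1 : `|D - h *: (w *m L)| <= B * (d * `|h| + d * `|D|).
  rewrite DE (le_trans (mx_norm_mul _ _))//.
  rewrite mulrCA mulrC; apply: ler_pM; [by rewrite mulr_ge0|by []|by rewrite lerDl|].
  by rewrite (le_trans (ler_normB _ _))// lerD.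
have N2 : `|D| <= K * `|h|.
  have : `|D| <= `|D - h *: (w *m L)| + `|h| * `|w *m L|.
    by rewrite -normrZ -{1}[D](subrK (h *: (w *m L))) ler_normD.
  have : B * (d * `|h| + d * `|D|) <= 2^-1 * (`|h| + `|D|).
    by rewrite -mulrDr mulrA [B * d]mulrC ler_wpM2r// addr_ge0.
  have h0 : 0 <= `|h| by [].
  move=> le1 le2; have := le_trans le2 (lerD (le_trans N1 le1) (lexx _)).
  rewrite /K; move: (`|h|) (`|w *m L|) (`|D|) h0 => x y z; lra.
rewrite (le_trans N1)// -mulrDr.
have : d * (`|h| + `|D|) <= d * ((1 + K) * `|h|).
  by rewrite ler_wpM2l ?(ltW d0)// mulrDl mul1r lerD2l.
move=> /(ler_wpM2l (ltW B0))/le_trans; apply.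
have -> : B * (d * ((1 + K) * `|h|)) = d * (B * (1 + K)) * `|h| by ring.
by rewrite ler_wpM2r.
Qed.

End InverseDerivative.

Section GreatCircle.
Context {R : realType}.

Lemma orthogonal_unit n (y : 'rV[R]_n.+2) : exists e : 'rV[R]_n.+2, dot e e = 1 /\ dot y e = 0.
Proof.
have K0 : kermx y^T != 0.
  rewrite -mxrank_eq0 mxrank_ker -lt0n subn_gt0.
  by rewrite (leq_ltn_trans (rank_leq_col _)).
have /rowV0Pn[v vK v0] := K0.
have vv : 0 < dot v v by rewrite lt_neqAle dot_ge0 andbT eq_sym; apply: contra_neq v0 => /dot_eq0.
exists ((Num.sqrt (dot v v))^-1 *: v); split.
  by rewrite dotZl dotZr mulrA -expr2 exprVn sqr_sqrtr ?ltW// mulVf// gt_eqF.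
rewrite dotZr; have -> : dot y v = 0; last by rewrite mulr0.
by rewrite dotC /dot (sub_kermxP vK) mxE.
Qed.

Lemma great_circle n (y z : 'rV[R]_n.+2) : dot y y = 1 -> dot z z = 1 ->
  exists e th, [/\ dot e e = 1, dot y e = 0, 0 <= th <= pi & z = cos th *: y + sin th *: e].
Proof.
move=> y1 z1; pose x := dot y z; pose w := z + - x *: y.
have x1 : -1 <= x <= 1.
  have := cauchy_schwarz y z; rewrite y1 z1 mulr1 -/x => x2.
  by rewrite -ler_norml -(@ler_pXn2r _ 2)// ?nnegrE// real_normK ?num_real// expr1n.
have ww : dot w w = 1 - x ^+ 2.
  rewrite /w !(dotDl, dotDr, dotZl, dotZr) y1 z1 (dotC z) -/x; ring.
have yw : dot y w = 0 by rewrite /w dotDr dotZr y1 -/x mulr1 subrr.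
have th : 0 <= acos x <= pi by have [] := acos_def x1.
have [e [e1 ye ew]] : exists e, [/\ dot e e = 1, dot y e = 0 & Num.sqrt (dot w w) *: e = w].
  (* For equal or antipodal points, any unit vector orthogonal to [y] serves. *)
  have [w0|w0] := eqVneq w 0.
    have [e [e1 ye]] := orthogonal_unit y; exists e; split => //.
    by rewrite w0 /dot mul0mx mxE sqrtr0 scale0r.
  have w2 : 0 < dot w w by rewrite lt_neqAle dot_ge0 andbT eq_sym; apply: contra_neq w0 => /dot_eq0.
  exists ((Num.sqrt (dot w w))^-1 *: w); split.
  - by rewrite dotZl dotZr mulrA -expr2 exprVn sqr_sqrtr ?ltW// mulVf// gt_eqF.
  - by rewrite dotZr yw mulr0.
  - by rewrite scalerA mulfV ?scale1r// gt_eqF// sqrtr_gt0.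
exists e, (acos x); split => //.
by rewrite sin_acos// -ww ew acosK ?in_itv//= /w addrC scaleNr subrK.
Qed.

End GreatCircle.

Section Diameter.
Context {R : realType} {n : nat}.
Variables (k : R) (M : riemannianManifold R n.+1).
Variables (iota : M -> 'rV[R]_n.+2) (kappa : 'rV[R]_n.+2 -> M).
Hypothesis k0 : 0 < k.
Hypothesis sph : forall p, euclidean_sphere k (iota p).
Hypothesis ckappa : {within euclidean_sphere k, continuous kappa}.
Hypothesis iotaK : cancel iota kappa.
Hypothesis kappaK : forall y, euclidean_sphere k y -> iota (kappa y) = y.
Hypothesis isom : forall p, let F := iota \o chart_inv (chart_at p) in
  smooth_on (chart_img (chart_at p)) F /\
  (forall x, chart_img (chart_at p) x -> 'J F x *m ('J F x)^T = metric p x).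

Local Notation to p := (chart_to (chart_at p)).
Local Notation inv p := (chart_inv (chart_at p)).
Local Notation dom p := (chart_dom (chart_at p)).
Local Notation F p := (iota \o inv p).

Let sk : Num.sqrt k ^+ 2 = k. Proof. by rewrite sqr_sqrtr// ltW. Qed.
Let sk0 : 0 < Num.sqrt k. Proof. by rewrite sqrtr_gt0. Qed.

Section Circle.
Variables (y e : 'rV[R]_n.+2).
Hypotheses (y1 : dot y y = 1) (e1 : dot e e = 1) (ye : dot y e = 0).

Let c (t : R) := (Num.sqrt k)^-1 *: (cos t *: y + sin t *: e).
Let dc (t : R) := (Num.sqrt k)^-1 *: (- sin t *: y + cos t *: e).
Let gamma t := kappa (c t).

Let dot_circle (a b : R) : dot (a *: y + b *: e) (a *: y + b *: e) = a ^+ 2 + b ^+ 2.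
Proof. rewrite !(dotDl, dotDr, dotZl, dotZr) y1 e1 (dotC e) ye; ring. Qed.

Let c_sphere t : euclidean_sphere k (c t).
Proof.
rewrite /euclidean_sphere/= -/(dot _ _) /c dotZl dotZr dot_circle cos2Dsin2 mulr1.
by rewrite -expr2 exprVn sk.
Qed.

Let iota_gamma t : iota (gamma t) = c t.
Proof. exact: kappaK. Qed.

Let is_derive_c (t : R) : is_derive t 1 c (dc t).
Proof.
rewrite /c /dc; apply: is_deriveZ; apply: is_deriveD.
  exact: is_derive_scale_vector.
exact: is_derive_scale_vector.
Qed.

Let cdc : continuous dc.
Proof.
move=> t; apply: (cvgZ (cvg_cst _)); apply: cvgD; apply: cvgZr_tmp.
  by apply: cvgN; exact: continuous_sin.
exact: continuous_cos.
Qed.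

Let cc : continuous c.
Proof.
move=> t; apply: differentiable_continuous; apply/derivable1_diffP.
by have [] := is_derive_c t.
Qed.

Let cgamma : continuous gamma.
Proof.
move=> t U nU; have := within_cont_on ckappa (c_sphere t) nU => H.
have H' : \forall s \near t, euclidean_sphere k (c s) -> U (kappa (c s)).
  exact: (cc (x := t) : c s @[s --> t] --> c t) _ H.
by apply: filterS H' => s /= Hs; exact: Hs (c_sphere s).
Qed.

(** Since [J J^T] is the metric, [J^T] times its inverse is a right inverse of the Jacobian, as
    [derivable_inverse] requires. *)
Let chart_curve (t : R) : \forall s \near t, is_derive (s : R) 1 (to (gamma t) \o gamma)
  (dc s *m (('J (F (gamma t)) (to (gamma t) (gamma s)))^T
      *m invmx (metric (gamma t) (to (gamma t) (gamma s))))).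
Proof.
set p := gamma t.
have nd : \forall s \near t, dom p (gamma s) := cgamma (near_dom (chart_at_dom p)).
apply: filterS (nbhs_interior nd) => s ns; have ds := nbhs_singleton ns.
have [sF gE] := isom p.
have ix : chart_img (chart_at p) (to p (gamma s)) by exists (gamma s).
apply: (@derivable_inverse R _ _ (to p \o gamma) (F p)).
- by apply: continuous_comp; [exact: cgamma|exact: chart_to_continuous ds].
- exact: C1_differentiable (smooth_C1 sF) ix.
- by rewrite mulmxA gE// mulmxV// metric_unit.
have E : \forall z \near s, c z = (F p \o (to p \o gamma)) z.
  by apply: filterS ns => z dz; rewrite /= chart_atK// iota_gamma.
have [dcs vcs] := is_derive_c s.
split.
  by apply/derivable1_diffP; apply: near_eq_differentiable E _; exact/derivable1_diffP.
by rewrite -vcs; apply/esym; exact: near_eq_derive.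
Qed.

Lemma great_circle_C1 a b : C1_curve gamma a b.
Proof.
move=> t _ /=; have H := chart_curve t; set u := to _ \o gamma in H *.
have cu : {for t, continuous u}.
  by apply: differentiable_continuous; apply/derivable1_diffP; have [] := nbhs_singleton H.
split; first exact: cgamma.
  by apply: filterS H => s [].
have E : \forall s \near t, dc s *m (('J (F (gamma t)) (u s))^T
      *m invmx (metric (gamma t) (u s))) = derive1 u s.
  by apply: filterS H => s [_]; rewrite derive1E => ->.
rewrite /prop_for/= /continuous_at -(nbhs_singleton E).
apply: cvg_trans (near_eq_cvg E) _.
have [sF _] := isom (gamma t); have cp := chart_coord_img (gamma t).
have oU := @chart_img_open _ _ _ (chart_at (gamma t)).
have dJ := C1_differentiable (C1_jacobian oU sF) cp.
have dg := C1_differentiable (smooth_C1 (metric_smooth (gamma t))) cp.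
have cJ : {for t, continuous (fun s => 'J (F (gamma t)) (u s))}.
  apply: (@continuous_comp _ _ _ u (fun x => 'J (F (gamma t)) x)); first exact: cu.
  exact: differentiable_continuous dJ.
have cg : {for t, continuous (fun s => metric (gamma t) (u s))}.
  apply: (@continuous_comp _ _ _ u (metric (gamma t))); first exact: cu.
  exact: differentiable_continuous dg.
have cgi := continuous_invmx cg (metric_unit cp).
exact: (continuous_mulmx (cdc (x := t)) (continuous_mulmx (continuous_trmx cJ) cgi)).
Qed.

Lemma great_circle_speed t : speed gamma t = (Num.sqrt k)^-1.
Proof.
have [cg du cdu] : _ := great_circle_C1 (a := t) (b := t) (t := t) ltac:(by rewrite in_itv/= lexx).
apply/eqP; rewrite -(@eqrXn2 _ 2)//; last exact: sqrtr_ge0.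
apply/eqP; rewrite -(speed_iota isom cg du).
have -> : iota \o gamma = c by apply/funext => s; exact: iota_gamma.
have [_ ->] := is_derive_c t.
by rewrite /dc dotZl dotZr dot_circle sqrrN addrC cos2Dsin2 mulr1 expr2.
Qed.

Lemma great_circle_length th : 0 <= th -> curve_length gamma 0 th = (th / Num.sqrt k)%:E.
Proof.
move=> th0; rewrite /curve_length.
under eq_integral do rewrite great_circle_speed.
rewrite integral_cst//= lebesgue_measure_itv/= lte_fin.
have [t0|t0] := ltP; first by rewrite oppr0 adde0 -EFinM mulrC.
have -> : th = 0 by apply/eqP; rewrite eq_le t0 th0.
by rewrite mule0 mul0r.
Qed.

End Circle.

Lemma dist_le (p q : M) : (riemannian_dist p q <= (pi / Num.sqrt k)%:E)%E.
Proof.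
have [e [th [e1 ye /andP[th0 thpi] E]]] := great_circle (dot_iota k0 sph p) (dot_iota k0 sph q).
set y := Num.sqrt k *: iota p in e1 ye E.
pose gamma t := kappa ((Num.sqrt k)^-1 *: (cos t *: y + sin t *: e)).
have g0 : gamma 0 = p.
  by rewrite /gamma cos0 sin0 scale1r scale0r addr0 scalerA mulVf ?gt_eqF// scale1r iotaK.
have g1 : gamma th = q.
  by rewrite /gamma -E scalerA mulVf ?gt_eqF// scale1r iotaK.
have y1 : dot y y = 1 by exact: dot_iota.
have J : joined_by p q (curve_length gamma 0 th + 0)%E.
  rewrite -{1}g0; apply: joined_cons => //; first exact: great_circle_C1.
  by rewrite g1; exact: joined_refl.
rewrite (le_trans (ereal_inf_lbound J))// adde0 great_circle_length// lee_fin.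
by rewrite ler_wpM2r// invr_ge0 ltW.
Qed.

Lemma diameter_le : (diameter M <= (pi / Num.sqrt k)%:E)%E.
Proof. by apply: ub_ereal_sup => _ [p [q ->]]; exact: dist_le. Qed.

End Diameter.

Lemma no_minimal_hemisphere (R : realType) (n : nat) (k : R) (M : riemannianManifold R n) :
  0 < k -> is_round_sphere k M ->
  ~ (exists (m : nat) (N : smoothManifold R m) (f : N -> M) (p : M),
      compact_minimal_submanifold f /\
      range f `<=` open_geodesic_ball p ((2^-1)%:E * diameter M)%E).
Proof.
move=> k0 [iota [kappa [[ciota sph] ckappa [iotaK kappaK] isom]]] [m [N [f [p [minf fball]]]]].
(* Great circles need a unit vector orthogonal to a given one, hence positive dimension; dimension
   zero is excluded by [0 < m < n]. *)
case: n M iota kappa ciota sph ckappa iotaK kappaK isom f p minf fball => [|n] M iota kappa ciota sph ckappa iotaK kappaK isom f p minf fball.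
  by have [[[/andP[_]]]] := minf.
have H := sphere_hessian (iota p) k0 sph isom.
have [q qmax] := compact_maximum minf (hessian_continuous H).
have := minimal_maximum minf (H (f q)) qmax; apply/negP; rewrite -ltNge mulr_gt0//.
have diam := diameter_le k0 sph ckappa iotaK kappaK isom.
apply: (ball_dot k0 sph isom (r := pi / 2 / Num.sqrt k)) => //.
have : open_geodesic_ball p ((2^-1)%:E * diameter M)%E (f q) by apply: fball; exists q.
move=> /lt_le_trans; apply.
have -> : pi / 2 / Num.sqrt k = 2^-1 * (pi / Num.sqrt k) by ring.
by rewrite EFinM; apply: lee_wpmul2l => //; rewrite lee_fin.
Qed.

Theorem corollary9 (R : realType) :
  (forall (n : nat) (M : riemannianManifold R n) (k : R),
     simply_connected R M -> constant_sectional_curvature M k -> k <= 0 ->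
     ~ (exists (m : nat) (N : smoothManifold R m) (f : N -> M),
          compact_minimal_submanifold f))
  /\
  (forall (n : nat) (k : R) (M : riemannianManifold R n),
     0 < k -> is_round_sphere k M ->
     ~ (exists (m : nat) (N : smoothManifold R m) (f : N -> M) (p : M),
          compact_minimal_submanifold f /\
          range f `<=` open_geodesic_ball p ((2^-1)%:E * diameter M)%E)).
Proof.
split=> [n M k|n k M].
  exact: no_minimal_nonpositive.
exact: no_minimal_hemisphere.
Qed.
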